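(* For a partition $\Pi=\{0=t_0<t_1<t_2<\cdots\}$ of $[0,\infty)$ with $t_j\uparrow\infty$, let $$V_\Pi(t)=\sum_{0<t_j\le t}|F(t_j)-F(t_{j-1})|^4,\qquad |\Pi|=\sup_j|t_j-t_{j-1}|.$$ Then for all $T>0$, $$\lim_{|\Pi|\to 0}E\left[\sup_{0\le t\le T}\left|V_\Pi(t)-\frac{6}{\pi}\int_0^t|u(q(s),s)|^{-2}\,ds\right|^2\right]=0.$$
   Context: Fix $\alpha\in(0,1)$. Let $B=\{B(t):t\ge 0\}$ be a one-dimensional Brownian motion with random initial position, i.e. $B(t)=B(0)+W(t)$ with $W$ a standard Brownian motion started at $0$ and independent of $B(0)$. Assume $B(0)$ has a density $f\in C^\infty(\mathbb{R})$ that is a Schwartz function, i.e. $\sup_{x\in\mathbb{R}}(1+|x|^n)|f^{(m)}(x)|<\infty$ for all nonnegative integers $n,m$. Assume that $f(x)\,dx$ has a unique $\alpha$-quantile $q(0)$ (i.e. a unique number with $\int_{-\infty}^{q(0)}f(x)\,dx=\alpha$) and that $f(q(0))>0$. Let $u(x,t)$ denote the density of $B(t)$ (so $u(x,0)=f(x)$), and for $t>0$ let $q(t)$ be the (unique) $\alpha$-quantile of the law of $B(t)$. $F=\{F(t):t\ge 0\}$ is a continuous, centered Gaussian process with covariance function $$\rho(s,t)=E[F(s)F(t)]=\frac{P(B(s)\le q(s),\,B(t)\le q(t))-\alpha^2}{u(q(s),s)\,u(q(t),t)}.$$ *)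

(* Defs.v *)
From HB Require Import structures.
From mathcomp Require Import all_boot all_order all_algebra.
From mathcomp Require Import all_classical all_reals all_analysis.

Set Implicit Arguments.
Unset Strict Implicit.
Unset Printing Implicit Defensive.

Import Order.TTheory GRing.Theory Num.Theory.
Import numFieldNormedType.Exports.

Local Open Scope classical_set_scope.
Local Open Scope ring_scope.

Definition schwartz (R : realType) (f : R -> R) : Prop :=
  (forall (m : nat) (x : R), derivable (derive1n m f) x 1) /\
  (forall n m : nat,
    has_ubound (range (fun x : R => (1 + `|x| ^+ n) * `|derive1n m f x|))).

Definition density_law (R : realType) (g : R -> R) (A : set R) : \bar R :=
  (\int[lebesgue_measure]_(x in A) (g x)%:E)%E.

(* [normal_prob m 0] is the uniform law on [0, 1], so the degenerate Gaussian
   law has to be treated separately. *)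
Definition gaussian_law (R : realType) (m s : R) (A : set R) : \bar R :=
  if s == 0 then \d_ m A else normal_prob m s A.

Definition has_law d (Omega : measurableType d) (R : realType)
    (P : probability Omega R) (X : Omega -> R) (mu : set R -> \bar R) : Prop :=
  forall A : set R, measurable A -> P (X @^-1` A) = mu A.

Definition is_density d (Omega : measurableType d) (R : realType)
    (P : probability Omega R) (X : Omega -> R) (g : R -> R) : Prop :=
  [/\ measurable_fun setT g, forall x, 0 <= g x &
      has_law P X (density_law g)].

(* Since all the laws considered are atomless, an [alpha]-quantile is a point
   where the distribution function takes the value [alpha]. *)
Definition is_quantile (R : realType) (alpha : R) (mu : set R -> \bar R)
    (x : R) : Prop :=
  mu `]-oo, x]%classic = alpha%:E.

Definition is_unique_quantile (R : realType) (alpha : R)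
    (mu : set R -> \bar R) (x : R) : Prop :=
  is_quantile alpha mu x /\ forall y, is_quantile alpha mu y -> y = x.

(* A process [X : R -> {RV P >-> R}] stands for [{X t : t >= 0}]: its values at
   negative times are irrelevant, and every condition on [X] below only
   involves times [t >= 0]. *)
Definition continuous_process d (Omega : measurableType d) (R : realType)
    (P : probability Omega R) (X : R -> {RV P >-> R}) : Prop :=
  {ae P, forall w, {within `[0, +oo[, continuous (fun t : R => X t w)}}.

(* For a finite family the product rule over the whole family gives the rule
   over subfamilies, by taking some of the sets [A i] to be [setT]. *)
Definition mutually_independent d (Omega : measurableType d) (R : realType)
    (P : probability Omega R) (n : nat) (X : 'I_n -> Omega -> R) : Prop :=
  forall A : 'I_n -> set R, (forall i, measurable (A i)) ->
    P (\bigcap_(i in [set: 'I_n]) (X i @^-1` A i))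
    = (\prod_(i < n) P (X i @^-1` A i))%E.

Definition standard_brownian_motion d (Omega : measurableType d)
    (R : realType) (P : probability Omega R) (W : R -> {RV P >-> R}) : Prop :=
  [/\ {ae P, forall w, W 0 w = 0},
      forall (n : nat) (t : nat -> R), 0 <= t 0%N ->
        (forall i, (i < n)%N -> t i < t i.+1) ->
        mutually_independent P
          (fun (i : 'I_n) w => W (t i.+1) w - W (t i) w),
      forall s t : R, 0 <= s -> s < t ->
        has_law P (fun w => W t w - W s w)
          (normal_prob 0 (Num.sqrt (t - s))) &
      continuous_process W].

Definition process_sigma_algebra d (Omega : measurableType d) (R : realType)
    (P : probability Omega R) (W : R -> {RV P >-> R}) : set (set Omega) :=
  <<s [set E | exists t : R, exists A : set R,
         [/\ 0 <= t, measurable A & E = W t @^-1` A]] >>.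

Definition independent_of_process d (Omega : measurableType d) (R : realType)
    (P : probability Omega R) (X : {RV P >-> R}) (W : R -> {RV P >-> R}) :
    Prop :=
  forall (A : set R) (E : set Omega),
    measurable A -> process_sigma_algebra W E ->
    P (X @^-1` A `&` E) = (P (X @^-1` A) * P E)%E.

Definition gaussian_process d (Omega : measurableType d) (R : realType)
    (P : probability Omega R) (F : R -> {RV P >-> R}) : Prop :=
  forall (n : nat) (t c : 'I_n -> R), (forall i, 0 <= t i) ->
    exists m s : R, 0 <= s /\
      has_law P (fun w => \sum_(i < n) c i * F (t i) w) (gaussian_law m s).

Definition centered_process d (Omega : measurableType d) (R : realType)
    (P : probability Omega R) (F : R -> {RV P >-> R}) : Prop :=
  forall t : R, 0 <= t -> ('E_P[F t] = 0)%E.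

Definition has_covariance d (Omega : measurableType d) (R : realType)
    (P : probability Omega R) (F : R -> {RV P >-> R}) (r : R -> R -> R) :
    Prop :=
  forall s t : R, 0 <= s -> 0 <= t ->
    ('E_P[fun w => (F s w * F t w)%R] = (r s t)%:E)%E.

Definition rho d (Omega : measurableType d) (R : realType)
    (P : probability Omega R) (alpha : R) (B : R -> {RV P >-> R})
    (u : R -> R -> R) (q : R -> R) (s t : R) : R :=
  (fine (P [set w | B s w <= q s /\ B t w <= q t]) - alpha ^+ 2)
  / (u (q s) s * u (q t) t).

Definition is_partition (R : realType) (p : nat -> R) : Prop :=
  [/\ p 0%N = 0, forall j : nat, p j < p j.+1 & p n @[n --> \oo] --> +oo].

Definition mesh (R : realType) (p : nat -> R) : \bar R :=
  ereal_sup (range (fun j : nat => (`|p j.+1 - p j|)%:E)).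

(* The index set is finite because [p] tends to infinity, and [0 < p j] forces
   [j > 0] because [p 0 = 0]. *)
Definition quartic_variation (Omega : Type) (R : realType)
    (F : R -> Omega -> R) (p : nat -> R) (t : R) (w : Omega) : R :=
  \sum_(j \in [set j : nat | 0 < p j <= t]) `|F (p j) w - F (p j.-1) w| ^+ 4.

(* Main.v *)
Require Import Defs.
From HB Require Import structures.
From mathcomp Require Import all_boot all_order all_algebra.
From mathcomp Require Import all_classical all_reals all_analysis.
From mathcomp Require Import measurable_realfun.
From mathcomp Require Import ring lra.

Import Order.TTheory GRing.Theory Num.Theory.
Import numFieldNormedType.Exports.

Local Open Scope classical_set_scope.
Local Open Scope ring_scope.

(** Write [U s = u (q s) s], [X_j = F (p j.+1) - F (p j)], [v_j] for the
    variance of [X_j] and [r_ij] for the covariance of [X_i] and [X_j].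

    The mean.  As [X_j] is a centered Gaussian variable, its fourth moment is
    [3 v_j ^ 2].  The variance of [F t - F s] is governed by the probability
    that [B] is below its quantile at time [s] and above it at time [t]
    (the crossing probability).  Given the increment [D] of [B] over [[s, t]],
    which is independent of [B s], this happens when [B s] falls in the
    interval of length about [D] just below [q s]; hence the crossing
    probability is [U s * E (max D 0)] up to [O(t - s)], where
    [E (max D 0) = sqrt ((t - s) / (2 pi))].  Dividing by the densities, the
    variance of [F t - F s] is [sqrt (2 / pi) * sqrt (t - s) / U s] up to
    [O(t - s)], so [3 v_j ^ 2] is [(6 / pi) (p j.+1 - p j) / U (p j) ^ 2] up to
    a smaller order, and the sum of these means is a Riemann sum for the limit
    ([variance_asymptotics], [compensator_asymptotics]).

    The fluctuations.  The covariance of [X_i ^ 4] and [X_j ^ 4] is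
    [72 v_i v_j r_ij ^ 2 + 24 r_ij ^ 4], at most [96 v_i v_j r_ij ^ 2].  Pairs of
    steps at distance less than [eta] contribute [O(eta)] to the variance of the
    quartic variation, because [v_j ^ 2 = O(p j.+1 - p j)] and
    [r_ij ^ 2 <= v_i v_j].  For the other pairs [r_ij ^ 2] is at most a constant
    depending on [eta] times the product of the lengths of the two steps, while
    [v_i v_j] is small with the mesh, so their contribution vanishes
    ([covariance_decay_rho], [double_sum_bound]).  The reason for this decay is
    that moving the first time from [s1] to [t1] only alters an event of
    probability [O(sqrt (t1 - s1))] of the past of [t1], and that, conditionally
    on this past, the probability of being below the quantile at a time later
    than [t1 + eta] changes by [O(sqrt (t2 - s2))] from [s2] to [t2], because
    the increment of [B] since [t1] has a bounded density.  Together
    these facts give convergence in mean square at each fixed time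
    ([L2_convergence]).

    The supremum.  The quartic variation and its limit are nondecreasing in
    time and the limit is continuous, so convergence on a fine finite grid
    forces uniform convergence ([uniform_L2_convergence]).

    The density [f] enters through a bound and a Lipschitz constant: convolution
    with the law of an increment preserves the second order expansion of the
    distribution function of [B 0], so that [u] is the derivative in [x] of the
    distribution function of [B s], with Lipschitz constant uniform in time.
    Since a Brownian increment is centered, the distribution function is also
    Lipschitz in time; hence [q] is locally Lipschitz, and [U] is locally
    1/2-Hoelder and bounded away from 0 on compact intervals
    ([quantile_regularity]). *)
Set Implicit Arguments.
Unset Strict Implicit.
Unset Printing Implicit Defensive.

(** * Expectation on a probability space *)

Section Expectation.
Context {d : measure_display} {T : measurableType d} {R : realType}.
Variable P : probability T R.
Implicit Types X Y : T -> R.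

Definition intg X : Prop := P.-integrable setT (EFin \o X).
Definition Ex X : R := \int[P]_w X w.

Lemma intg_meas X : intg X -> measurable_fun setT X.
Proof. by move=> /integrableP[/measurable_EFinP]. Qed.

Lemma intg_cst c : intg (fun=> c).
Proof. by apply: finite_measure_integrable_cst. Qed.

Lemma intgD X Y : intg X -> intg Y -> intg (fun w => X w + Y w).
Proof. by move=> iX iY; have := integrableD measurableT iX iY. Qed.

Lemma intgB X Y : intg X -> intg Y -> intg (fun w => X w - Y w).
Proof. by move=> iX iY; have := integrableB measurableT iX iY. Qed.

Lemma intgZ c X : intg X -> intg (fun w => c * X w).
Proof. by move=> iX; have := integrableZl measurableT c iX. Qed.

Lemma intg_sum (I : Type) (r : seq I) (p : pred I) (X : I -> T -> R) :
  (forall i, p i -> intg (X i)) -> intg (fun w => \sum_(i <- r | p i) X i w).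
Proof.
move=> iX; have -> : (fun w => \sum_(i <- r | p i) X i w)
    = (\sum_(i <- r | p i) X i).
  by apply/funext => w; rewrite fct_sumE.
elim/big_ind : _ => //; first exact: (intg_cst 0).
by move=> U V; exact: intgD.
Qed.

Lemma intg_le X Y : measurable_fun setT X -> (forall w, `|X w| <= Y w) ->
  intg Y -> intg X.
Proof.
move=> mX XY; apply: le_integrable => //; first exact/measurable_EFinP.
by move=> w _ /=; rewrite lee_fin (le_trans (XY w))// ler_norm.
Qed.

Lemma intg_bounded X c : measurable_fun setT X -> (forall w, `|X w| <= c) ->
  intg X.
Proof. by move=> mX Xc; apply: intg_le Xc (intg_cst c). Qed.

Lemma Ex_cst c : Ex (fun=> c) = c.
Proof. by rewrite /Ex Rintegral_cst//= (@probability_setT _ _ _ P) mulr1. Qed.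

Lemma ExD X Y : intg X -> intg Y -> Ex (fun w => X w + Y w) = Ex X + Ex Y.
Proof. exact: RintegralD. Qed.

Lemma ExB X Y : intg X -> intg Y -> Ex (fun w => X w - Y w) = Ex X - Ex Y.
Proof. exact: RintegralB. Qed.

Lemma ExZ c X : intg X -> Ex (fun w => c * X w) = c * Ex X.
Proof. exact: RintegralZl. Qed.

Lemma Ex_sum (I : Type) (r : seq I) (p : pred I) (X : I -> T -> R) :
  (forall i, p i -> intg (X i)) ->
  Ex (fun w => \sum_(i <- r | p i) X i w) = \sum_(i <- r | p i) Ex (X i).
Proof.
move=> iX; elim: r => [|i r IH].
  by under [X in Ex X]funext do rewrite big_nil; rewrite Ex_cst big_nil.
under [X in Ex X]funext do rewrite big_cons.
rewrite big_cons; case: ifPn => // pi.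
by rewrite ExD ?IH//; [exact: iX|exact: intg_sum].
Qed.

Lemma Ex_le X Y : intg X -> intg Y -> (forall w, X w <= Y w) -> Ex X <= Ex Y.
Proof. by move=> iX iY XY; apply: le_Rintegral. Qed.

Lemma Ex_ge0 X : (forall w, 0 <= X w) -> 0 <= Ex X.
Proof. by move=> X0; apply: Rintegral_ge0. Qed.

Lemma Ex_norm_le X Y : measurable_fun setT X -> intg Y ->
  (forall w, `|X w| <= Y w) -> `|Ex X| <= Ex Y.
Proof.
move=> mX iY XY; have iX := intg_le mX XY iY.
rewrite (le_trans (le_normr_Rintegral _ _))//.
by apply: Ex_le => //; apply: intg_le iY => //;
  [exact: measurableT_comp|move=> w; rewrite normr_id].
Qed.

Lemma Ex_indic (A : set T) : measurable A -> Ex \1_A = fine (P A).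
Proof. by move=> mA; rewrite /Ex /Rintegral integral_indic// setIT. Qed.

Lemma intg_indic (A : set T) : measurable A -> intg \1_A.
Proof.
move=> mA; apply: (@intg_bounded _ 1); first exact: measurable_indic.
by move=> w; rewrite indicE; case: (_ \in _); rewrite ?normr1 ?normr0.
Qed.

Lemma integral_EFin_Ex X : intg X -> (\int[P]_w (X w)%:E = (Ex X)%:E)%E.
Proof.
by move=> iX; rewrite /Ex /Rintegral fineK//; exact: integrable_fin_num iX.
Qed.

Lemma intg_ge0 X r : measurable_fun setT X -> (forall w, 0 <= X w) ->
  (\int[P]_w (X w)%:E = r%:E)%E -> intg X /\ Ex X = r.
Proof.
move=> mX X0 E; split; last by rewrite /Ex /Rintegral E.
apply/integrableP; split; first exact/measurable_EFinP.
by under eq_integral do rewrite /= ger0_norm//; rewrite E ltry.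
Qed.

End Expectation.

Lemma law_Ex {d} {T : measurableType d} {R : realType} (P : probability T R)
  {d' : measure_display} {U : measurableType d'} (N : probability U R)
  (X : T -> U) (h : U -> R) :
  measurable_fun setT X ->
  (forall A, measurable A -> P (X @^-1` A) = N A) -> intg N h ->
  intg P (fun w => h (X w)) /\ Ex P (fun w => h (X w)) = Ex N h.
Proof.
move=> mX XN ih; have mh := intg_meas ih.
have lawE (g : U -> \bar R) : measurable_fun setT g -> (forall x, 0 <= g x)%E ->
    (\int[P]_w g (X w) = \int[N]_x g x)%E.
  move=> mg g0.
  rewrite -(@eq_measure_integral _ _ _ setT N (pushforward P X)); last first.
    by move=> A mA _; exact: XN.
  by rewrite ge0_integral_pushforward.
have ihX : intg P (fun w => h (X w)).
  apply/integrableP; split; first by apply/measurable_EFinP; exact: measurableT_comp.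
  rewrite (lawE (fun x => `|(h x)%:E|)%E)//=.
    by have /integrableP[_] := ih.
  by do 2 apply: measurableT_comp => //.
split => //; rewrite /Ex /Rintegral; congr fine.
rewrite -(@eq_measure_integral _ _ _ setT N (pushforward P X)); last first.
  by move=> A mA _; exact: XN.
by rewrite (integral_pushforward mX)//; exact/measurable_EFinP.
Qed.

Lemma RV_measurable {d} {T : measurableType d} {R : realType} (P : probability T R)
  (X : {RV P >-> R}) : measurable_fun setT (X : T -> R).
Proof. exact: measurable_funPT. Qed.

(** The normal density is a version of the Radon-Nikodym derivative of the
    normal law, so the change of variables formula for that derivative holds
    with it up to a null set. *)
Lemma integral_normal_prob {R : realType} (m s : R) (f : R -> R) : s != 0 ->
  measurable_fun setT f -> (forall x, 0 <= f x) ->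
  (\int[normal_prob m s]_x (f x)%:E =
   \int[lebesgue_measure]_x (f x * normal_pdf m s x)%:E)%E.
Proof.
move=> s0 mf f0; have dom := normal_prob_dominates m s.
have mf' : measurable_fun setT (EFin \o f) by exact/measurable_EFinP.
have mg : measurable_fun setT (EFin \o normal_pdf m s).
  by apply/measurable_EFinP; exact: measurable_normal_pdf.
under [RHS]eq_integral do rewrite EFinM.
rewrite -(Radon_Nikodym_SigmaFinite.change_of_variables dom _ measurableT mf') => [|x]; last first.
  by rewrite lee_fin.
have mr := measurable_int _ (Radon_Nikodym_SigmaFinite.f_integrable dom).
apply: ae_eq_integral => //; first exact: emeasurable_funM.
  exact: emeasurable_funM.
apply: ae_eqe_mul2l.
apply: integral_ae_eq => //; first exact: Radon_Nikodym_SigmaFinite.f_integrable.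
by move=> A _ mA; rewrite -Radon_Nikodym_SigmaFinite.f_integral.
Qed.

(** * Absolute moments of the centered normal law *)

Section NormalHalfLine.
Context {R : realType}.
Variable s : R.
Hypothesis s0 : 0 < s.
Local Notation mu := (@lebesgue_measure R).

(** The normal density without its normalizing constant. *)
Definition gaussian_bump (x : R) : R := expR (- (x ^+ 2 / (2 * s ^+ 2))).
Local Notation g := gaussian_bump.

Lemma bump_gt0 x : 0 < g x. Proof. exact: expR_gt0. Qed.

Lemma is_derive_bump (x : R) : is_derive x 1 g (- (x / s ^+ 2) * g x).
Proof.
rewrite /gaussian_bump.
have h : is_derive x 1 (fun x : R => - (x ^+ 2 / (2 * s ^+ 2))) (- (x / s ^+ 2)).
  have -> : (fun x : R => - (x ^+ 2 / (2 * s ^+ 2)))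
     = ((- (2 * s ^+ 2)^-1) \*: ((@id R) ^+ 2)).
    by apply/funext => y /=; rewrite /GRing.scale /= mulrC mulNr.
  apply: is_derive_eq.
  rewrite /GRing.scale /= expr1 mulr1; by field; rewrite gt_eqF.
have := @is_derive1_comp R expR (fun x : R => - (x ^+ 2 / (2 * s ^+ 2))) x _ _ (is_derive_expR _) h.
by move=> H; apply: (is_derive_eq H); exact: mulrC.
Qed.

(** This antiderivative vanishes at [0] and at infinity; integrating its
    derivative therefore gives a two-term recursion between moments. *)
Lemma is_derive_xbump (n : nat) (x : R) :
  is_derive x 1 (fun x => - s ^+ 2 * (x ^+ n.+1 * g x))
    (x ^+ n.+2 * g x - n.+1%:R * s ^+ 2 * (x ^+ n * g x)).
Proof.
have h1 := is_derive_bump x.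
have h2 : is_derive x 1 (fun x : R => x ^+ n.+1) (n.+1%:R * x ^+ n).
  have := @is_deriveX R R (@id R) n.+1 x 1 1 (is_derive_id _ _).
  rewrite /GRing.scale/= mulr1 => h.
  have -> : (fun x : R => x ^+ n.+1) = ((@id R) ^+ n.+1).
    by apply/funext => y; rewrite exprfctE.
  exact: h.
have h3 := is_deriveM h2 h1.
have h4 := is_deriveZ (- s ^+ 2) h3.
apply: (is_derive_eq h4); rewrite /GRing.scale /= !exprS.
by field; rewrite gt_eqF.
Qed.

(** The exponential series dominates its term of order [n.+1], which beats
    [x ^+ n] by a factor [x] at least. *)
Lemma cvg_xbump (n : nat) : (x ^+ n * g x) @[x --> +oo] --> (0 : R).
Proof.
pose C : R := (n.+1)`!%:R * (2 * s ^+ 2) ^+ n.+1.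
have C0 : 0 < C by rewrite mulr_gt0// ?ltr0n ?fact_gt0// exprn_gt0// mulr_gt0// exprn_gt0.
apply/cvgrPdist_le => e e0; near=> x.
have x1 : 1 <= x by near: x; apply: nbhs_pinfty_ge; exact: num_real.
have x0 : 0 < x by exact: lt_le_trans x1.
have xC : C / e <= x by near: x; apply: nbhs_pinfty_ge; exact: num_real.
rewrite sub0r normrN ger0_norm; last by rewrite mulr_ge0 ?exprn_ge0 ?(ltW (bump_gt0 _))// ltW.
have y0 : 0 < x ^+ 2 / (2 * s ^+ 2) by rewrite divr_gt0// ?exprn_gt0// mulr_gt0// exprn_gt0.
have gC : g x <= C / x ^+ (2 * n.+1)%N.
  rewrite /gaussian_bump expRN.
  rewrite -[leRHS]invrK lef_pV2 ?posrE ?expR_gt0 ?invr_gt0 ?divr_gt0 ?exprn_gt0//.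
  have := @expR_ge1Dxn R _ n (ltW y0); apply: le_trans.
  rewrite invf_div /C expr_div_n -exprM.
  rewrite -[leLHS]add0r lerD//.
  rewrite le_eqVlt; apply/orP; left; apply/eqP; field.
  by rewrite !expf_neq0 ?mulf_neq0 ?gt_eqF// ?ltr0n ?fact_gt0// ?pnatr_eq0.
apply: le_trans (_ : x ^+ n * (C / x ^+ (2 * n.+1)%N) <= _).
  by rewrite ler_pM2l ?exprn_gt0.
have -> : x ^+ n * (C / x ^+ (2 * n.+1)%N) = (C / x) / x ^+ n.+1.
  rewrite mulSn mul1n exprD !exprS; field.
  by rewrite !expf_neq0 ?gt_eqF.
rewrite ler_pdivrMr ?exprn_gt0//.
apply: (@le_trans _ _ e).
  by rewrite ler_pdivrMr// mulrC -ler_pdivrMr.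
by rewrite ler_peMr// ?(ltW e0)// exprn_ege1.
Unshelve. all: by end_near. Qed.

Lemma continuous_bump : continuous g.
Proof.
move=> x; have [h _] := is_derive_bump x.
by apply/differentiable_continuous/derivable1_diffP.
Qed.

Lemma continuous_xbump n : continuous (fun x : R => x ^+ n * g x).
Proof.
move=> x; apply: cvgM; last exact: continuous_bump.
exact: exprn_continuous.
Qed.

Lemma measurable_xbump n : measurable_fun setT (fun x : R => x ^+ n * g x).
Proof. by apply: continuous_measurable_fun; exact: continuous_xbump. Qed.

Definition half_moment n : \bar R := (\int[mu]_(x in `[0%R, +oo[) (x ^+ n * g x)%:E)%E.

Lemma half_moment1 : half_moment 1 = (s ^+ 2)%:E.
Proof.
have dG (x : R) : is_derive x 1 (fun x : R => - s ^+ 2 * (x ^+ 0 * g x)) (x ^+ 1 * g x).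
  have h := is_deriveZ (- s ^+ 2) (is_derive_bump x).
  have -> : (fun x => - s ^+ 2 * (x ^+ 0 * g x)) = (- s ^+ 2) \*: g.
    by apply/funext => y /=; rewrite expr0 mul1r.
  apply: (is_derive_eq h); rewrite /GRing.scale /= expr1.
  by field; rewrite gt_eqF.
rewrite /half_moment (@ge0_continuous_FTC2y _ _ (fun x => - s ^+ 2 * (x ^+ 0 * g x)) 0 0).
- by rewrite -EFinB expr0 mul1r /gaussian_bump expr0n/= mul0r oppr0 expR0 mulr1 sub0r opprK.
- by move=> x x0; rewrite mulr_ge0// ?(ltW (bump_gt0 _)).
- by apply: continuous_subspaceT; exact: continuous_xbump.
- by rewrite -(mulr0 (- s ^+ 2)); apply: cvgM; [exact: cvg_cst|exact: cvg_xbump].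
- by move=> x _; have [] := dG x.
- by apply: cvg_at_right_filter; apply: cvgM; [exact: cvg_cst|exact: continuous_xbump].
- by move=> x _; rewrite derive1E; have h := dG x; exact: derive_val.
Qed.

(** Integration by parts.  The integrand [f] below is nonnegative only from
    [s * sqrt n.+1] on, so the half-line is cut at a point [a] beyond: on [[0, a]]
    everything is integrable by compactness, and on the rest the fundamental
    theorem of calculus for nonnegative integrands applies.  The two boundary
    values at [a] cancel. *)
Lemma half_moment_rec n :
  half_moment n.+2 = ((n.+1%:R * s ^+ 2)%R%:E * half_moment n)%E.
Proof.
have ge0 k (x : R) : 0 <= x -> 0 <= x ^+ k * g x.
  by move=> x0; rewrite mulr_ge0 ?exprn_ge0// ltW// bump_gt0.
pose G (x : R) := - s ^+ 2 * (x ^+ n.+1 * g x).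
pose f (x : R) := x ^+ n.+2 * g x - n.+1%:R * s ^+ 2 * (x ^+ n * g x).
have dG (x : R) : is_derive x 1 G (f x) := is_derive_xbump n x.
have cf : continuous f.
  move=> x; apply: cvgB; first exact: continuous_xbump.
  by apply: cvgM; [exact: cvg_cst|exact: continuous_xbump].
have cG : continuous G.
  by move=> x; apply: cvgM; [exact: cvg_cst|exact: continuous_xbump].
pose a := s * n.+1%:R.
have a0 : 0 < a by rewrite mulr_gt0// ltr0n.
have Ia : (\int[mu]_(x in `[0%R, a]) (f x)%:E = (G a)%:E)%E.
  rewrite (@continuous_FTC2 _ _ G)//.
  - by rewrite {2}/G expr0n/= mul0r mulr0 sube0.
  - exact: continuous_subspaceT.
  - split.
    + by move=> x _; have [] := dG x.
    + by apply: cvg_at_right_filter; exact: cG.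
    + by apply: cvg_at_left_filter; exact: cG.
  - by move=> x _; rewrite derive1E; have h := dG x; exact: derive_val.
have f0 x : a <= x -> 0 <= f x.
  move=> ax; have -> : f x = (x * x - n.+1%:R * s ^+ 2) * (x ^+ n * g x).
    by rewrite /f !exprS; ring.
  apply: mulr_ge0; last by apply: ge0; exact: le_trans (ltW a0) ax.
  rewrite subr_ge0.
  apply: (@le_trans _ _ (a * a)); last by rewrite ler_pM// ltW.
  rewrite /a mulrACA mulrC -expr2 ler_pM2l ?exprn_gt0//.
  by rewrite -natrM ler_nat leq_pmull.
have Ib : (\int[mu]_(x in `[a, +oo[) (f x)%:E = (- G a)%:E)%E.
  rewrite (@ge0_continuous_FTC2y _ _ G _ 0).
  - by rewrite sub0e.
  - exact: f0.
  - exact: continuous_subspaceT.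
  - by rewrite -(mulr0 (- s ^+ 2)); apply: cvgM; [exact: cvg_cst|exact: cvg_xbump].
  - by move=> x _; have [] := dG x.
  - by apply: cvg_at_right_filter; exact: cG.
  - by move=> x _; rewrite derive1E; have h := dG x; exact: derive_val.
have split01 k : half_moment k =
    (\int[mu]_(x in `[0%R, a]) (x ^+ k * g x)%:E +
     \int[mu]_(x in `]a, +oo[) (x ^+ k * g x)%:E)%E.
  rewrite /half_moment (@itv_bndbnd_setU _ _ _ (BRight a)) ?bnd_simp ?ltW//.
  rewrite ge0_integral_setU//.
  - by apply/measurable_EFinP/measurable_funTS; exact: measurable_xbump.
  - move=> x [|] /=; rewrite in_itv/= lee_fin => /andP[x0 _]; apply: ge0 => //.
    by rewrite (le_trans (ltW a0))// ltW.
  - apply/disj_setPS => y [/=]; rewrite 2!in_itv/= => /andP[_ ya] /andP[].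
    by rewrite ltNge ya.
have c0 : (0%R <= (n.+1%:R * s ^+ 2)%R%:E)%E by rewrite lee_fin mulr_ge0// exprn_ge0// ltW.
have xfE x : x ^+ n.+2 * g x = f x + n.+1%:R * s ^+ 2 * (x ^+ n * g x).
  by rewrite /f subrK.
have mx k D : measurable_fun D (fun x : R => (x ^+ k * g x)%:E).
  by apply/measurable_EFinP/measurable_funTS; exact: measurable_xbump.
have mf D : measurable_fun D (fun x : R => (f x)%:E).
  apply/measurable_EFinP/measurable_funTS; exact: continuous_measurable_fun.
have Ea : (\int[mu]_(x in `[0%R, a]) (x ^+ n.+2 * g x)%:E = (G a)%:E +
    (n.+1%:R * s ^+ 2)%R%:E * \int[mu]_(x in `[0%R, a]) (x ^+ n * g x)%:E)%E.
  under eq_integral do rewrite xfE EFinD.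
  have cpt (h : R -> R) : continuous h -> mu.-integrable `[0, a] (EFin \o h).
    move=> ch; apply: continuous_compact_integrable; first exact: segment_compact.
    exact: continuous_subspaceT.
  have cc : continuous (fun x : R => n.+1%:R * s ^+ 2 * (x ^+ n * g x)).
    by move=> x; apply: cvgM; [exact: cvg_cst|exact: continuous_xbump].
  rewrite (@integralD_EFin _ _ _ mu)//=; [|exact: cpt|exact: cpt].
  rewrite Ia; congr (_ + _)%E; under eq_integral do rewrite EFinM.
  by rewrite integralZl//; apply: cpt; exact: continuous_xbump.
have Eb : (\int[mu]_(x in `]a, +oo[) (x ^+ n.+2 * g x)%:E = (- G a)%:E +
    (n.+1%:R * s ^+ 2)%R%:E * \int[mu]_(x in `]a, +oo[) (x ^+ n * g x)%:E)%E.
  under eq_integral do rewrite xfE EFinD EFinM.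
  have mc : measurable_fun `]a, +oo[
      (fun x : R => (n.+1%:R * s ^+ 2)%R%:E * (x ^+ n * g x)%:E)%E.
    by apply: emeasurable_funM => //; exact: mx.
  rewrite ge0_integralD//=; last 3 first.
  - by move=> x; rewrite in_itv/= andbT => ax; rewrite lee_fin f0// ltW.
  - exact: mf.
  - move=> x; rewrite in_itv/= andbT => ax.
    by rewrite mule_ge0// lee_fin ge0// (le_trans (ltW a0))// ltW.
  rewrite ge0_integralZl_EFin//; last 2 first.
  - move=> x; rewrite /= in_itv/= andbT => ax.
    by rewrite lee_fin ge0// (le_trans (ltW a0))// ltW.
  - exact: mx.
  by rewrite integral_itv_obnd_cbnd// Ib.
have I1 : (0 <= \int[mu]_(x in `[0%R, a]) (x ^+ n * g x)%:E)%E.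
  apply: integral_ge0 => x /=; rewrite in_itv/= lee_fin => /andP[x0 _].
  exact: ge0.
have I2 : (0 <= \int[mu]_(x in `]a, +oo[) (x ^+ n * g x)%:E)%E.
  apply: integral_ge0 => x /=; rewrite in_itv/= lee_fin => /andP[x0 _].
  by apply: ge0; rewrite (le_trans (ltW a0))// ltW.
by rewrite !split01 Ea Eb (ge0_muleDr _ I1 I2) addeACA -EFinD subrr add0e.
Qed.

End NormalHalfLine.

Section NormalMoments.
Context {R : realType}.
Variable s : R.
Hypothesis s0 : 0 < s.
Local Notation mu := (@lebesgue_measure R).
Local Notation g := (gaussian_bump s).
Local Notation N := (normal_prob 0 s).

Lemma normal_pdf_bump x : normal_pdf 0 s x = normal_peak s * g x.
Proof.
rewrite normal_pdfE ?gt_eqF//; congr (_ * _).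
by rewrite /normal_fun /gaussian_bump subr0 mulNr mulr_natl.
Qed.

Lemma measurable_absX n : measurable_fun setT (fun x : R => `|x| ^+ n).
Proof. by apply: measurable_funX; exact: normr_measurable. Qed.

Lemma half_lineE (f : R -> R) :
  (\int[mu]_(x in `[0%R, +oo[) (f x)%:E =
   \int[mu]_(x in [set x | (0 <= x)%R]) (f x)%:E)%E.
Proof. by congr integral; apply/seteqP; split => x /=; rewrite in_itv/= andbT. Qed.

Lemma peak_half_moment n : ((normal_peak s)%:E * half_moment s n =
  \int[mu]_(x in `[0%R, +oo[) (`|x| ^+ n * normal_pdf 0 s x)%:E)%E.
Proof.
rewrite /half_moment -ge0_integralZl_EFin//; last 3 first.
- move=> x /=; rewrite in_itv/= andbT => x0.
  by rewrite lee_fin mulr_ge0 ?exprn_ge0 ?(ltW (bump_gt0 _ _)).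
- by apply/measurable_EFinP/measurable_funTS; exact: measurable_xbump.
- exact: normal_peak_ge0.
apply: eq_integral => x; rewrite inE/= in_itv/= andbT => x0.
by rewrite -EFinM normal_pdf_bump ger0_norm// mulrCA.
Qed.

Lemma normal_abs_moment n :
  (\int[N]_x (`|x| ^+ n)%:E = (2 * normal_peak s)%:E * half_moment s n)%E.
Proof.
rewrite integral_normal_prob ?lt0r_neq0//; last exact: measurable_absX.
rewrite ge0_symfun_integralT//.
- by rewrite EFinM -muleA peak_half_moment half_lineE.
- by move=> x; rewrite mulr_ge0 ?exprn_ge0 ?normal_pdf_ge0.
- move=> x; apply: cvgM; last by apply: continuous_normal_pdf; rewrite gt_eqF.
  apply: (@continuous_comp _ _ _ (fun x : R => `|x|) (fun x => x ^+ n)).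
    exact: norm_continuous.
  exact: exprn_continuous.
- by move=> x /=; rewrite normrN !normal_pdf_bump /gaussian_bump sqrrN.
Qed.

Lemma half_moment0 : ((2 * normal_peak s)%:E * half_moment s 0 = 1)%E.
Proof.
rewrite -normal_abs_moment; under eq_integral do rewrite expr0.
rewrite integral_cst// mul1e; exact: probability_setT.
Qed.

(** The left-hand side is the mean of the absolute value of the variable, the
    factor [s ^+ 2] being the first half-line moment of the bump. *)
Lemma peak2 : 2 * normal_peak s * s ^+ 2 = s * Num.sqrt (2 / pi).
Proof.
rewrite /normal_peak; move: (pi : R) (@pi_gt0 R) => p p0.
rewrite -mulrnAr sqrtrM ?sqr_ge0// sqrtr_sqr gtr0_norm//.
have -> : p *+ 2 = 2 ^+ 2 / (2 / p) by rewrite mulr2n; field; rewrite gt_eqF.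
rewrite sqrtrM ?exprn_ge0// sqrtr_sqr ger0_norm// sqrtrV ?divr_ge0// ?ltW//.
have q0 : 0 < Num.sqrt (2 / p) by rewrite sqrtr_gt0 divr_gt0.
by field; rewrite !gt_eqF.
Qed.

Lemma normal_moment_rec n r : (\int[N]_x (`|x| ^+ n)%:E = r%:E)%E ->
  (\int[N]_x (`|x| ^+ n.+2)%:E = (n.+1%:R * s ^+ 2 * r)%:E)%E.
Proof.
by rewrite !normal_abs_moment (half_moment_rec s0) muleCA => ->.
Qed.

Lemma normal_moment0 : (\int[N]_x (`|x| ^+ 0)%:E = 1%:E)%E.
Proof. by rewrite normal_abs_moment half_moment0. Qed.

Lemma intg_normal n r : (\int[N]_x (`|x| ^+ n)%:E = r%:E)%E ->
  intg N (fun x => `|x| ^+ n) /\ Ex N (fun x => `|x| ^+ n) = r.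
Proof.
apply: intg_ge0; last by move=> x; rewrite exprn_ge0.
exact: measurable_absX.
Qed.

Lemma normal_even n : ~~ odd n -> (fun x : R => `|x| ^+ n) = (fun x => x ^+ n).
Proof.
move=> on; apply/funext => x; rewrite -normrX ger0_norm//.
by rewrite -(odd_double_half n) (negbTE on) add0n -mul2n mulnC exprM sqr_ge0.
Qed.

Lemma normal_moment2 : intg N (fun x => x ^+ 2) /\ Ex N (fun x => x ^+ 2) = s ^+ 2.
Proof.
rewrite -(@normal_even 2)//; have := intg_normal (normal_moment_rec normal_moment0).
by rewrite mul1r mulr1.
Qed.

Lemma normal_moment4 : intg N (fun x => x ^+ 4) /\
  Ex N (fun x => x ^+ 4) = 3 * s ^+ 4.
Proof.
rewrite -(@normal_even 4)//.
have [? ->] := intg_normal (normal_moment_rec (normal_moment_rec normal_moment0)).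
by split => //; ring.
Qed.

Lemma normal_moment8 : intg N (fun x => x ^+ 8) /\
  Ex N (fun x => x ^+ 8) = 105 * s ^+ 8.
Proof.
rewrite -(@normal_even 8)//.
have [? ->] := intg_normal (normal_moment_rec (normal_moment_rec
  (normal_moment_rec (normal_moment_rec normal_moment0)))).
by split => //; ring.
Qed.

Lemma normal_abs : intg N (fun x => `|x|) /\
  Ex N (fun x => `|x|) = s * Num.sqrt (2 / pi).
Proof.
have := @intg_normal 1 _ _; apply; rewrite normal_abs_moment half_moment1//.
by rewrite -EFinM peak2.
Qed.

Lemma normal_pos : intg N (fun x => Num.max x 0) /\
  Ex N (fun x => Num.max x 0) = s * Num.sqrt (2 / pi) / 2.
Proof.
have m0 : measurable_fun setT (fun x : R => Num.max x 0) by exact: measurable_maxr.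
apply: intg_ge0 => //; first by move=> x; rewrite le_max lexx orbT.
rewrite integral_normal_prob ?lt0r_neq0//; last by move=> x; rewrite le_max lexx orbT.
transitivity ((normal_peak s)%:E * half_moment s 1)%E; last first.
  rewrite half_moment1// -EFinM; congr EFin.
  by rewrite -peak2; field.
rewrite peak_half_moment [RHS]integral_mkcond; apply: eq_integral => x _.
rewrite /restrict /= mem_setE in_itv/= andbT.
case: leP => // x0; last by rewrite mul0r.
by rewrite ger0_norm.
Qed.

Lemma normal_mean : intg N id /\ Ex N id = 0.
Proof.
have [ia Ea] := normal_abs; have [ip Ep] := normal_pos.
have -> : id = (fun x : R => 2 * Num.max x 0 - `|x|).
  by apply/funext => x; case: (lerP x 0) => x0;
    [rewrite ler0_norm|rewrite gtr0_norm]; rewrite //; ring.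
split; first by apply: intgB => //; exact: intgZ.
by rewrite ExB ?ExZ ?Ea ?Ep//; [field|exact: intgZ].
Qed.

End NormalMoments.

(** * Moments of a variable with a Gaussian law *)

Lemma normal_shift_integral {R : realType} (m s : R) (h : R -> R) : 0 < s ->
  continuous h -> (forall x, 0 <= h x) ->
  (\int[normal_prob m s]_x (h (x - m))%:E = \int[normal_prob 0 s]_x (h x)%:E)%E.
Proof.
move=> s0 ch h0; have s0' : s != 0 by rewrite gt_eqF.
have chm : continuous (fun x : R => h (x - m)).
  by move=> x; apply: continuous_comp; [apply: cvgB; [exact: cvg_id|exact: cvg_cst]|exact: ch].
have mh : measurable_fun setT h by exact: continuous_measurable_fun.
have mhm : measurable_fun setT (fun x : R => h (x - m)) by exact: continuous_measurable_fun.
have h0m (x : R) : 0 <= h (x - m) by [].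
rewrite (integral_normal_prob m s0' mhm h0m) (integral_normal_prob 0 s0' mh h0).
pose F (x : R) := x - m.
have dF (x : R) : is_derive x 1 F 1.
  have := is_deriveB (is_derive_id x (1 : R)) (is_derive_cst m x 1); rewrite subr0.
  exact.
have F'E : F^`()%classic = cst 1.
  by apply/funext => x; rewrite derive1E; have h1 := dF x; exact: derive_val.
rewrite (@increasing_ge0_integration_by_substitutionT _ F (fun x => h x * normal_pdf 0 s x)).
- apply: eq_integral => x _; rewrite F'E /= !fctE mulr1.
  by rewrite !normal_pdfE// /normal_fun /F subr0.
- by move=> x y xy; rewrite /F ltrD2r.
- by rewrite F'E => x; exact: cvg_cst.
- by rewrite F'E; exact: is_cvg_cst.
- by rewrite F'E; exact: is_cvg_cst.
- by move=> x; have [] := dF x.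
- exact: cvg_addrr_Ny.
- exact: cvg_addrr.
- by move=> x; apply: cvgM; [exact: ch|exact: continuous_normal_pdf].
- by move=> x; rewrite mulr_ge0// normal_pdf_ge0.
Qed.

Lemma normal_shift_Ex {R : realType} (m s : R) (h : R -> R) : 0 < s ->
  continuous h -> (forall x, 0 <= h x) -> intg (normal_prob 0 s) h ->
  intg (normal_prob m s) (fun x : R => h (x - m)) /\
  Ex (normal_prob m s) (fun x : R => h (x - m)) = Ex (normal_prob 0 s) h.
Proof.
move=> s0 ch h0 ih.
apply: intg_ge0 => //; last by rewrite normal_shift_integral// integral_EFin_Ex.
apply: (measurableT_comp (f := h)); first exact: intg_meas ih.
exact: measurable_funB.
Qed.

Lemma continuous_posr {R : realType} : continuous (fun x : R => Num.max x 0).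
Proof.
move=> x; have -> : (fun x : R => Num.max x 0) = (fun x => (x + `|x|) / 2).
  by apply/funext => y; case: (lerP y 0) => y0;
    [rewrite (ler0_norm y0)|rewrite (gtr0_norm y0)]; lra.
apply: cvgM; last exact: cvg_cst.
apply: cvgD; first exact: cvg_id.
exact: norm_continuous.
Qed.

(** It identifies the parameter [m] of a Gaussian law with the expectation, so
    that the laws attached to a centered process are centered. *)
Lemma normal_mean_shift {R : realType} (m s : R) : 0 < s ->
  intg (normal_prob m s) id /\ Ex (normal_prob m s) id = m.
Proof.
move=> s0; have [ia Ea] := normal_abs s0; have [ip Ep] := normal_pos s0.
have [||ia' Ea'] := normal_shift_Ex m s0 _ _ ia.
- exact: norm_continuous.
- by move=> x.
have cmax := @continuous_posr R.
have h0 (x : R) : 0 <= Num.max x 0 by rewrite le_max lexx orbT.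
have [ip' Ep'] := normal_shift_Ex m s0 cmax h0 ip.
have -> : id = (fun x : R => (2 * Num.max (x - m) 0 - `|x - m|) + m).
  apply/funext => x; case: (lerP (x - m) 0) => x0;
    [rewrite (ler0_norm x0)|rewrite (gtr0_norm x0)]; ring.
rewrite /= in ip' Ep' ia' Ea'.
have i2 := intgZ 2 ip'.
have i3 := intgB i2 ia'.
have im := intg_cst (normal_prob m s) m.
split; first exact: intgD.
have E1 := ExD i3 im; have E2 := ExB i2 ia'; have E3 := ExZ 2 ip'.
have E23 := etrans E2 (congr2 (fun a b => a - b) (etrans E3 (congr1 ( *%R 2) Ep')) Ea').
apply: (etrans E1); apply: (etrans (congr2 +%R E23 (Ex_cst _ m))).
rewrite Ea Ep.
by move: (Num.sqrt _) => k; field.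
Qed.

Lemma dirac_Ex {R : realType} (m : R) (h : R -> R) : measurable_fun setT h ->
  intg (dirac m) h /\ Ex (dirac m) h = h m.
Proof.
move=> mh; have mh' : measurable_fun setT (EFin \o h) by exact/measurable_EFinP.
split; last by rewrite /Ex /Rintegral integral_dirac// diracT mul1e.
apply/integrableP; split => //.
rewrite integral_dirac ?diracT ?mul1e ?ltry//.
exact: measurableT_comp.
Qed.

Lemma law_normal_Ex {d} {T : measurableType d} {R : realType}
  (P : probability T R) (X : T -> R) (m s : R) (h : R -> R) :
  measurable_fun setT X -> has_law P X (normal_prob m s) ->
  intg (normal_prob m s) h ->
  intg P (fun w => h (X w)) /\ Ex P (fun w => h (X w)) = Ex (normal_prob m s) h.
Proof. by move=> mX XN ih; apply: (law_Ex (N := normal_prob m s)). Qed.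

Section GaussianLaw.
Context {d : measure_display} {T : measurableType d} {R : realType}.
Variables (P : probability T R) (X : T -> R) (m s : R).
Hypotheses (mX : measurable_fun setT X) (s0 : 0 <= s).
Hypothesis XN : has_law P X (gaussian_law m s).

Lemma gaussian_law_mean : intg P X /\ Ex P X = m.
Proof.
move: XN; rewrite /gaussian_law; case: eqVneq => [_|sN0] XN'.
  have [i E] := dirac_Ex m (@measurable_id _ R setT).
  by have [i' E'] := law_Ex mX XN' i; rewrite -E.
have s1 : 0 < s by rewrite lt_neqAle eq_sym sN0.
have [i1 E1] := normal_mean_shift m s1.
by have [i E] := law_normal_Ex mX XN' i1; rewrite -E1.
Qed.

Lemma gaussian_law_moment (n : nat) (c : R) : (0 < n)%N -> m = 0 ->
  (0 < s -> intg (normal_prob 0 s) (fun x => x ^+ n) /\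
    Ex (normal_prob 0 s) (fun x => x ^+ n) = c * s ^+ n) ->
  intg P (fun w => X w ^+ n) /\ Ex P (fun w => X w ^+ n) = c * s ^+ n.
Proof.
move=> n0 m0; move: XN; rewrite /gaussian_law m0; case: eqVneq => [s00|sN0] XN' H.
  have mn : measurable_fun setT (fun x : R => x ^+ n) by exact: measurable_funX.
  have [i E] := dirac_Ex 0 mn.
  have [i' E'] := law_Ex mX XN' i.
  by rewrite E' E s00 expr0n gtn_eqF// mulr0.
have s1 : 0 < s by rewrite lt_neqAle eq_sym sN0.
have [i E] := H s1.
by have [i' E'] := law_normal_Ex mX XN' i; rewrite -E.
Qed.

End GaussianLaw.

(** What is used of a centered Gaussian law.  Only powers of one variable occur,
    and a constant variable equal to 0 qualifies, so that degenerate linear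
    combinations of a Gaussian process are covered. *)
Definition has_gaussian_moments {d} {T : measurableType d} {R : realType}
    (P : probability T R) (X : T -> R) : Prop :=
  [/\ intg P (fun w => X w ^+ 8),
     Ex P (fun w => X w ^+ 4) = 3 * Ex P (fun w => X w ^+ 2) ^+ 2 &
     Ex P (fun w => X w ^+ 8) = 105 * Ex P (fun w => X w ^+ 2) ^+ 4].

Lemma gaussian_moments {d} {T : measurableType d} {R : realType}
  (P : probability T R) (X : T -> R) (m s : R) :
  measurable_fun setT X -> 0 <= s -> has_law P X (gaussian_law m s) ->
  Ex P X = 0 ->
  has_gaussian_moments P X.
Proof.
move=> mX s0 XN EX.
have m0 : m = 0 by have [_ <-] := gaussian_law_mean mX s0 XN.
have [|_ E2] := gaussian_law_moment (n := 2) (c := 1) mX s0 XN isT m0.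
  by move=> s1; rewrite mul1r; exact: normal_moment2.
have [|_ E4] := gaussian_law_moment (n := 4) (c := 3) mX s0 XN isT m0.
  by move=> s1; exact: normal_moment4.
have [|i8 E8] := gaussian_law_moment (n := 8) (c := 105) mX s0 XN isT m0.
  by move=> s1; exact: normal_moment8.
split => //; first by rewrite E4 E2 mul1r -exprM.
by rewrite E8 E2 mul1r -exprM.
Qed.

(** * Covariance of fourth powers of Gaussian variables *)

Lemma sqr_le_pow8 {R : realType} (x : R) : x ^+ 2 <= 1 + x ^+ 8.
Proof.
have -> : x ^+ 8 = (x ^+ 2) ^+ 4 by rewrite -exprM.
move: (x ^+ 2) (sqr_ge0 x) => y y0.
have [y1|y1] := lerP y 1; first by have := exprn_ge0 4 y0; lra.
have : y <= y ^+ 4 by apply: ler_eXnr => //; exact: ltW.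
lra.
Qed.

Lemma pow4_le_pow8 {R : realType} (x : R) : x ^+ 4 <= 1 + x ^+ 8.
Proof.
have -> : x ^+ 8 = (x ^+ 4) ^+ 2 by rewrite -exprM.
by move: (x ^+ 4) => y; nra.
Qed.

Lemma pow4M_le_pow8 {R : realType} (x y : R) : x ^+ 4 * y ^+ 4 <= x ^+ 8 + y ^+ 8.
Proof.
have -> : x ^+ 8 = (x ^+ 4) ^+ 2 by rewrite -exprM.
have -> : y ^+ 8 = (y ^+ 4) ^+ 2 by rewrite -exprM.
by move: (x ^+ 4) (y ^+ 4) => a b; nra.
Qed.

Section QuarticCovariance.
Context {d : measure_display} {T : measurableType d} {R : realType}.
Variables (P : probability T R) (X Y : T -> R).
Hypotheses (mX : measurable_fun setT X) (mY : measurable_fun setT Y).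
Hypothesis gauss : forall a b : R, has_gaussian_moments P (fun w => a * X w + b * Y w).

Let gX : has_gaussian_moments P X.
Proof.
by have := gauss 1 0; have -> : (fun w => 1 * X w + 0 * Y w) = X
  by apply/funext => w; rewrite mul1r mul0r addr0.
Qed.

Let gY : has_gaussian_moments P Y.
Proof.
by have := gauss 0 1; have -> : (fun w => 0 * X w + 1 * Y w) = Y
  by apply/funext => w; rewrite mul1r mul0r add0r.
Qed.

Let sum8 : intg P (fun w => X w ^+ 8 + Y w ^+ 8).
Proof. by have [? _ _] := gX; have [? _ _] := gY; exact: intgD. Qed.

Let pow8_ge0 (x : R) : 0 <= x ^+ 8.
Proof. by rewrite exprn_even_ge0. Qed.

Lemma intg_sqr : intg P (fun w => X w ^+ 2).
Proof.
have [i8 _ _] := gX; apply: (@intg_le _ _ _ _ _ (fun w => 1 + X w ^+ 8)).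
- exact: measurable_funX.
- by move=> w; rewrite ger0_norm ?sqr_ge0// sqr_le_pow8.
- by apply: intgD => //; exact: intg_cst.
Qed.

Lemma intg_pow4 : intg P (fun w => X w ^+ 4).
Proof.
have [i8 _ _] := gX; apply: (@intg_le _ _ _ _ _ (fun w => 1 + X w ^+ 8)).
- exact: measurable_funX.
- move=> w; rewrite ger0_norm ?pow4_le_pow8//.
  by rewrite exprn_even_ge0.
- by apply: intgD => //; exact: intg_cst.
Qed.

Lemma intg_sqrY : intg P (fun w => Y w ^+ 2).
Proof.
have [i8 _ _] := gY; apply: (@intg_le _ _ _ _ _ (fun w => 1 + Y w ^+ 8)).
- exact: measurable_funX.
- by move=> w; rewrite ger0_norm ?sqr_ge0// sqr_le_pow8.
- by apply: intgD => //; exact: intg_cst.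
Qed.

Lemma intg_mul : intg P (fun w => X w * Y w).
Proof.
apply: (@intg_le _ _ _ _ _ (fun w => X w ^+ 2 + Y w ^+ 2)).
- exact: measurable_funM.
- by move=> w; rewrite ler_norml; apply/andP; split; nra.
- by apply: intgD; [exact: intg_sqr|exact: intg_sqrY].
Qed.

Lemma intg_pow4M : intg P (fun w => X w ^+ 4 * Y w ^+ 4).
Proof.
apply: (@intg_le _ _ _ _ _ (fun w => X w ^+ 8 + Y w ^+ 8)) => //.
- by apply: measurable_funM; exact: measurable_funX.
- move=> w; rewrite ger0_norm ?pow4M_le_pow8// -exprMn.
  by rewrite exprn_even_ge0.
Qed.

Local Notation a := (Ex P (fun w => X w ^+ 2)).
Local Notation b := (Ex P (fun w => Y w ^+ 2)).
Local Notation r := (Ex P (fun w => X w * Y w)).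

Lemma Ex_comb_sqr (s t : R) :
  Ex P (fun w => (s * X w + t * Y w) ^+ 2) = s ^+ 2 * a + 2 * s * t * r + t ^+ 2 * b.
Proof.
have -> : (fun w => (s * X w + t * Y w) ^+ 2) =
  (fun w => (s ^+ 2 * X w ^+ 2 + 2 * s * t * (X w * Y w)) + t ^+ 2 * Y w ^+ 2).
  by apply/funext => w; ring.
have iX := intgZ (s ^+ 2) intg_sqr.
have iM := intgZ (2 * s * t) intg_mul.
have iY := intgZ (t ^+ 2) intg_sqrY.
have iXM := intgD iX iM.
have E := ExD iXM iY.
rewrite (ExD iX iM) (ExZ _ intg_sqr) (ExZ _ intg_mul) (ExZ _ intg_sqrY) in E.
exact: E.
Qed.

(** Cauchy-Schwarz, from the nonnegativity of the quadratic form that gives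
    the second moments of the combinations of [X] and [Y]. *)
Lemma Ex_mul_sqr_le : r ^+ 2 <= a * b.
Proof.
have a0 : 0 <= a by apply: Ex_ge0 => w; exact: sqr_ge0.
have b0 : 0 <= b by apply: Ex_ge0 => w; exact: sqr_ge0.
have pos s t : 0 <= s ^+ 2 * a + 2 * s * t * r + t ^+ 2 * b.
  by rewrite -Ex_comb_sqr; apply: Ex_ge0 => w; exact: sqr_ge0.
move: a b r a0 b0 pos => A B C A0 B0 pos.
have [B1|B1] := ltrP 0 B.
  have := pos B (- C).
  have -> : B ^+ 2 * A + 2 * B * - C * C + (- C) ^+ 2 * B = B * (A * B - C ^+ 2) by ring.
  by rewrite pmulr_rge0// subr_ge0.
have B2 : B = 0 by apply/eqP; rewrite eq_le B0 B1.
(* Here the form is affine in [t]: a nonzero slope would make it negative. *)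
have [->|C0] := eqVneq C 0; first by rewrite expr0n mulr_ge0.
have := pos 1 (- (A + 1) / C); rewrite B2 mulr0 addr0.
have -> : 2 * 1 * (- (A + 1) / C) * C = - 2 * (A + 1) by field.
by move=> h; exfalso; lra.
Qed.

(** Isserlis' formula for [E (X^4 Y^4)].  Only the moments of single linear
    combinations are at hand, so [X^4 Y^4] is written as a combination of eighth
    powers of linear forms. *)
Lemma Ex_pow4M : Ex P (fun w => X w ^+ 4 * Y w ^+ 4) =
  9 * a ^+ 2 * b ^+ 2 + 72 * a * b * r ^+ 2 + 24 * r ^+ 4.
Proof.
pose S (s t : R) w := (s * X w + t * Y w) ^+ 8.
have iS s t : intg P (S s t) by have [] := gauss s t.
have ES s t : Ex P (S s t) = 105 * (s ^+ 2 * a + 2 * s * t * r + t ^+ 2 * b) ^+ 4.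
  by have [_ _] := gauss s t; rewrite Ex_comb_sqr.
(* The weights -1, 12, -39, 56, -39, 12, -1 at the slopes -3, ..., 3 are those of
   the central difference for a fourth derivative: they keep only the monomials
   [X^4 Y^4], with factor [6 * 4! * 70 = 10080], and [Y^8], which the last term
   removes. *)
pose L : seq (R * (R * R)) := [:: (- 39, (1, 1)); (- 39, (1, -1)); (12, (1, 2));
  (12, (1, - 2)); (-1, (1, 3)); (-1, (1, -3)); (56, (1, 0)); (7056, (0, 1))].
have E : (fun w => 10080 * (X w ^+ 4 * Y w ^+ 4)) =
    (fun w => \sum_(x <- L) x.1 * S x.2.1 x.2.2 w).
  apply/funext => w; rewrite /L !big_cons big_nil /S /=.
  by move: (X w) (Y w) => x y; ring.
have E1 := ExZ 10080 intg_pow4M; rewrite E Ex_sum in E1; last first.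
  by move=> i _; apply: intgZ.
have {}E1 : 10080 * Ex P (fun w => X w ^+ 4 * Y w ^+ 4)
    = \sum_(x <- L) x.1 * (105 * (x.2.1 ^+ 2 * a + 2 * x.2.1 * x.2.2 * r + x.2.2 ^+ 2 * b) ^+ 4).
  by rewrite -E1; apply: eq_bigr => x _; rewrite -ES ExZ.
move: E1; rewrite /L !big_cons big_nil /=.
move: (Ex P (fun w => X w ^+ 4 * Y w ^+ 4)) a b r => q A B C.
move=> E1; apply: (@mulfI _ 10080); first by rewrite pnatr_eq0.
by rewrite E1; ring.
Qed.

End QuarticCovariance.

Section QuarticSums.
Context {d : measure_display} {T : measurableType d} {R : realType}.
Variables (P : probability T R) (X : nat -> T -> R).
Hypothesis mX : forall i, measurable_fun setT (X i).
Hypothesis gauss : forall i j (a b : R), has_gaussian_moments P (fun w => a * X i w + b * X j w).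
Local Notation v i := (Ex P (fun w => X i w ^+ 2)).
Local Notation r i j := (Ex P (fun w => X i w * X j w)).

Let Y i w := X i w ^+ 4 - 3 * v i ^+ 2.

Let iX i : intg P (fun w => X i w ^+ 4).
Proof. exact: intg_pow4 (mX i) (gauss i i). Qed.

Let EX i : Ex P (fun w => X i w ^+ 4) = 3 * v i ^+ 2.
Proof.
have := gauss i i 1 0; have -> : (fun w => 1 * X i w + 0 * X i w) = X i.
  by apply/funext => w; rewrite mul1r mul0r addr0.
by case.
Qed.

Let iYY i j : intg P (fun w => Y i w * Y j w) /\
  Ex P (fun w => Y i w * Y j w) = 72 * v i * v j * r i j ^+ 2 + 24 * r i j ^+ 4.
Proof.
have i1 := intg_pow4M (mX i) (mX j) (gauss i j).
have E1 := Ex_pow4M (mX i) (mX j) (gauss i j).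
have i2 := intgZ (3 * v j ^+ 2) (iX i).
have i3 := intgZ (3 * v i ^+ 2) (iX j).
have ic := intg_cst P (9 * v i ^+ 2 * v j ^+ 2).
have i4 := intgB i1 i2; have i5 := intgB i4 i3.
have -> : (fun w => Y i w * Y j w) = (fun w => X i w ^+ 4 * X j w ^+ 4
   - 3 * v j ^+ 2 * X i w ^+ 4 - 3 * v i ^+ 2 * X j w ^+ 4 + 9 * v i ^+ 2 * v j ^+ 2).
  by apply/funext => w; rewrite /Y; ring.
split; first exact: intgD.
rewrite (ExD i5 ic) (ExB i4 i3) (ExB i1 i2) (ExZ _ (iX i)) (ExZ _ (iX j)) !EX E1 Ex_cst.
by ring.
Qed.

(** The covariance of [X i ^+ 4] and [X j ^+ 4] is
    [72 v_i v_j r_ij ^ 2 + 24 r_ij ^ 4]; by Cauchy-Schwarz the second term is at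
    most [24 v_i v_j r_ij ^ 2], whence the constant 96. *)
Lemma sum_quartic_variance n :
  let Q w := \sum_(i < n) X i w ^+ 4 - \sum_(i < n) 3 * v i ^+ 2 in
  intg P (fun w => Q w ^+ 2) /\
  Ex P (fun w => Q w ^+ 2) <= \sum_(i < n) \sum_(j < n) 96 * (v i * v j * r i j ^+ 2).
Proof.
move=> Q; have -> : (fun w => Q w ^+ 2) = (fun w => \sum_(i < n) \sum_(j < n) Y i w * Y j w).
  apply/funext => w; rewrite /Q -sumrB expr2 mulr_suml; apply: eq_bigr => i _.
  by rewrite mulr_sumr.
have iS (i : 'I_n) : intg P (fun w => \sum_(j < n) Y i w * Y j w).
  by apply: intg_sum => j _; have [] := iYY i j.
split; first exact: intg_sum.
rewrite Ex_sum//; apply: ler_sum => i _.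
rewrite Ex_sum; last by move=> j _; have [] := iYY i j.
apply: ler_sum => j _; have [_ ->] := iYY i j.
have h := Ex_mul_sqr_le (mX i) (mX j) (gauss i j).
have -> : 72 * v i * v j * r i j ^+ 2 + 24 * r i j ^+ 4 =
  96 * (v i * v j * r i j ^+ 2) - 24 * r i j ^+ 2 * (v i * v j - r i j ^+ 2) by ring.
by rewrite lerBlDr lerDl mulr_ge0 ?subr_ge0// mulr_ge0// sqr_ge0.
Qed.

End QuarticSums.

(** * Double sums over the steps of a partition *)

Section PartitionSums.
Context {R : realType}.
Variable p : nat -> R.
Hypothesis p_incr : forall j, p j <= p j.+1.

(** Clamping the points of the partition to [[x, y]] makes the sum telescope
    without changing the steps that are counted. *)
Lemma sum_steps_in_interval (x y : R) (n : nat) : x <= y ->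
  \sum_(j < n | (x <= p j) && (p j.+1 <= y)) (p j.+1 - p j) <= y - x.
Proof.
move=> xy; pose c z := Num.min (Num.max z x) y.
have cx z : x <= c z by rewrite /c le_min le_max lexx orbT.
have cy z : c z <= y by rewrite /c ge_min lexx orbT.
have cle a b : a <= b -> c a <= c b.
  move=> ab; rewrite /c le_min; apply/andP; split; last by rewrite ge_min lexx orbT.
  rewrite ge_min; apply/orP; left; rewrite ge_max; apply/andP.
  by split; rewrite le_max ?ab ?lexx ?orbT.
apply: (@le_trans _ _ (c (p n) - c (p 0%N))); last first.
  by have := cx (p 0%N); have := cy (p n); lra.
elim: n => [|n IH]; first by rewrite big_ord0 subrr.
rewrite big_mkcond big_ord_recr /= -big_mkcond /=.
have -> : c (p n.+1) - c (p 0%N) = (c (p n) - c (p 0%N)) + (c (p n.+1) - c (p n)) by ring.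
apply: lerD => //; case: ifP => [/andP[xp py]|_]; last by rewrite subr_ge0 cle.
rewrite /c !max_l ?(le_trans xp)// !min_l//; exact: le_trans (p_incr n) py.
Qed.

End PartitionSums.

Section DoubleSum.
Context {R : realType}.
Variables (p : nat -> R) (n : nat) (T mu eta K L : R).
Variables (v : nat -> R) (s : nat -> nat -> R).
Hypothesis p_incr : forall j, p j <= p j.+1.
Hypothesis p0 : p 0%N = 0.
Hypothesis pT : p n <= T.
Hypothesis step : forall j, p j.+1 - p j <= mu.
Hypotheses (mu0 : 0 <= mu) (eta0 : 0 <= eta) (K0 : 0 <= K) (L0 : 0 <= L).
Hypothesis v0 : forall j, 0 <= v j.
Hypothesis v_step : forall j, (j < n)%N -> v j ^+ 2 <= K * (p j.+1 - p j).
Hypothesis s0 : forall i j, 0 <= s i j.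
Hypothesis s_sym : forall i j, s i j = s j i.
Hypothesis s_le : forall i j, s i j <= v i * v j.
Hypothesis s_far : forall i j, (i < n)%N -> (j < n)%N -> p i.+1 + eta <= p j ->
  s i j <= L * ((p i.+1 - p i) * (p j.+1 - p j)).
Local Notation D j := (p j.+1 - p j).

Let D0 j : 0 <= D j. Proof. by rewrite subr_ge0. Qed.

Let sumD : \sum_(j < n) D j <= T.
Proof.
have -> : \sum_(j < n) D j = p n - p 0%N.
  by rewrite -(telescope_sumr p (leq0n n)) big_mkord.
by rewrite p0 subr0.
Qed.

(** The margins [mu] and [2 * mu] account for the lengths of the two steps: a step
    [j] that is not near leaves a gap of at least [eta] to step [i]. *)
Let near_steps (i j : nat) :=
  (p i - eta - mu <= p j) && (p j.+1 <= p i + eta + 2 * mu).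

Let near_sum i : \sum_(j < n | near_steps i j) D j <= 2 * eta + 3 * mu.
Proof.
apply: le_trans (sum_steps_in_interval p_incr n _) _; last by lra.
by have := eta0; have := mu0; lra.
Qed.

Let vv i j : (i < n)%N -> (j < n)%N -> v i * v j <= K * mu.
Proof.
move=> i_n j_n.
have hi : v i ^+ 2 <= K * mu by apply: le_trans (v_step i_n) _; rewrite ler_wpM2l.
have hj : v j ^+ 2 <= K * mu by apply: le_trans (v_step j_n) _; rewrite ler_wpM2l.
have := sqr_ge0 (v i - v j); nra.
Qed.

Let term_le i j : (i < n)%N -> (j < n)%N -> v i * v j * s i j <=
  K * mu * L * (D i * D j) + (if near_steps i j then K ^+ 2 * (D i * D j) else 0).
Proof.
move=> i_n j_n; have vij := vv i_n j_n; have vij0 : 0 <= v i * v j by rewrite mulr_ge0.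
have DD : 0 <= D i * D j by rewrite mulr_ge0.
case: ifPn => [_|].
  apply: (@le_trans _ _ (K ^+ 2 * (D i * D j))); last first.
    by rewrite lerDr !mulr_ge0.
  apply: (@le_trans _ _ (v i ^+ 2 * v j ^+ 2)).
    have -> : v i ^+ 2 * v j ^+ 2 = v i * v j * (v i * v j) by ring.
    by rewrite ler_wpM2l.
  have -> : K ^+ 2 * (D i * D j) = (K * D i) * (K * D j) by ring.
  by apply: ler_pM; rewrite ?sqr_ge0 ?v_step.
rewrite negb_and -!ltNge addr0 => h.
have far : s i j <= L * (D i * D j).
  case/orP: h => h.
    rewrite s_sym (mulrC (D i)); apply: s_far => //.
    by have := step j; lra.
  apply: s_far => //; have := step i; have := step j; lra.
have -> : K * mu * L * (D i * D j) = K * mu * (L * (D i * D j)) by ring.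
exact: ler_pM.
Qed.

(** Steps near a given one have total length [O(eta + mu)], and for them
    [v_i v_j s_ij <= (v_i v_j) ^ 2] is of the order of the product of the
    lengths.  For the other pairs [s_ij] is itself of that order, and the factor
    [v_i v_j <= K * mu] is small. *)
Lemma double_sum_bound : 0 <= T -> \sum_(i < n) \sum_(j < n) v i * v j * s i j <=
  K * mu * L * T ^+ 2 + K ^+ 2 * T * (2 * eta + 3 * mu).
Proof.
move=> T0.
apply: (@le_trans _ _ (\sum_(i < n) (K * mu * L * T * D i
   + K ^+ 2 * (2 * eta + 3 * mu) * D i))); last first.
  rewrite big_split /= -!mulr_sumr expr2; apply: lerD.
    rewrite [leRHS]mulrA; apply: ler_wpM2l => //; by rewrite !mulr_ge0.
  have -> : K ^+ 2 * T * (2 * eta + 3 * mu) = K ^+ 2 * (2 * eta + 3 * mu) * T by ring.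
  apply: ler_wpM2l => //; rewrite mulr_ge0 ?sqr_ge0// addr_ge0 ?mulr_ge0//.
apply: ler_sum => i _.
apply: (@le_trans _ _ (\sum_(j < n) (K * mu * L * D i * D j +
   (if near_steps i j then K ^+ 2 * D i * D j else 0)))).
  apply: ler_sum => j _; apply: le_trans (term_le (ltn_ord i) (ltn_ord j)) _.
  by rewrite !mulrA.
rewrite big_split /= -big_mkcond /= -!mulr_sumr; apply: lerD.
  have -> : K * mu * L * T * D i = K * mu * L * D i * T by ring.
  by apply: ler_wpM2l => //; rewrite !mulr_ge0.
have -> : K ^+ 2 * (2 * eta + 3 * mu) * D i = K ^+ 2 * D i * (2 * eta + 3 * mu) by ring.
by apply: ler_wpM2l => //; rewrite mulr_ge0 ?sqr_ge0.
Qed.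

End DoubleSum.

(** * Increments of a Gaussian process *)

Section GaussianProcess.
Context {d : measure_display} {T : measurableType d} {R : realType}.
Variables (P : probability T R) (F : R -> {RV P >-> R}) (rho : R -> R -> R).
Hypothesis F_gaussian : gaussian_process F.
Hypothesis F_centered : centered_process F.
Hypothesis F_covariance : has_covariance F rho.

Lemma process_intg t : 0 <= t -> intg P (F t) /\ Ex P (F t) = 0.
Proof.
move=> t0; have [|m [s [s0 law]]] := @F_gaussian 1 (fun=> t) (fun=> 1); first by [].
have E : (fun w => \sum_(i < 1) 1 * F t w) = F t.
  by apply/funext => w; rewrite big_ord_recl big_ord0 mul1r addr0.
rewrite E in law; have [i _] := gaussian_law_mean (RV_measurable (F t)) s0 law.
split => //; have := F_centered t0; rewrite unlock => h.
by rewrite /Ex /Rintegral h.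
Qed.

Lemma gaussian_lincomb n (t c : 'I_n -> R) : (forall i, 0 <= t i) ->
  has_gaussian_moments P (fun w => \sum_(i < n) c i * F (t i) w).
Proof.
move=> t0; have [m [s [s0 law]]] := F_gaussian c t0.
apply: gaussian_moments s0 law _.
  apply: measurable_sum => i; apply: measurable_funM => //; exact: RV_measurable.
rewrite Ex_sum; last by move=> i _; apply: intgZ; have [] := process_intg (t0 i).
rewrite big1// => i _; have [iF EF] := process_intg (t0 i).
by rewrite ExZ// EF mulr0.
Qed.

Lemma increments_gaussian s1 t1 s2 t2 : 0 <= s1 -> 0 <= t1 -> 0 <= s2 -> 0 <= t2 ->
  forall a b : R, has_gaussian_moments P (fun w => a * (F t1 w - F s1 w) + b * (F t2 w - F s2 w)).
Proof.
move=> s10 t10 s20 t20 a b.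
pose t (i : 'I_4) := nth 0 [:: t1; s1; t2; s2] i.
pose c (i : 'I_4) := nth 0 [:: a; - a; b; - b] i.
have t0 i : 0 <= t i.
  by case: i => -[|[|[|[|//]]]] /=.
have := gaussian_lincomb c t0.
have -> : (fun w => \sum_(i < 4) c i * F (t i) w) =
  (fun w => a * (F t1 w - F s1 w) + b * (F t2 w - F s2 w)).
  apply/funext => w; rewrite !big_ord_recl big_ord0 /c /t /=; ring.
by [].
Qed.

Lemma values_intg s t : 0 <= s -> 0 <= t -> intg P (fun w => F s w * F t w).
Proof.
move=> s0 t0; apply: intg_mul (RV_measurable (F s)) (RV_measurable (F t)) _ => a b.
pose tt (i : 'I_2) := nth 0 [:: s; t] i.
pose c (i : 'I_2) := nth 0 [:: a; b] i.
have tt0 i : 0 <= tt i by case: i => -[|[|//]] /=.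
have := gaussian_lincomb c tt0.
have -> : (fun w => \sum_(i < 2) c i * F (tt i) w) = (fun w => a * F s w + b * F t w).
  by apply/funext => w; rewrite !big_ord_recl big_ord0 /c /tt /= addr0.
by [].
Qed.

Lemma Ex_increments s1 t1 s2 t2 : 0 <= s1 -> 0 <= t1 -> 0 <= s2 -> 0 <= t2 ->
  Ex P (fun w => (F t1 w - F s1 w) * (F t2 w - F s2 w)) =
  rho t1 t2 - rho t1 s2 - (rho s1 t2 - rho s1 s2).
Proof.
move=> s10 t10 s20 t20.
have E s t : 0 <= s -> 0 <= t -> Ex P (fun w => F s w * F t w) = rho s t.
  by move=> s0 t0; have := F_covariance s0 t0; rewrite unlock => h; rewrite /Ex /Rintegral h.
have -> : (fun w => (F t1 w - F s1 w) * (F t2 w - F s2 w)) =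
  (fun w => F t1 w * F t2 w - F t1 w * F s2 w - (F s1 w * F t2 w - F s1 w * F s2 w)).
  by apply/funext => w; ring.
have i1 := intgB (values_intg t10 t20) (values_intg t10 s20).
have i2 := intgB (values_intg s10 t20) (values_intg s10 s20).
by rewrite (ExB i1 i2) (ExB (values_intg t10 t20) (values_intg t10 s20))
  (ExB (values_intg s10 t20) (values_intg s10 s20)) !E.
Qed.

End GaussianProcess.

(** * Quartic variation along a partition *)

Section Partition.
Context {R : realType}.
Variable p : nat -> R.
Hypothesis pP : is_partition p.

Lemma partition_le i j : (i <= j)%N -> p i <= p j.
Proof.
case: pP => _ pi _; elim: j => [|j IH]; first by rewrite leqn0 => /eqP ->.
rewrite leq_eqVlt => /orP[/eqP -> //|]; rewrite ltnS => /IH h.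
by rewrite (le_trans h)// ltW.
Qed.

Lemma partition_lt i j : (i < j)%N -> p i < p j.
Proof. by case: pP => _ pi _ ij; apply: lt_le_trans (pi i) (partition_le ij). Qed.

Lemma partition_ge0 j : 0 <= p j.
Proof. by case: (pP) => <- _ _; exact: partition_le. Qed.

Lemma partition_index t : 0 <= t -> exists n, p n <= t /\ t < p n.+1.
Proof.
move=> t0; case: (pP) => p0 _ poo.
have [N _ HN] : \forall n \near \oo, t < p n.
  by move/cvgryPgt : poo; apply.
have exN : exists n, t < p n by exists N; apply: HN => /=.
case: (ex_minnP exN) => -[|m] tm hm; first by move: tm; rewrite p0 ltNge t0.
exists m; split => //; rewrite leNgt; apply/negP => /hm.
by rewrite ltnn.
Qed.

Lemma quartic_variationE (T : Type) (F : R -> T -> R) n t w : p n <= t -> t < p n.+1 ->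
  quartic_variation F p t w = \sum_(j < n) (F (p j.+1) w - F (p j) w) ^+ 4.
Proof.
move=> pnt tpn; rewrite /quartic_variation.
have -> : [set j : nat | 0 < p j <= t] = [set` index_iota 1 n.+1].
  apply/seteqP; split => j /=; rewrite mem_index_iota.
    move=> /andP[j0 jt]; apply/andP; split.
      by case: j j0 {jt} => //; case: (pP) => -> _ _; rewrite ltxx.
    rewrite ltnNge; apply/negP => nj; move: jt; rewrite leNgt => /negP; apply.
    exact: lt_le_trans tpn (partition_le nj).
  move=> /andP[j0 jn]; apply/andP; split.
    by case: (pP) => <- _ _; exact: partition_lt.
  by apply: le_trans pnt; exact: partition_le.
rewrite -fsbig_seq ?iota_uniq// big_add1 big_mkord; apply: eq_bigr => j _ /=.
by rewrite -normrX ger0_norm// exprn_even_ge0.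
Qed.

Lemma mesh_step (delta : R) j : (mesh p < delta%:E)%E -> p j.+1 - p j <= delta.
Proof.
move=> h; case: (pP) => _ pi _.
have : ((p j.+1 - p j)%:E <= mesh p)%E.
  apply: ereal_sup_ubound; exists j => //=.
  by rewrite gtr0_norm// subr_gt0.
by move=> /le_lt_trans /(_ h); rewrite lte_fin => /ltW.
Qed.

End Partition.

(** * Mean square convergence at a fixed time *)

Lemma small_mul {R : realType} (C e : R) : 0 <= C -> 0 < e -> exists2 m, 0 < m & C * m <= e.
Proof.
move=> C0 e0; exists (e / (C + 1)); first by rewrite divr_gt0//; lra.
by rewrite mulrCA ler_piMr ?(ltW e0)// ler_pdivrMr; lra.
Qed.

Section L2Convergence.
Context {d : measure_display} {Omega : measurableType d} {R : realType}.
Variables (P : probability Omega R) (F : R -> {RV P >-> R}).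
Hypothesis F_gaussian : gaussian_process F.
Hypothesis F_centered : centered_process F.
Variables (T LA : R) (A : R -> R).
Hypotheses (T0 : 0 < T) (LA0 : 0 <= LA) (A0 : A 0 = 0).
Hypothesis A_incr : forall s t, 0 <= s -> s <= t -> t <= T ->
  0 <= A t - A s <= LA * (t - s).
Local Notation v s t := (Ex P (fun w => (F t w - F s w) ^+ 2)).
Hypothesis variance_asymp : forall e, 0 < e -> exists2 delta, 0 < delta &
  forall s t, 0 <= s -> s < t -> t <= T -> t - s <= delta ->
  `|3 * v s t ^+ 2 - (A t - A s)| <= e * (t - s).
Hypothesis covariance_decay : forall eta, 0 < eta -> exists L, exists delta,
  [/\ 0 <= L, 0 < delta & forall s1 t1 s2 t2, 0 <= s1 -> s1 < t1 -> t1 + eta <= s2 ->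
  s2 < t2 -> t2 <= T -> t1 - s1 <= delta -> t2 - s2 <= delta ->
  Ex P (fun w => (F t1 w - F s1 w) * (F t2 w - F s2 w)) ^+ 2
    <= L * ((t1 - s1) * (t2 - s2))].

(** The error splits into the centered quartic sum [Z], whose variance is bounded
    by [double_sum_bound], and the bias [M - A t], which is at most the sum of the
    local errors of [variance_asymp] plus the variation of [A] over the step
    containing [t]. *)
Lemma L2_convergence eps : 0 < eps -> exists2 delta, 0 < delta &
  forall p, is_partition p -> (forall j, p j.+1 - p j <= delta) ->
  forall t, 0 <= t -> t <= T ->
  intg P (fun w => (quartic_variation F p t w - A t) ^+ 2) /\
  Ex P (fun w => (quartic_variation F p t w - A t) ^+ 2) <= eps.
Proof.
move=> e0; pose K := LA + 1.
have K0 : 0 <= K by rewrite addr_ge0.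
have e4 : 0 < eps / 4 by rewrite divr_gt0.
have KT : 0 <= K ^+ 2 * T by rewrite mulr_ge0 ?sqr_ge0 ?(ltW T0).
(* [eta] settles the contribution of the near pairs; it comes before the mesh
   because the constant [L] of the far pairs depends on it. *)
have [eta eta0 Heta] : exists2 eta, 0 < eta & 384 * (K ^+ 2 * T) * eta <= eps / 4.
  by apply: small_mul e4; rewrite mulr_ge0 ?ler0n.
have [L [d3 [L0 d30 H3]]] := covariance_decay eta0.
(* [k] bounds the bias: [2 k ^ 2 <= eps / 4]. *)
pose k := Num.min 1 (eps / 8).
have k0 : 0 < k by rewrite /k lt_min ltr01/=; lra.
have k1 : k <= 1 by rewrite /k ge_min lexx.
have k8 : k <= eps / 8 by rewrite /k ge_min lexx orbT.
have [e1 e10 He1] : exists2 e1, 0 < e1 & T * e1 <= k / 2.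
  by apply: small_mul; rewrite ?(ltW T0)// divr_gt0.
have [d1 d10 H1] := variance_asymp ltr01.
have [d2 d20 H2] := variance_asymp e10.
have [d4 d40 H4] : exists2 d4, 0 < d4 & LA * d4 <= k / 2.
  by apply: small_mul => //; rewrite divr_gt0.
have KL : 0 <= 192 * (K * L * T ^+ 2 + K ^+ 2 * T * 3).
  rewrite mulr_ge0 ?ler0n// addr_ge0//.
    by rewrite mulr_ge0 ?sqr_ge0// mulr_ge0.
  by rewrite mulr_ge0 ?ler0n.
have [d5 d50 H5] : exists2 d5, 0 < d5 & 192 * (K * L * T ^+ 2 + K ^+ 2 * T * 3) * d5 <= eps / 4.
  exact: small_mul KL e4.
pose delta := Num.min (Num.min d1 d2) (Num.min d3 (Num.min d4 d5)).
have delta0 : 0 < delta by rewrite /delta !lt_min d10 d20 d30 d40 d50.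
have [l1 [l2 [l3 [l4 l5]]]] : delta <= d1 /\ delta <= d2 /\ delta <= d3 /\
    delta <= d4 /\ delta <= d5.
  by rewrite /delta !ge_min !lexx !orbT.
exists delta => // p pP step t t0 tT.
have [n [pnt tpn]] := partition_index pP t0.
have pT : p n <= T by exact: le_trans tT.
have pj0 := partition_ge0 pP.
have plt j : p j < p j.+1 by case: (pP).
have pjT j : (j < n)%N -> p j.+1 <= T.
  by move=> jn; apply: le_trans pT; exact: partition_le.
pose X j w := F (p j.+1) w - F (p j) w.
have mX j : measurable_fun setT (X j).
  by apply: measurable_funB; exact: RV_measurable.
have gX i j : forall a b : R, has_gaussian_moments P (fun w => a * X i w + b * X j w).
  exact: (increments_gaussian F_gaussian F_centered).
have [iQ EQ] := sum_quartic_variance mX gX n.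
pose vj j := v (p j) (p j.+1).
pose sj i j := Ex P (fun w => X i w * X j w) ^+ 2.
have v0 j : 0 <= vj j by apply: Ex_ge0 => w; exact: sqr_ge0.
(* [d1], the bound with error 1, is what gives [v_j ^ 2 <= K (p j.+1 - p j)]. *)
have bound : \sum_(i < n) \sum_(j < n) vj i * vj j * sj i j <=
    K * delta * L * T ^+ 2 + K ^+ 2 * T * (2 * eta + 3 * delta).
  apply: (@double_sum_bound _ p n T delta eta K L vj sj) => //; rewrite ?(ltW T0) ?(ltW eta0) ?(ltW delta0)//.
  - by move=> j; exact: ltW.
  - by case: (pP).
  - move=> j jn; have := H1 _ _ (pj0 j) (plt j) (pjT _ jn) (le_trans (step j) l1).
    have /andP[a1 a2] := A_incr (pj0 j) (ltW (plt j)) (pjT _ jn).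
    rewrite -/(vj j) ler_norml => /andP[_ h].
    by rewrite /K; have := sqr_ge0 (vj j); lra.
  - by move=> i j; exact: sqr_ge0.
  - by move=> i j; rewrite /sj; congr (Ex P _ ^+ 2); apply/funext => w; rewrite mulrC.
  - by move=> i j; exact: Ex_mul_sqr_le (mX i) (mX j) (gX i j).
  - move=> i j i_n j_n far; apply: H3 => //; first exact: pjT.
      exact: le_trans l3.
    exact: le_trans l3.
pose M := \sum_(i < n) 3 * vj i ^+ 2.
have bias : `|M - A t| <= k.
  have -> : M - A t = \sum_(i < n) (3 * vj i ^+ 2 - (A (p i.+1) - A (p i))) - (A t - A (p n)).
    rewrite sumrB -/M; have -> : \sum_(i < n) (A (p i.+1) - A (p i)) = A (p n).
      rewrite -(big_mkord xpredT (fun i => A (p i.+1) - A (p i))).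
      rewrite (telescope_sumr (fun i => A (p i)) (leq0n n)).
      by case: (pP) => -> _ _; rewrite A0 subr0.
    by ring.
  apply: (@le_trans _ _ (k / 2 + k / 2)); last by lra.
  apply: le_trans (ler_normB _ _) _; apply: lerD.
    apply: le_trans (ler_norm_sum _ _ _) _.
    apply: (@le_trans _ _ (\sum_(i < n) e1 * (p i.+1 - p i))).
      apply: ler_sum => i _; apply: H2 => //; first exact: pjT.
      exact: le_trans l2.
    rewrite -mulr_sumr -(big_mkord xpredT (fun i => p i.+1 - p i)).
    rewrite (telescope_sumr p (leq0n n)); case: (pP) => -> _ _; rewrite subr0.
    by apply: le_trans He1; rewrite mulrC ler_wpM2r// ltW.
  have /andP[a1 a2] := A_incr (pj0 n) pnt tT.
  rewrite ger0_norm//; apply: le_trans a2 _; apply: le_trans H4.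
  by rewrite ler_wpM2l//; have := step n; lra.
pose Z w := \sum_(i < n) X i w ^+ 4 - M.
have E : (fun w => (quartic_variation F p t w - A t) ^+ 2) = (fun w => (Z w + (M - A t)) ^+ 2).
  apply/funext => w; rewrite (quartic_variationE pP _ _ pnt tpn) /Z.
  by congr (_ ^+ 2); rewrite addrA subrK.
have i2 := intgD (intgZ 2 iQ) (intg_cst P (2 * (M - A t) ^+ 2)).
have dom w : (Z w + (M - A t)) ^+ 2 <= 2 * Z w ^+ 2 + 2 * (M - A t) ^+ 2.
  by have := sqr_ge0 (Z w - (M - A t)); nra.
have mZ : measurable_fun setT (fun w => (Z w + (M - A t)) ^+ 2).
  apply: measurable_funX; apply: measurable_funD => //; apply: measurable_funB => //.
  by apply: measurable_sum => i; apply: measurable_funX.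
have iZ : intg P (fun w => (Z w + (M - A t)) ^+ 2).
  by apply: intg_le mZ _ i2 => w; rewrite ger0_norm ?sqr_ge0//; exact: dom.
rewrite E; split => //.
apply: le_trans (Ex_le iZ i2 dom) _.
rewrite (ExD (intgZ 2 iQ) (intg_cst P _)) (ExZ 2 iQ) Ex_cst.
have hM : 2 * (M - A t) ^+ 2 <= eps / 4.
  have : (M - A t) ^+ 2 <= k ^+ 2.
    by rewrite -real_normK ?num_real// ler_pXn2r ?nnegrE ?normr_ge0// ltW.
  nra.
have hQ : 2 * Ex P (fun w => Z w ^+ 2) <= eps / 2.
  apply: (@le_trans _ _ (192 * (K * delta * L * T ^+ 2 + K ^+ 2 * T * (2 * eta + 3 * delta)))).
    have : Ex P (fun w => Z w ^+ 2) <= 96 * \sum_(i < n) \sum_(j < n) vj i * vj j * sj i j.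
      by apply: le_trans EQ _; rewrite mulr_sumr; apply: ler_sum => i _; rewrite mulr_sumr.
    by move: bound; lra.
  have h5 : 192 * (K * L * T ^+ 2 + K ^+ 2 * T * 3) * delta <= eps / 4.
    by apply: le_trans H5; rewrite ler_wpM2l.
  have -> : 192 * (K * delta * L * T ^+ 2 + K ^+ 2 * T * (2 * eta + 3 * delta)) =
    192 * (K * L * T ^+ 2 + K ^+ 2 * T * 3) * delta + 384 * (K ^+ 2 * T) * eta by ring.
  lra.
lra.
Qed.

End L2Convergence.

(** * From fixed times to the supremum *)

(** The integral of a nonnegative function is the supremum of the integrals of the
    simple functions below it, so monotonicity holds for arbitrary functions; it
    serves for the supremum over an uncountable set of times. *)
Lemma ge0_le_integral_any {d} {T : measurableType d} {R : realType}
  (mu : {measure set T -> \bar R}) (f g : T -> \bar R) :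
  (forall x, 0 <= f x)%E -> (forall x, f x <= g x)%E ->
  (\int[mu]_x f x <= \int[mu]_x g x)%E.
Proof.
move=> f0 fg; rewrite !ge0_integralTE//; last first.
  by move=> x; exact: le_trans (fg x).
apply: le_ereal_sup => _ [h hf <-]; exists h => // x.
exact: le_trans (hf x) (fg x).
Qed.

Lemma term_le_sum {R : realType} (n : nat) (f : nat -> R) k :
  (forall i, 0 <= f i) -> (k < n)%N -> f k <= \sum_(i < n) f i.
Proof.
move=> f0 kn; rewrite (bigD1 (Ordinal kn))//= lerDl.
by apply: sumr_ge0 => i _.
Qed.

(** A quantity squeezed between [a - o] and [b + o] is controlled by [b] when it
    is nonnegative and by [a] otherwise. *)
Lemma sqr_le_between {R : realType} (x a b o : R) : 0 <= o -> x <= b + o -> a - o <= x ->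
  x ^+ 2 <= 2 * a ^+ 2 + 2 * o ^+ 2 \/ x ^+ 2 <= 2 * b ^+ 2 + 2 * o ^+ 2.
Proof.
move=> o0 xb ax; have [x0|x0] := lerP 0 x; [right|left].
  by have := sqr_ge0 (b - o); nra.
by have := sqr_ge0 (a + o); nra.
Qed.

Lemma double_sqr_small {R : realType} (o eps : R) :
  0 < o -> o <= 1 -> o <= eps / 8 -> 2 * o ^+ 2 <= eps / 4.
Proof. by move=> o0 o1 o8; nra. Qed.

Lemma equal_shares {R : realType} (eps : R) n :
  2 * (eps / 8 / n.+1%:R) *+ n.+1 = eps / 4.
Proof.
rewrite -mulr_natr; move: (n.+1%:R) (ltr0Sn R n) => x x0.
by field; rewrite gt_eqF.
Qed.

Section UniformConvergence.
Context {d : measure_display} {Omega : measurableType d} {R : realType}.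
Variables (P : probability Omega R) (F : R -> Omega -> R).
Variables (T LA : R) (A : R -> R).
Hypotheses (T0 : 0 < T) (LA0 : 0 <= LA).
Hypothesis A_incr : forall s t, 0 <= s -> s <= t -> t <= T ->
  0 <= A t - A s <= LA * (t - s).
Hypothesis L2 : forall eps, 0 < eps -> exists2 delta, 0 < delta &
  forall p, is_partition p -> (forall j, p j.+1 - p j <= delta) ->
  forall t, 0 <= t -> t <= T ->
  intg P (fun w => (quartic_variation F p t w - A t) ^+ 2) /\
  Ex P (fun w => (quartic_variation F p t w - A t) ^+ 2) <= eps.

Lemma quartic_variation_le p s t w : is_partition p -> 0 <= s -> s <= t ->
  quartic_variation F p s w <= quartic_variation F p t w.
Proof.
move=> pP s0 st; have [n [pns spn]] := partition_index pP s0.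
have [m [pmt tpm]] := partition_index pP (le_trans s0 st).
rewrite (quartic_variationE pP _ _ pns spn) (quartic_variationE pP _ _ pmt tpm).
have nm : (n <= m)%N.
  rewrite -ltnS ltnNge; apply/negP => mn.
  have := partition_le pP mn; rewrite leNgt => /negP; apply.
  exact: le_lt_trans (le_trans pns st) tpm.
pose f j := (F (p j.+1) w - F (p j) w) ^+ 4.
rewrite -!(big_mkord xpredT f) (big_cat_nat (n := n) (p := m))//= lerDl.
by apply: sumr_ge0 => j _; rewrite exprn_even_ge0.
Qed.

(** Polya's argument.  On a grid so fine that [A] grows by at most [o] between
    neighbours, monotonicity bounds the error at any time by the errors at the two
    neighbouring grid points, up to [o].  The supremum of the squares is thus
    below a finite sum of squares, whose mean tends to 0 with the mesh. *)
Lemma uniform_L2_convergence eps : 0 < eps -> exists delta, 0 < delta /\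
  forall p, is_partition p -> (mesh p < delta%:E)%E ->
    (\int[P]_w ereal_sup
         [set ((`|quartic_variation F p t w - A t|%R ^+ 2)%R)%:E | t in `[0%R, T]]
     < eps%:E)%E.
Proof.
move=> e0; pose o := Num.min 1 (eps / 8).
have o0 : 0 < o by rewrite /o lt_min ltr01/=; rewrite divr_gt0.
have o1 : o <= 1 by rewrite /o ge_min lexx.
have o8 : o <= eps / 8 by rewrite /o ge_min lexx orbT.
have oo : 2 * o ^+ 2 <= eps / 4 by exact: double_sqr_small.
have [h h0 Hh] := small_mul LA0 o0.
pose m := (Num.truncn (T / h)).+1.
have mT : T / m%:R <= h.
  rewrite ler_pdivrMr ?ltr0n// mulrC -ler_pdivrMr// ltW//.
  by rewrite /m; exact: truncnS_gt.
have m0 : 0 < m%:R :> R by rewrite ltr0n.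
pose s k : R := k%:R * (T / m%:R).
have s0 k : 0 <= s k by rewrite mulr_ge0 ?ler0n// divr_ge0 ?(ltW T0) ?(ltW m0).
have sm : s m = T by rewrite /s mulrCA divff ?mulr1// gt_eqF.
have sS k : s k.+1 = s k + T / m%:R by rewrite /s -addn1 natrD mulrDl mul1r.
have sle i j : (i <= j)%N -> s i <= s j.
  by move=> ij; rewrite /s ler_wpM2r ?ler_nat// divr_ge0 ?(ltW T0) ?(ltW m0).
have e1 : 0 < eps / 8 / m.+1%:R by rewrite !divr_gt0.
have [delta d0 Hd] := L2 e1.
exists delta; split => // p pP mp.
have step j := mesh_step pP j mp.
pose e k w := quartic_variation F p (s k) w - A (s k).
have ie k : (k < m.+1)%N -> intg P (fun w => e k w ^+ 2) /\
    Ex P (fun w => e k w ^+ 2) <= eps / 8 / m.+1%:R.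
  by move=> km; apply: Hd => //; rewrite -sm sle.
pose G w := \sum_(k < m.+1) 2 * e k w ^+ 2 + 2 * o ^+ 2.
have i1 : intg P (fun w => \sum_(k < m.+1) 2 * e k w ^+ 2).
  by apply: intg_sum => k _; apply: intgZ; have [] := ie k (ltn_ord k).
have ic := intg_cst P (2 * o ^+ 2).
have iG : intg P G by exact: intgD i1 ic.
have EG : Ex P G <= eps / 2.
  rewrite (ExD i1 ic) Ex_cst Ex_sum; last first.
    by move=> k _; apply: intgZ; have [] := ie k (ltn_ord k).
  have : \sum_(k < m.+1) Ex P (fun w => 2 * e k w ^+ 2) <= \sum_(k < m.+1) 2 * (eps / 8 / m.+1%:R).
    by apply: ler_sum => k _; have [ik Ek] := ie k (ltn_ord k); rewrite ExZ// ler_wpM2l.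
  rewrite sumr_const card_ord equal_shares.
  by move: oo; lra.
have bound w t : 0 <= t -> t <= T -> (quartic_variation F p t w - A t) ^+ 2 <= G w.
  move=> t0 tT; have ex : exists n, t <= s n by exists m; rewrite sm.
  have term k : (k < m.+1)%N -> 2 * e k w ^+ 2 + 2 * o ^+ 2 <= G w.
    move=> km; rewrite /G lerD2r; apply: (@term_le_sum _ _ (fun k => 2 * e k w ^+ 2)) => // i.
    by rewrite mulr_ge0// sqr_ge0.
  case: (ex_minnP ex) => -[|k] tk hk.
    have -> : t = s 0%N by apply/eqP; rewrite eq_le tk /s mul0r t0.
    apply: le_trans (term 0%N _) => //; rewrite -/(e 0%N w).
    by have := sqr_ge0 (e 0%N w); have := sqr_ge0 o; lra.
  have kt : s k <= t.
    by rewrite leNgt; apply/negP => /ltW /hk; rewrite ltnn.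
  have km : (k.+1 < m.+1)%N by rewrite ltnS; apply: hk; rewrite sm.
  have sk1T : s k.+1 <= T by rewrite -sm sle.
  have V1 := quartic_variation_le w pP (s0 k) kt.
  have V2 := quartic_variation_le w pP t0 tk.
  have /andP[A1 _] := A_incr (s0 k) kt tT.
  have /andP[A2 _] := A_incr t0 tk sk1T.
  have /andP[_ A3] := A_incr (s0 k) (le_trans kt tk) sk1T.
  have Ao : A (s k.+1) - A (s k) <= o.
    apply: le_trans A3 _; apply: le_trans Hh; rewrite ler_wpM2l//.
    by rewrite sS addrC addKr.
  have [||H|H] := @sqr_le_between _ (quartic_variation F p t w - A t) (e k w) (e k.+1 w) o (ltW o0).
  - by rewrite /e; move: V1 V2 A1 A2 Ao; lra.
  - by rewrite /e; move: V1 V2 A1 A2 Ao; lra.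
  - by apply: le_trans H (term k _); exact: ltnW.
  - exact: le_trans H (term k.+1 km).
apply: (@le_lt_trans _ _ (eps / 2)%:E); last by rewrite lte_fin; move: e0; lra.
apply: (@le_trans _ _ (\int[P]_w (G w)%:E)%E); last by rewrite integral_EFin_Ex// lee_fin.
apply: ge0_le_integral_any => w.
  apply: ereal_sup_ge; exists ((`|quartic_variation F p 0 w - A 0| ^+ 2)%:E).
    by exists 0 => //=; rewrite in_itv/= lexx ltW.
  by rewrite lee_fin sqr_ge0.
apply: ge_ereal_sup => _ [t /= tT' <-]; move: tT'; rewrite in_itv/= => /andP[t0 tT].
by rewrite lee_fin real_normK ?num_real// bound.
Qed.

End UniformConvergence.

(** * Independent random elements *)

Section Independence.
Context {d : measure_display} {Omega : measurableType d} {R : realType}.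
Variable P : probability Omega R.

Definition indep {d1 d2} {T1 : measurableType d1} {T2 : measurableType d2}
  (X : Omega -> T1) (Y : Omega -> T2) : Prop :=
  forall A B, measurable A -> measurable B ->
  (P (X @^-1` A `&` Y @^-1` B) = P (X @^-1` A) * P (Y @^-1` B))%E.

Lemma measurable_preimage {d1} {T1 : measurableType d1} (X : Omega -> T1) A :
  measurable_fun setT X -> measurable A -> measurable (X @^-1` A).
Proof. by move=> mX mA; rewrite -[X in measurable X]setTI; exact: mX. Qed.

Lemma indep_comp {d1 d2 d3 d4} {T1 : measurableType d1} {T2 : measurableType d2}
  {T3 : measurableType d3} {T4 : measurableType d4}
  (X : Omega -> T1) (Y : Omega -> T2) (f : T1 -> T3) (g : T2 -> T4) :
  measurable_fun setT f -> measurable_fun setT g -> indep X Y ->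
  indep (fun w => f (X w)) (fun w => g (Y w)).
Proof.
move=> mf mg XY A B mA mB.
have := XY (f @^-1` A) (g @^-1` B).
by apply; rewrite -[X in measurable X]setTI; [exact: mf|exact: mg].
Qed.

(** The law of the pair restricted to the event [Y \in C] and its multiple by the
    probability of that event are finite measures; they agree on rectangles,
    which are stable under intersection and generate the product. *)
Lemma indep_pair {d1 d2 d3} {T1 : measurableType d1} {T2 : measurableType d2}
  {T3 : measurableType d3} (X1 : Omega -> T1) (X2 : Omega -> T2) (Y : Omega -> T3) :
  measurable_fun setT X1 -> measurable_fun setT X2 -> measurable_fun setT Y ->
  (forall A1 A2 C, measurable A1 -> measurable A2 -> measurable C ->
   (P (X1 @^-1` A1 `&` X2 @^-1` A2 `&` Y @^-1` C) =
    P (X1 @^-1` A1 `&` X2 @^-1` A2) * P (Y @^-1` C))%E) ->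
  indep (fun w => (X1 w, X2 w)) Y.
Proof.
move=> mX1 mX2 mY H S C mS mC.
pose Z w := (X1 w, X2 w).
have mZ : measurable_fun setT Z by exact: measurable_fun_pair.
have mYC := measurable_preimage mY mC.
have finC : P (Y @^-1` C) \is a fin_num by exact: fin_num_measure.
pose r : {nonneg R} := NngNum (fine_ge0 (measure_ge0 P (Y @^-1` C))).
pose Z' : {mfun Omega >-> (T1 * T2)%type} := mfun_Sub (mem_set mZ).
have : pushforward (mrestr P mYC) Z' S = mscale r (distribution P Z') S.
  apply: (@measure_unique _ R _ [set A1 `*` A2 | A1 in measurable & A2 in measurable] (fun=> setT)).
  - exact: measurable_prod_measurableType.
  - move=> _ _ [A mA [B mB <-]] [A' mA' [B' mB' <-]].
    exists (A `&` A'); first exact: measurableI.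
    by exists (B `&` B'); [exact: measurableI|rewrite setXI].
  - by move=> _; exists setT => //; exists setT => //; rewrite setXTT.
  - by rewrite bigcup_const//; exists 0%N.
  - move=> _ [A mA [B mB <-]].
    rewrite /= /pushforward /mrestr /mscale /distribution /pushforward /=.
    rewrite fineK// muleC; exact: H.
  - move=> _; rewrite /= /pushforward /mrestr/= preimage_setT setTI.
    by rewrite (le_lt_trans (probability_le1 P mYC))// ltry.
  - exact: mS.
rewrite /= /pushforward /mrestr /mscale /distribution /pushforward /=.
by rewrite fineK// muleC.
Qed.

(** Fubini's theorem for the joint law.  It stands for conditioning with respect
    to [Y]: [g y] is the conditional probability of the event when [Y = y]. *)
Lemma indep_Ex {d1 d2} {T1 : measurableType d1} {T2 : measurableType d2}
  (X : Omega -> T1) (Y : Omega -> T2) (S : set (T2 * T1)) :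
  measurable_fun setT X -> measurable_fun setT Y -> indep X Y -> measurable S ->
  let g y := fine (P [set w' | S (y, X w')]) in
  measurable_fun setT g /\ fine (P [set w | S (Y w, X w)]) = Ex P (fun w => g (Y w)).
Proof.
move=> mX mY XY mS g.
pose X' : {mfun Omega >-> T1} := mfun_Sub (mem_set mX).
pose Y' : {mfun Omega >-> T2} := mfun_Sub (mem_set mY).
pose Z' : {mfun Omega >-> (T2 * T1)%type} := mfun_Sub (mem_set (measurable_fun_pair mY mX)).
have gE y : (distribution P X' \o xsection S) y = (g y)%:E.
  rewrite /g /= /distribution /pushforward /= fineK; last first.
    apply: fin_num_measure; have := measurable_preimage mX (measurable_xsection y mS).
    by congr measurable; apply/seteqP; split => w /=; rewrite /xsection /= inE.
  by congr (P _); apply/seteqP; split => w /=; rewrite /xsection /= inE.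
have mg : measurable_fun setT g.
  have := measurable_fun_xsection (distribution P X') mS.
  have -> : distribution P X' \o xsection S = EFin \o g by apply/funext => y; exact: gE.
  by move/measurable_EFinP.
split => //.
have prodE := @product_measure_unique _ _ _ _ R (distribution P Y') (distribution P X')
  (distribution P Z').
have : (distribution P Y' \x distribution P X')%E S = distribution P Z' S.
  apply: prodE => // A B mA mB; rewrite /= /distribution /pushforward /= muleC -XY//.
  by congr (P _); apply/seteqP; split => w /= [].
rewrite /product_measure1 => E.
have E2 : P [set w | S (Y w, X w)] = (\int[distribution P Y']_y (g y)%:E)%E.
  by rewrite -[LHS]/(distribution P Z' S) -E; apply: eq_integral => y _; rewrite gE.
rewrite E2 /Ex /Rintegral ge0_integral_distribution//.
- exact/measurable_EFinP.
- by move=> y; rewrite lee_fin fine_ge0.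
Qed.

End Independence.

(** * Independence of Brownian increments from the past *)

Section BrownianIndependence.
Context {d : measure_display} {Omega : measurableType d} {R : realType}.
Variables (P : probability Omega R) (B W : R -> {RV P >-> R}).
Hypothesis W_bm : standard_brownian_motion W.
Hypothesis B0_W_indep : independent_of_process (B 0) W.
Hypothesis B_eq : forall (t : R) (w : Omega), 0 <= t -> B t w = B 0 w + W t w.

(** The relation between [B] and [W] at time 0 makes this hold everywhere, and not
    only almost surely. *)
Lemma W_start w : W 0 w = 0.
Proof. by apply: (@addrI _ (B 0 w)); rewrite -B_eq// addr0. Qed.

Hint Resolve RV_measurable : core.

Lemma increment_measurable s t : measurable_fun setT (fun w => W t w - W s w).
Proof. exact: measurable_funB. Qed.
Hint Resolve increment_measurable : core.

Lemma W_increments_indep a b c : 0 <= a -> a < b -> b < c ->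
  indep P (fun w => W b w - W a w) (fun w => W c w - W b w).
Proof.
move=> a0 ab bc; case: W_bm => _ inc _ _ A1 A2 mA1 mA2.
have := inc 2%N (fun i => nth 0 [:: a; b; c] i) a0.
have hlt i : (i < 2)%N -> nth 0 [:: a; b; c] i < nth 0 [:: a; b; c] i.+1.
  by case: i => [|[|]].
move=> /(_ hlt (fun i : 'I_2 => nth setT [:: A1; A2] i)).
rewrite !big_ord_recl big_ord0 mule1 /= => <-.
  congr (P _); apply/seteqP; split => [w [h1 h2] i _|w h].
    by case: i => -[|[|//]] /=.
  by split; [exact: (h ord0)|exact: (h (lift ord0 ord0))].
by case => -[|[|//]].
Qed.

Lemma W_increments_indep3 a b c e A1 A2 A3 : 0 <= a -> a < b -> b < c -> c < e ->
  measurable A1 -> measurable A2 -> measurable A3 ->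
  (P ((fun w => (W b w - W a w)%R) @^-1` A1 `&` (fun w => (W c w - W b w)%R) @^-1` A2 `&`
    (fun w => (W e w - W c w)%R) @^-1` A3) =
  P ((fun w => (W b w - W a w)%R) @^-1` A1) * P ((fun w => (W c w - W b w)%R) @^-1` A2) *
  P ((fun w => (W e w - W c w)%R) @^-1` A3))%E.
Proof.
move=> a0 ab bc ce mA1 mA2 mA3; case: W_bm => _ inc _ _.
have := inc 3%N (fun i => nth 0 [:: a; b; c; e] i) a0.
have hlt i : (i < 3)%N -> nth 0 [:: a; b; c; e] i < nth 0 [:: a; b; c; e] i.+1.
  by case: i => [|[|[|]]].
move=> /(_ hlt (fun i : 'I_3 => nth setT [:: A1; A2; A3] i)).
rewrite !big_ord_recl big_ord0 mule1 /= muleA => <-.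
  congr (P _); apply/seteqP; split => [w [[h1 h2] h3] i _|w h].
    by case: i => -[|[|[|//]]] /=.
  split; first split; first exact: (h ord0).
    exact: (h (lift ord0 ord0)).
  exact: (h (lift ord0 (lift ord0 ord0))).
by case => -[|[|[|//]]].
Qed.

(** The pair is a function of the increments over [[0, s]] and [[s, r]].  The case
    [s = 0] is apart because the times of the increments must be distinct. *)
Lemma W_pair_indep s r t : 0 <= s -> s < r -> r < t ->
  indep P (fun w => (W s w, W r w)) (fun w => W t w - W r w).
Proof.
move=> s0 sr rt; move: s0; rewrite le_eqVlt => /orP[/eqP s0|s0].
  have := W_increments_indep (lexx 0); rewrite s0 => /(_ _ _ sr rt) h.
  have := @indep_comp _ _ _ P _ _ _ _ _ _ (R * R)%type _ _ _ (fun x => (0, x)) id _ _ h.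
  have -> : (fun w => (0, W r w - W s w)) = (fun w => (W s w, W r w)).
    by apply/funext => w; rewrite -s0 W_start subr0.
  by apply => //; exact: measurable_fun_pair.
have H : indep P (fun w => (W s w - W 0 w, W r w - W s w)) (fun w => W t w - W r w).
  apply: indep_pair => // A1 A2 C mA1 mA2 mC.
  rewrite W_increments_indep3//; congr (_ * _)%E.
  by rewrite -W_increments_indep.
have := @indep_comp _ _ _ P _ _ _ _ _ _ (R * R)%type _ _ _
  (fun x : R * R => (x.1, x.1 + x.2)) id _ _ H.
have -> : (fun w => ((W s w - W 0 w, W r w - W s w).1,
    (W s w - W 0 w, W r w - W s w).1 + (W s w - W 0 w, W r w - W s w).2)) =
  (fun w => (W s w, W r w)).
  by apply/funext => w /=; rewrite W_start subr0 addrC subrK.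
apply => //; apply: measurable_fun_pair => //.
by apply: measurable_funD.
Qed.

Let GW : set (set Omega) := [set E | exists t : R, exists A : set R,
         [/\ 0 <= t, measurable A & E = W t @^-1` A]].

Let W_sigma t : 0 <= t ->
  measurable_fun (setT : set (g_sigma_algebraType GW)) (W t : Omega -> R).
Proof.
move=> t0 _ A mA; rewrite setTI; apply: sub_sigma_algebra.
by exists t, A.
Qed.

(** [B 0] is independent of all of [W], so it joins the past [(W s, W r)] without
    affecting the independence from the increment; [(B s, B r)] is a function of
    these three variables. *)
Lemma B_pair_indep s r t : 0 <= s -> s < r -> r < t ->
  indep P (fun w => (B s w, B r w)) (fun w => W t w - W r w).
Proof.
move=> s0 sr rt; have r0 : 0 <= r by rewrite (le_trans s0)// ltW.
have t0 : 0 <= t by rewrite (le_trans r0)// ltW.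
have VD := W_pair_indep s0 sr rt.
have sV : measurable_fun (setT : set (g_sigma_algebraType GW))
    (fun w => (W s w, W r w)) by apply: measurable_fun_pair; exact: W_sigma.
have sD : measurable_fun (setT : set (g_sigma_algebraType GW))
    (fun w => W t w - W r w) by apply: measurable_funB; exact: W_sigma.
have H : indep P (fun w => (B 0 w, (W s w, W r w))) (fun w => W t w - W r w).
  apply: indep_pair => // [|A V C mA mV mC]; first exact: measurable_fun_pair.
  have sEV : process_sigma_algebra W ((fun w => (W s w, W r w)) @^-1` V).
    by have := sV measurableT V mV; rewrite setTI.
  have sEC : process_sigma_algebra W ((fun w => W t w - W r w) @^-1` C).
    by have := sD measurableT C mC; rewrite setTI.
  have sEVC : process_sigma_algebra W ((fun w => (W s w, W r w)) @^-1` V `&`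
      (fun w => W t w - W r w) @^-1` C).
    exact: (@measurableI _ (g_sigma_algebraType GW)).
  by rewrite -setIA !B0_W_indep// VD// muleA.
have := @indep_comp _ _ _ P _ _ _ _ _ _ (R * R)%type _ _ _
  (fun x : R * (R * R) => (x.1 + x.2.1, x.1 + x.2.2)) id _ _ H.
have -> : (fun w => ((B 0 w, (W s w, W r w)).1 + (B 0 w, (W s w, W r w)).2.1,
    (B 0 w, (W s w, W r w)).1 + (B 0 w, (W s w, W r w)).2.2)) =
  (fun w => (B s w, B r w)).
  by apply/funext => w /=; rewrite -!B_eq.
apply => //; apply: measurable_fun_pair; apply: measurable_funD => //;
  by apply: measurableT_comp.
Qed.

Lemma B_indep r t : 0 <= r -> r < t -> indep P (B r : Omega -> R) (fun w => W t w - W r w).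
Proof.
move=> r0 rt; move: (r0); rewrite le_eqVlt => /orP[/eqP r00|r1].
  rewrite -r00 => A C mA mC; apply: B0_W_indep => //.
  have sD : measurable_fun (setT : set (g_sigma_algebraType GW)) (fun w => W t w - W 0 w).
    by apply: measurable_funB; apply: W_sigma => //; rewrite (le_trans r0)// ltW.
  by have := sD measurableT C mC; rewrite setTI.
have := @indep_comp _ _ _ P _ _ _ _ _ _ R R _ _ (fun x => x.2) id _ _
  (B_pair_indep (lexx 0) r1 rt).
by apply => //; exact: measurable_snd.
Qed.

End BrownianIndependence.

(** * Distribution functions and densities *)

Section EventProbability.
Context {d : measure_display} {Omega : measurableType d} {R : realType}.
Variable P : probability Omega R.

Definition pr (E : set Omega) : R := fine (P E).

Lemma pr_ge0 E : 0 <= pr E. Proof. by rewrite fine_ge0. Qed.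

Lemma pr_le1 E : measurable E -> pr E <= 1.
Proof.
move=> mE; rewrite -lee_fin fineK; last exact: fin_num_measure.
exact: probability_le1.
Qed.

Lemma pr_le E1 E2 : measurable E1 -> measurable E2 -> E1 `<=` E2 -> pr E1 <= pr E2.
Proof.
move=> m1 m2 sub; apply: fine_le; try exact: fin_num_measure.
by apply: le_measure => //; rewrite inE.
Qed.

Lemma pr_split E1 E2 : measurable E1 -> measurable E2 ->
  pr E1 = pr (E1 `&` E2) + pr (E1 `\` E2).
Proof.
move=> m1 m2; have mI := measurableI _ _ m1 m2; have mD := measurableD m1 m2.
rewrite /pr -fineD; try exact: fin_num_measure.
congr fine; rewrite -measureU//; first by rewrite setUIDK.
by rewrite setDE setIACA setICr setI0.
Qed.

End EventProbability.

Section CumulativeDistribution.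
Context {d : measure_display} {Omega : measurableType d} {R : realType}.
Variables (P : probability Omega R) (X : Omega -> R).
Hypothesis mX : measurable_fun setT X.

Lemma measurable_le_event x : measurable [set w | X w <= x].
Proof.
have := measurable_preimage mX (measurable_itv `]-oo, x]).
by congr measurable; apply/seteqP; split => w /=; rewrite in_itv.
Qed.

Lemma measurable_between_event x y : measurable [set w | x < X w <= y].
Proof.
have := measurable_preimage mX (measurable_itv `]x, y]).
by congr measurable; apply/seteqP; split => w /=; rewrite in_itv.
Qed.

Lemma cdf_between x y : x <= y ->
  pr P [set w | x < X w <= y] = pr P [set w | X w <= y] - pr P [set w | X w <= x].
Proof.
move=> xy; rewrite (pr_split P (measurable_le_event y) (measurable_le_event x)).
have -> : [set w | X w <= y] `&` [set w | X w <= x] = [set w | X w <= x].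
  by apply/seteqP; split => w /=; [case|move=> h; split => //; exact: le_trans xy].
have -> : [set w | X w <= y] `\` [set w | X w <= x] = [set w | x < X w <= y].
  apply/seteqP; split => w /=; first by case=> -> /negP; rewrite -ltNge => ->.
  by move=> /andP[h ->]; split => //; apply/negP; rewrite -ltNge.
by rewrite addrAC subrr add0r.
Qed.

Lemma cdf_mono x y : x <= y -> pr P [set w | X w <= x] <= pr P [set w | X w <= y].
Proof. by move=> xy; rewrite -subr_ge0 -cdf_between// pr_ge0. Qed.

Lemma pos_cdf_between x y : pr P [set w | x < X w <= y] =
  Num.max (pr P [set w | X w <= y] - pr P [set w | X w <= x]) 0.
Proof.
have [xy|yx] := lerP x y.
  by rewrite cdf_between// max_l// subr_ge0 cdf_mono.
rewrite max_r ?subr_le0 ?cdf_mono ?(ltW yx)//.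
have -> : [set w | x < X w <= y] = set0.
  by apply/seteqP; split => w //= /andP[h1 h2]; have := lt_trans (lt_le_trans h1 h2) yx; rewrite ltxx.
by rewrite /pr measure0.
Qed.

Lemma density_between (g : R -> R) x y : measurable_fun setT g ->
  (forall z, 0 <= g z) -> has_law P X (density_law g) ->
  (pr P [set w | x < X w <= y])%:E = (\int[lebesgue_measure]_(z in `]x, y]) (g z)%:E)%E.
Proof.
move=> mg g0 XN; have := XN _ (measurable_itv `]x, y]); rewrite /density_law => <-.
have -> : X @^-1` `]x, y]%classic = [set w | x < X w <= y].
  by apply/seteqP; split => w /=; rewrite in_itv.
by rewrite /pr fineK// fin_num_measure//; exact: measurable_between_event.
Qed.

Lemma density_between_bounds (g : R -> R) x y m M : x <= y -> measurable_fun setT g ->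
  (forall z, 0 <= g z) -> has_law P X (density_law g) -> 0 <= m ->
  (forall z, x < z -> z <= y -> m <= g z <= M) ->
  m * (y - x) <= pr P [set w | x < X w <= y] <= M * (y - x).
Proof.
move=> xy mg g0 XN m0 bnd.
have cst c : (\int[lebesgue_measure]_(z in `]x, y]) c%:E = (c * (y - x))%:E)%E.
  rewrite integral_cst//= lebesgue_measure_itv/= lte_fin.
  move: xy; rewrite le_eqVlt => /orP[/eqP ->|->]; last by rewrite -EFinB -EFinM.
  by rewrite ltxx subrr mulr0 mule0.
have mgx : measurable_fun `]x, y] (fun z : R => (g z)%:E).
  by apply/measurable_EFinP; exact: measurable_funTS.
rewrite -!lee_fin (density_between x y mg g0 XN) -(cst m) -(cst M); apply/andP; split.
  apply: ge0_le_integral => //.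
  by move=> z /=; rewrite in_itv/= => /andP[z1 z2]; have /andP[h _] := bnd z z1 z2; rewrite lee_fin.
apply: ge0_le_integral => //; first by move=> z _; rewrite lee_fin.
by move=> z /=; rewrite in_itv/= => /andP[z1 z2]; have /andP[_ h] := bnd z z1 z2; rewrite lee_fin.
Qed.

End CumulativeDistribution.

(** A quantitative way of saying that [g] is the derivative of [Phi] and is
    Lipschitz (the latter is [taylor2_lipschitz]).  Being a uniform inequality, it
    passes directly to averages of translates. *)
Definition taylor2 {R : realType} (K : R) (Phi g : R -> R) : Prop :=
  forall x h, `|Phi (x + h) - Phi x - h * g x| <= K * h ^+ 2.

(** Add the expansions from [x] to [y] and from [y] to [x]. *)
Lemma taylor2_lipschitz {R : realType} (K : R) (Phi g : R -> R) x y :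
  taylor2 K Phi g -> `|g x - g y| <= 2 * K * `|x - y|.
Proof.
move=> H; have [->|xy] := eqVneq x y; first by rewrite !subrr normr0 mulr0.
have h1 := H x (y - x); have h2 := H y (x - y).
rewrite !subrKC in h1 h2; have e0 : 0 < `|x - y| by rewrite normr_gt0 subr_eq0.
rewrite -(ler_pM2r e0) -normrM.
have -> : 2 * K * `|x - y| * `|x - y| = K * (y - x) ^+ 2 + K * (x - y) ^+ 2.
  by rewrite -mulrA -expr2 real_normK ?num_real//; ring.
have -> : (g x - g y) * (x - y) = (Phi y - Phi x - (y - x) * g x) + (Phi x - Phi y - (x - y) * g y).
  by ring.
by apply: le_trans (ler_normD _ _) _; apply: lerD.
Qed.

Lemma density_taylor2 {d : measure_display} {Omega : measurableType d} {R : realType}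
  (P : probability Omega R) (X : Omega -> R) (f : R -> R) K :
  measurable_fun setT X -> measurable_fun setT f -> (forall z, 0 <= f z) ->
  has_law P X (density_law f) -> 0 <= K ->
  (forall x y, `|f x - f y| <= K * `|x - y|) ->
  taylor2 K (fun x => pr P [set w | X w <= x]) f.
Proof.
move=> mX mf f0 XN K0 lip x h.
have pos a b c : a <= b -> (a <= c) -> (c <= b) ->
    `|pr P [set w | X w <= b] - pr P [set w | X w <= a] - (b - a) * f c| <= K * (b - a) ^+ 2.
  move=> ab ac cb; rewrite -cdf_between//.
  have bnd z : a < z -> z <= b -> Num.max (f c - K * (b - a)) 0 <= f z <= f c + K * (b - a).
    move=> az zb; have := lip z c.
    have : `|z - c| <= b - a by rewrite ler_norml; apply/andP; split; lra.
    move=> /(ler_wpM2l K0) h1 /le_trans /(_ h1); rewrite ler_norml => /andP[h2 h3].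
    by rewrite ge_max f0 andbT; apply/andP; split; lra.
  have mx0 : 0 <= Num.max (f c - K * (b - a)) 0 by rewrite le_max lexx orbT.
  have /andP[l1 l2] := density_between_bounds mX ab mf f0 XN mx0 bnd.
  have l3 : (f c - K * (b - a)) * (b - a) <= pr P [set w | a < X w <= b].
    by apply: le_trans l1; rewrite ler_wpM2r ?subr_ge0// le_max lexx.
  move: (pr P _) l2 l3 => p l2 l3.
  by rewrite ler_norml; apply/andP; split; nra.
have [h0|h0] := lerP 0 h.
  have := pos x (x + h) x; rewrite lerDl h0 lexx (addrC x) addrK; exact.
have := pos (x + h) x x; rewrite gerDl lexx ltW// => /(_ isT isT isT).
have -> : x - (x + h) = - h by ring.
rewrite sqrrN -normrN => H; apply: le_trans H; rewrite le_eqVlt; apply/orP; left; apply/eqP.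
by congr `|_|; ring.
Qed.

(** * Normal random variables of given variance *)

Section NormalVariable.
Context {d : measure_display} {Omega : measurableType d} {R : realType}.
Variables (P : probability Omega R) (D : Omega -> R) (v : R).
Hypotheses (v0 : 0 < v) (mD : measurable_fun setT D).
Hypothesis D_law : has_law P D (normal_prob 0 (Num.sqrt v)).
Let s0 : 0 < Num.sqrt v. Proof. by rewrite sqrtr_gt0. Qed.

Lemma normal_var_mean : intg P D /\ Ex P D = 0.
Proof.
have [i E] := normal_mean s0; have [i' E'] := law_normal_Ex mD D_law i.
by split => //; apply: etrans E' E.
Qed.

Lemma normal_var_sqr : intg P (fun w => D w ^+ 2) /\ Ex P (fun w => D w ^+ 2) = v.
Proof.
have [i E] := normal_moment2 s0; have [i' E'] := law_normal_Ex mD D_law i.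
by split => //; apply: etrans E' _; rewrite E sqr_sqrtr// ltW.
Qed.

Lemma normal_var_abs : intg P (fun w => `|D w|) /\
  Ex P (fun w => `|D w|) = Num.sqrt v * Num.sqrt (2 / pi).
Proof.
have [i E] := normal_abs s0; have [i' E'] := law_normal_Ex mD D_law i.
by split => //; apply: etrans E' E.
Qed.

Lemma normal_var_pos : intg P (fun w => Num.max (D w) 0) /\
  Ex P (fun w => Num.max (D w) 0) = Num.sqrt v * Num.sqrt (2 / pi) / 2.
Proof.
have [i E] := normal_pos s0; have [i' E'] := law_normal_Ex mD D_law i.
by split => //; apply: etrans E' E.
Qed.

Lemma normal_var_abs_le : Ex P (fun w => `|D w|) <= Num.sqrt v.
Proof.
have [_ ->] := normal_var_abs; apply: ler_piMr; first exact: ltW.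
rewrite -[leRHS]sqrtr1 ler_wsqrtr// ler_pdivrMr ?pi_gt0// mul1r.
exact: pi_ge2.
Qed.

Lemma normal_density_le x : normal_pdf 0 (Num.sqrt v) x <= (Num.sqrt v)^-1.
Proof.
apply: le_trans (normal_pdf_ub _ _ (lt0r_neq0 s0)) _.
rewrite /normal_peak sqr_sqrtr ?(ltW v0)// lef_pV2 ?posrE ?sqrtr_gt0 ?mulrn_wgt0 ?mulr_gt0 ?pi_gt0//.
rewrite ler_wsqrtr// -mulr_natr -mulrA ler_peMr ?(ltW v0)//.
have := @pi_ge2 R; move: (pi : R) => p; lra.
Qed.

Lemma normal_var_ball_le (c l : R) : 0 <= l ->
  pr P [set w | `|D w - c| <= l] <= (Num.sqrt v)^-1 * (2 * l).
Proof.
move=> l0.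
have -> : [set w | `|D w - c| <= l] = D @^-1` `[c - l, c + l]%classic.
  by apply/seteqP; split => w /=; rewrite in_itv/= ler_distl.
rewrite /pr D_law//.
rewrite -lee_fin fineK; last by apply: fin_num_measure.
rewrite /normal_prob.
apply: (@le_trans _ _ (\int[lebesgue_measure]_(x in `[(c - l)%R, (c + l)%R]) ((Num.sqrt v)^-1)%:E)%E).
  apply: ge0_le_integral => //.
  - by move=> x _; rewrite lee_fin normal_pdf_ge0.
  - by apply/measurable_EFinP/measurable_funTS; exact: measurable_normal_pdf.
  - by move=> x _; rewrite lee_fin normal_density_le.
rewrite integral_cst//= lebesgue_measure_itv/= lte_fin.
case: ifP => _; last by rewrite mule0 lee_fin mulr_ge0 ?mulr_ge0// invr_ge0 ltW.
rewrite -EFinB -EFinM lee_fin.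
by have -> : c + l - (c - l) = 2 * l by ring.
Qed.

Lemma normal_var_interval_gt0 (a b : R) : a < b ->
  0 < pr P [set w | a < D w <= b].
Proof.
move=> ab.
have -> : [set w | a < D w <= b] = D @^-1` `]a, b]%classic.
  by apply/seteqP; split => w /=; rewrite in_itv/=.
rewrite /pr D_law//.
rewrite -lte_fin fineK; last by apply: fin_num_measure.
rewrite /normal_prob.
pose M := Num.max `|a| `|b|.
have M0 : 0 <= M by rewrite le_max normr_ge0.
pose m := normal_peak (Num.sqrt v) * expR (- (M ^+ 2 / (2 * v))).
have m0 : 0 < m by rewrite mulr_gt0 ?expR_gt0// normal_peak_gt0// lt0r_neq0.
apply: (@lt_le_trans _ _ (\int[lebesgue_measure]_(x in `]a, b]) m%:E)%E).
  rewrite integral_cst//= lebesgue_measure_itv/= lte_fin ab -EFinB -EFinM lte_fin.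
  by rewrite mulr_gt0// subr_gt0.
apply: ge0_le_integral => //.
- by move=> x _; rewrite lee_fin ltW.
- by apply/measurable_EFinP/measurable_funTS; exact: measurable_normal_pdf.
- move=> x /=; rewrite in_itv/= => /andP[ax xb].
  rewrite lee_fin normal_pdf_bump// ler_wpM2l ?normal_peak_ge0//.
  rewrite /gaussian_bump ler_expR lerN2 sqr_sqrtr ?(ltW v0)//.
  rewrite ler_wpM2r ?invr_ge0 ?mulr_ge0 ?(ltW v0)//.
  rewrite -(real_normK (num_real x)) ler_pXn2r ?nnegrE ?normr_ge0 ?M0//.
  rewrite ler_norml; apply/andP; split.
    rewrite lerNl /M le_max -(normrN a) (le_trans _ (ler_norm (- a)))//.
    by rewrite lerN2 ltW.
  by rewrite /M le_max (le_trans xb (ler_norm b)) orbT.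
Qed.

End NormalVariable.

(** * The distribution function of the diffusing variable *)

(** A density is only defined up to a null set; continuity singles out the
    derivative of the distribution function, since two different values at [x]
    would give different masses to a short interval starting there. *)
Lemma continuous_density_taylor2 {d : measure_display} {Omega : measurableType d} {R : realType}
  (P : probability Omega R) (X : Omega -> R) (v g : R -> R) K :
  measurable_fun setT X -> measurable_fun setT v -> (forall z, 0 <= v z) ->
  has_law P X (density_law v) -> 0 <= K -> continuous v ->
  taylor2 K (fun x => pr P [set w | X w <= x]) g -> forall x, v x = g x.
Proof.
move=> mX mv v0 XN K0 cv Tg x; apply/eqP; rewrite -subr_eq0 -normr_eq0; apply/eqP.
set e := `|v x - g x|; apply/eqP; rewrite eq_le normr_ge0 andbT leNgt; apply/negP => e0.
have e4 : 0 < e / 4 by rewrite divr_gt0.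
have [dl /= dl0 Hdl] : nbhs_ball x (fun z => `|v x - v z| <= e / 4).
  by apply/nbhs_ballP; have /cvgrPdist_le := cv x; apply.
have [h1 h10 Hh1] := small_mul K0 e4.
pose h := Num.min (dl / 2) h1.
have h0 : 0 < h by rewrite lt_min h10 divr_gt0.
have hdl : h < dl by rewrite gt_min; apply/orP; left; lra.
have Kh : K * h <= e / 4 by apply: le_trans Hh1; rewrite ler_wpM2l// ge_min lexx orbT.
have xh : x <= x + h by rewrite lerDl ltW.
have bnd z : x < z -> z <= x + h -> Num.max (v x - e / 4) 0 <= v z <= v x + e / 4.
  move=> xz zh; have := Hdl z; rewrite /ball/= => H.
  have : `|x - z| < dl by rewrite ltr_distl; apply/andP; split; lra.
  move=> /H; rewrite ler_norml => /andP[a1 a2].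
  by rewrite ge_max v0 andbT; apply/andP; split; lra.
have mx0 : 0 <= Num.max (v x - e / 4) 0 by rewrite le_max lexx orbT.
have /andP[l1 l2] := density_between_bounds mX xh mv v0 XN mx0 bnd.
have l3 : (v x - e / 4) * (x + h - x) <= pr P [set w | x < X w <= x + h].
  by apply: le_trans l1; rewrite ler_wpM2r ?subr_ge0// le_max lexx.
rewrite cdf_between// in l2 l3.
have := Tg x h; rewrite ler_norml => /andP[t1 t2].
have hh : K * h ^+ 2 <= e / 4 * h by rewrite expr2 mulrA ler_wpM2r// ltW.
move: l2 l3 t1 t2; have -> : x + h - x = h by ring.
move: (pr P _) (pr P _) => p1 p2 l2 l3 t1 t2.
have : e * h <= e / 2 * h.
  rewrite -{1}(gtr0_norm h0) /e -normrM ler_norml -/e; apply/andP; split; lra.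
by rewrite ler_pM2r//; lra.
Qed.

Section ProcessDistribution.
Context {d : measure_display} {Omega : measurableType d} {R : realType}.
Variables (P : probability Omega R) (B W : R -> {RV P >-> R}).
Hypothesis W_bm : standard_brownian_motion W.
Hypothesis B0_W_indep : independent_of_process (B 0) W.
Hypothesis B_eq : forall (t : R) (w : Omega), 0 <= t -> B t w = B 0 w + W t w.
Variables (f : R -> R) (K M : R).
Hypothesis f_density : is_density P (B 0) f.
Hypotheses (K0 : 0 < K) (f_lip : forall x y, `|f x - f y| <= K * `|x - y|).
Hypothesis f_le : forall x, f x <= M.
Variable u : R -> R -> R.
Hypothesis u0 : forall x : R, u x 0 = f x.
Hypothesis u_density : forall t : R, 0 < t -> is_density P (B t) (fun x => u x t).
Hypothesis u_continuous : forall t : R, 0 < t -> continuous (fun x => u x t).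

Definition Phi s x : R := pr P [set w | B s w <= x].
Local Notation D s t := (fun w => W t w - W s w).

Lemma increment_law s t : 0 <= s -> s < t -> has_law P (D s t) (normal_prob 0 (Num.sqrt (t - s))).
Proof. by case: W_bm => _ _ + _; exact. Qed.

Lemma B_increment s t w : 0 <= s -> s < t -> B t w = B s w + (W t w - W s w).
Proof.
move=> s0 st; have t0 : 0 <= t by rewrite (le_trans s0)// ltW.
by rewrite (B_eq w s0) (B_eq w t0); ring.
Qed.

(** [B t] is the sum of [B s] and of an independent increment. *)
Lemma Phi_convolution s t x : 0 <= s -> s < t ->
  intg P (fun w => Phi s (x - D s t w)) /\
  Phi t x = Ex P (fun w => Phi s (x - D s t w)).
Proof.
move=> s0 st.
have ind := B_indep W_bm B0_W_indep B_eq s0 st.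
pose S : set (R * R) := [set z | z.2 + z.1 <= x].
have mS : measurable S.
  have mf : measurable_fun setT (fun z : R * R => z.2 + z.1) by apply: measurable_funD.
  have := mf measurableT _ (measurable_itv `]-oo, x]); rewrite setTI.
  by congr measurable; apply/seteqP; split => z /=; rewrite in_itv.
have [mg E] := indep_Ex (RV_measurable (B s)) (increment_measurable W s t) ind mS.
have gE y : fine (P [set w' | S (y, B s w')]) = Phi s (x - y).
  by rewrite /Phi /pr; congr (fine (P _)); apply/seteqP; split => w; rewrite /S /= lerBrDr.
have mPhi : measurable_fun setT (fun y : R => Phi s (x - y)).
  by have -> : (fun y => Phi s (x - y)) = (fun y => fine (P [set w' | S (y, B s w')]))
    by apply/funext => y; rewrite gE.
split.
  apply: (@intg_bounded _ _ _ _ _ 1).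
    exact: measurableT_comp mPhi (increment_measurable W s t).
  move=> w; rewrite ger0_norm ?pr_ge0// pr_le1//.
  by apply: measurable_le_event; exact: RV_measurable.
rewrite /Phi /pr; transitivity (fine (P [set w | S (W t w - W s w, B s w)])).
  by congr (fine (P _)); apply/seteqP; split => w; rewrite /S /= (B_increment w s0 st).
by rewrite E; congr (Ex P _); apply/funext => w; rewrite gE.
Qed.

Let f0 z : 0 <= f z. Proof. by case: f_density. Qed.
Let mf : measurable_fun setT f. Proof. by case: f_density. Qed.

Lemma Phi_taylor0 : taylor2 K (Phi 0) f.
Proof.
case: f_density => _ _ fl.
exact: (density_taylor2 (RV_measurable (B 0)) mf f0 fl (ltW K0) f_lip).
Qed.

Lemma f_shift_intg s x : intg P (fun w => f (x - W s w)).
Proof.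
apply: (@intg_bounded _ _ _ _ _ M).
  apply: measurableT_comp => //; apply: measurable_funB => //; exact: RV_measurable.
by move=> w; rewrite ger0_norm.
Qed.

Lemma Phi_taylor_conv s : 0 < s -> taylor2 K (Phi s) (fun x => Ex P (fun w => f (x - W s w))).
Proof.
move=> s0 x h.
have [i1 E1] := Phi_convolution (x + h) (lexx 0) s0.
have [i2 E2] := Phi_convolution x (lexx 0) s0.
have i3 := f_shift_intg s x.
have i4 := intgB i1 i2; have i5 := intgB i4 (intgZ h i3).
rewrite E1 E2 -(ExB i1 i2) -(ExZ h i3) -(ExB i4 (intgZ h i3)).
apply: (@le_trans _ _ (Ex P (fun=> K * h ^+ 2))); last by rewrite Ex_cst.
apply: Ex_norm_le; [exact: intg_meas i5|exact: intg_cst|] => w.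
have := Phi_taylor0 (x - W s w) h; rewrite (W_start B_eq) subr0.
by have -> : x + h - W s w = x - W s w + h by ring.
Qed.

(** The distribution function of [B s] is an average of translates of that of
    [B 0], so its expansion is the average of theirs, with the same constant; the
    continuous density must be its derivative. *)
Lemma u_convolution s x : 0 < s -> u x s = Ex P (fun w => f (x - W s w)).
Proof.
move=> s0; case: (u_density s0) => mu u_ge0 ul.
by apply: (continuous_density_taylor2 (RV_measurable (B s)) mu u_ge0 ul (ltW K0) (u_continuous s0)
  (Phi_taylor_conv s0)).
Qed.

Lemma Phi_taylor s : 0 <= s -> taylor2 K (Phi s) (fun x => u x s).
Proof.
rewrite le_eqVlt => /orP[/eqP <-|s0].
  by move=> x h; rewrite u0; exact: Phi_taylor0.
by move=> x h; rewrite u_convolution//; exact: Phi_taylor_conv.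
Qed.

Lemma u_le s x : 0 <= s -> u x s <= M.
Proof.
rewrite le_eqVlt => /orP[/eqP <-|s0]; first by rewrite u0.
rewrite u_convolution// -[leRHS](Ex_cst P).
by apply: Ex_le => //; [exact: f_shift_intg|exact: intg_cst].
Qed.

(** By the Lipschitz bound [f] is at least [f z / 2] near [z], and the increment
    from time 0 brings [x] there with positive probability. *)
Lemma u_gt0 s x z : 0 < f z -> 0 < s -> 0 < u x s.
Proof.
move=> fz s0; rewrite u_convolution//.
pose c := f z / 2; have c0 : 0 < c by rewrite divr_gt0.
have [r r0 Hr] := small_mul (ltW K0) c0.
pose E := [set w | x - z - r < D 0 s w <= x - z + r].
have mE : measurable E by apply: measurable_between_event; exact: increment_measurable.
have E0 : 0 < pr P E.
  have s1 : 0 < s - 0 by rewrite subr0.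
  apply: (normal_var_interval_gt0 s1 (increment_law (lexx 0) s0)).
  by lra.
apply: lt_le_trans (_ : c * pr P E <= _); first by rewrite mulr_gt0.
rewrite /pr -Ex_indic// -ExZ; last exact: intg_indic.
apply: Ex_le; [by apply: intgZ; exact: intg_indic|exact: f_shift_intg|].
move=> w; rewrite indicE; have [|_] := boolP (w \in E); last by rewrite mulr0.
rewrite inE mulr1 /E /= (W_start B_eq) subr0 => /andP[h1 h2].
have := f_lip z (x - W s w).
have : `|z - (x - W s w)| <= r by rewrite ler_norml; apply/andP; split; lra.
move=> /(ler_wpM2l (ltW K0)) l1 /le_trans /(_ l1) /le_trans /(_ Hr).
by rewrite ler_norml /c => /andP[l2 l3]; lra.
Qed.

(** In the expansion of [Phi s] around [x], the first order term averages to 0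
    because the increment is centered; the second order one is bounded by its
    variance [t - s]. *)
Lemma Phi_time s t x : 0 <= s -> s < t -> `|Phi t x - Phi s x| <= K * (t - s).
Proof.
move=> s0 st; have ts : 0 < t - s by rewrite subr_gt0.
have [i1 E1] := Phi_convolution x s0 st.
have mD := increment_measurable W s t; have lD := increment_law s0 st.
have [iD ED] := normal_var_mean ts mD lD.
have [iD2 ED2] := normal_var_sqr ts mD lD.
have i2 := intgB i1 (intg_cst P (Phi s x)).
have i3 := intgD i2 (intgZ (u x s) iD).
have -> : Phi t x - Phi s x = Ex P (fun w => Phi s (x - D s t w) - Phi s x + u x s * D s t w).
  by rewrite (ExD i2 (intgZ (u x s) iD)) (ExB i1 (intg_cst P _)) (ExZ _ iD) ED mulr0 addr0 Ex_cst E1.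
rewrite -ED2 -(ExZ K iD2); apply: Ex_norm_le; [exact: intg_meas i3|exact: intgZ|] => w.
have := Phi_taylor s0 x (- (W t w - W s w)); rewrite sqrrN /=.
have -> : Phi s (x + - (W t w - W s w)) - Phi s x - - (W t w - W s w) * u x s =
  Phi s (x - (W t w - W s w)) - Phi s x + u x s * (W t w - W s w) by ring.
exact.
Qed.

Lemma Phi_mono s x y : x <= y -> Phi s x <= Phi s y.
Proof. by move=> xy; apply: cdf_mono => //; exact: RV_measurable. Qed.

End ProcessDistribution.

(** * Regularity of the quantile and of the density there *)

Section QuantileRegularity.
Context {R : realType}.
Variables (K alpha : R) (Phi u : R -> R -> R) (q : R -> R).
Hypothesis K0 : 0 < K.
Hypothesis Phi_taylor : forall s, 0 <= s -> taylor2 K (Phi s) (fun x => u x s).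
Hypothesis Phi_time : forall s t x, 0 <= s -> s < t -> `|Phi t x - Phi s x| <= K * (t - s).
Hypothesis Phi_mono : forall s x y, x <= y -> Phi s x <= Phi s y.
Hypothesis Phi_q : forall s, 0 <= s -> Phi s (q s) = alpha.
Hypothesis u_q_gt0 : forall s, 0 <= s -> 0 < u (q s) s.
Local Notation U s := (u (q s) s).

Lemma Phi_time_abs s t x : 0 <= s -> 0 <= t -> `|Phi t x - Phi s x| <= K * `|t - s|.
Proof.
move=> s0 t0; have [st|ts|->] := ltgtP s t; last by rewrite !subrr normr0 mulr0.
  by rewrite (@ger0_norm _ (t - s)) ?subr_ge0 ?(ltW st)//; exact: Phi_time.
by rewrite distrC (distrC t s) (@ger0_norm _ (s - t)) ?subr_ge0 ?(ltW ts)//; exact: Phi_time.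
Qed.

(** At distance [h] from [q s], the distribution function at time [s] differs from
    [alpha] by at least [h * (U s / 2)]; the change between [s] and [t] is too small
    to compensate for it. *)
Lemma quantile_near s t h : 0 <= s -> 0 <= t -> 0 < h -> K * h <= U s / 2 ->
  K * `|t - s| < h * (U s / 2) -> `|q t - q s| <= h.
Proof.
move=> s0 t0 h0 Kh Kts.
have hh : K * h ^+ 2 <= h * (U s / 2) by rewrite expr2 mulrA (mulrC h) ler_wpM2r// ltW.
have up : alpha < Phi t (q s + h).
  have := Phi_taylor s0 (q s) h; rewrite Phi_q// ler_norml => /andP[t1 _].
  have := Phi_time_abs (q s + h) s0 t0; rewrite ler_norml => /andP[t2 _].
  by move: (U s) Kh Kts hh t1 t2 => c Kh Kts hh t1 t2; lra.
have low : Phi t (q s - h) < alpha.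
  have := Phi_taylor s0 (q s) (- h); rewrite Phi_q// ler_norml sqrrN => /andP[_ t1].
  have := Phi_time_abs (q s - h) s0 t0; rewrite ler_norml => /andP[_ t2].
  by move: (U s) Kh Kts hh t1 t2 => c Kh Kts hh t1 t2; lra.
rewrite ler_norml; apply/andP; split; rewrite leNgt; apply/negP => H.
  have : q t <= q s - h by lra.
  by move=> /(Phi_mono t); rewrite Phi_q// leNgt low.
have : q s + h <= q t by lra.
by move=> /(Phi_mono t); rewrite Phi_q// leNgt up.
Qed.

(** Compare the expansions at times [s] and [t] with step
    [h = sqrt `|t - s|]: the distribution functions differ by [K * h ^+ 2], hence
    their derivatives by a multiple of [h]. *)
Lemma u_time s t x : 0 <= s -> 0 <= t -> `|u x t - u x s| <= 4 * K * Num.sqrt `|t - s|.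
Proof.
move=> s0 t0; have [->|ts] := eqVneq s t; first by rewrite !subrr normr0 sqrtr0 mulr0.
set h := Num.sqrt _; have h0 : 0 < h by rewrite sqrtr_gt0 normr_gt0 subr_eq0 eq_sym.
have h2 : `|t - s| = h ^+ 2 by rewrite sqr_sqrtr.
rewrite -(ler_pM2l h0) -{1}(gtr0_norm h0) -normrM.
have := Phi_taylor s0 x h; have := Phi_taylor t0 x h.
have := Phi_time_abs (x + h) s0 t0; have := Phi_time_abs x s0 t0; rewrite h2.
rewrite !ler_norml => /andP[a1 a2] /andP[b1 b2] /andP[c1 c2] /andP[d1 d2].
by apply/andP; split; lra.
Qed.

Lemma u_quantile_dist s t : 0 <= s -> 0 <= t ->
  `|U t - U s| <= 2 * K * `|q t - q s| + 4 * K * Num.sqrt `|t - s|.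
Proof.
move=> s0 t0; have -> : U t - U s = (u (q t) t - u (q s) t) + (u (q s) t - u (q s) s) by ring.
apply: le_trans (ler_normD _ _) _; apply: lerD; last exact: u_time.
exact: taylor2_lipschitz (Phi_taylor t0).
Qed.

(** Freezing the function at negative times extends it to the whole line, where
    it can be minimized and integrated as a continuous function. *)
Lemma u_quantile_continuous : continuous (fun s : R => U (Num.max s 0)).
Proof.
move=> s0; apply/cvgrPdist_le => e e0.
set s := Num.max s0 0; have s_ge0 : 0 <= s by rewrite le_max lexx orbT.
have c0 := u_q_gt0 s_ge0; set c := U s in c0.
have c2 : 0 < c / 2 by rewrite divr_gt0.
have [h1 h10 H1] := small_mul (ltW K0) c2.
have e2 : 0 < e / 4 by rewrite divr_gt0.
have [h2 h20 H2] := small_mul (ltW K0) e2.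
pose h := Num.min h1 h2; have h0 : 0 < h by rewrite lt_min h10.
have Kh1 : K * h <= c / 2 by apply: le_trans H1; rewrite ler_wpM2l ?(ltW K0)// ge_min lexx.
have Kh2 : K * h <= e / 4 by apply: le_trans H2; rewrite ler_wpM2l ?(ltW K0)// ge_min lexx orbT.
have e8 : 0 < e / 8 by rewrite divr_gt0.
have [d1 d10 D1] := small_mul (ltW K0) e8.
have hc : 0 < h * (c / 2) / 2 by rewrite divr_gt0// mulr_gt0.
have [d2 d20 D2] := small_mul (ltW K0) hc.
near=> t0.
set t := Num.max t0 0; have t_ge0 : 0 <= t by rewrite le_max lexx orbT.
have ts0 : `|t - s| <= `|t0 - s0|.
  rewrite /t /s; case: (lerP t0 0) => a; case: (lerP s0 0) => b.
  - by rewrite subrr normr0.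
  - rewrite sub0r normrN gtr0_norm// ler0_norm; last by lra.
    by lra.
  - rewrite subr0 gtr0_norm// gtr0_norm; last by lra.
    by lra.
  - by [].
have ts1 : `|t - s| <= d1 ^+ 2.
  apply: le_trans ts0 _; rewrite distrC; near: t0.
  by apply: cvgr_dist_le; [exact: cvg_id|rewrite exprn_gt0].
have ts2 : `|t - s| <= d2.
  apply: le_trans ts0 _; rewrite distrC; near: t0.
  by apply: cvgr_dist_le; [exact: cvg_id|].
have qh : `|q t - q s| <= h.
  apply: quantile_near => //; rewrite -/c.
  apply: (@le_lt_trans _ _ (K * d2)); first by rewrite ler_wpM2l// ltW.
  by apply: le_lt_trans D2 _; rewrite ltr_pdivrMr// ltr_pMr ?ltr1n// mulr_gt0.
have sq : Num.sqrt `|t - s| <= d1.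
  have -> : d1 = Num.sqrt (d1 ^+ 2) by rewrite sqrtr_sqr gtr0_norm.
  by rewrite ler_wsqrtr.
rewrite distrC; apply: le_trans (u_quantile_dist s_ge0 t_ge0) _.
have l1 : K * `|q t - q s| <= e / 4 by apply: le_trans Kh2; rewrite ler_wpM2l// ltW.
have l2 : K * Num.sqrt `|t - s| <= e / 8 by apply: le_trans D1; rewrite ler_wpM2l// ltW.
by rewrite -!mulrA; move: (K * _) (K * _) l1 l2 => x y l1 l2; lra.
Unshelve. all: by end_near. Qed.

Lemma u_quantile_lower T : 0 <= T -> exists2 c, 0 < c & forall s, 0 <= s -> s <= T -> c <= U s.
Proof.
move=> T0; have cU : {within `[0, T], continuous (fun s : R => U (Num.max s 0))}.
  by apply: continuous_subspaceT; exact: u_quantile_continuous.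
have [c _ H] := EVT_min T0 cU.
exists (U (Num.max c 0)); first by apply: u_q_gt0; rewrite le_max lexx orbT.
move=> s s0 sT; have := H s; rewrite in_itv/= s0 sT => /(_ isT).
by rewrite [in leRHS]max_l.
Qed.

(** Once [U] is bounded below by [c] on [[0, T]], [quantile_near] applies with
    [h] proportional to [t - s]; [delta] keeps [h] small enough for it. *)
Lemma quantile_regularity T : 0 <= T -> exists c, exists L, exists delta,
  [/\ 0 < c, 0 <= L, 0 < delta, delta <= 1 &
  (forall s, 0 <= s -> s <= T -> c <= U s) /\
  (forall s t, 0 <= s -> s < t -> t <= T -> t - s <= delta ->
    `|q t - q s| <= L * (t - s) /\ `|U t - U s| <= L * Num.sqrt (t - s))].
Proof.
move=> T0; have [c c0 Hc] := u_quantile_lower T0.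
(* With [h = L1 * (t - s)], [h * (c / 2)] is twice the change [K * (t - s)] in time. *)
have [L1 L1E L10] : exists2 L1, L1 = 4 * K / c & 0 < L1.
  by exists (4 * K / c) => //; rewrite divr_gt0// mulr_gt0.
pose L := L1 + 2 * K * L1 + 4 * K.
have L10' := ltW L10; have K0' := ltW K0.
have L0 : 0 <= L by rewrite !addr_ge0 ?mulr_ge0.
have [d d0 Hd] : exists2 d, 0 < d & K * L1 * d <= c / 2.
  by apply: small_mul; [rewrite mulr_ge0|rewrite divr_gt0].
exists c, L, (Num.min 1 d); split => //; rewrite ?lt_min ?ltr01 ?d0 ?ge_min ?lexx//.
split => // s t s0 st tT; rewrite le_min => /andP[ts1 tsd].
have t0 : 0 <= t by rewrite (le_trans s0)// ltW.
have sT : s <= T by rewrite (le_trans _ tT)// ltW.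
have ts0 : 0 < t - s by rewrite subr_gt0.
have qts : `|q t - q s| <= L1 * (t - s).
  apply: quantile_near => //; first by rewrite mulr_gt0.
    apply: (@le_trans _ _ (c / 2)); last by rewrite ler_pM2r ?invr_gt0// Hc.
    by apply: le_trans Hd; rewrite mulrA ler_wpM2l// mulr_ge0.
  rewrite gtr0_norm//; apply: (@lt_le_trans _ _ (L1 * (t - s) * (c / 2))); last first.
    by rewrite ler_wpM2l ?mulr_ge0 ?(ltW L10) ?(ltW ts0)// ler_pM2r ?invr_gt0// Hc.
  have -> : L1 * (t - s) * (c / 2) = 2 * (K * (t - s)) by rewrite L1E; field; rewrite gt_eqF.
  by rewrite ltr_pMl ?ltr1n// mulr_gt0.
have sq0 : 0 <= Num.sqrt (t - s) by rewrite sqrtr_ge0.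
have tsq : t - s <= Num.sqrt (t - s).
  rewrite -{1}(sqr_sqrtr (ltW ts0)) expr2 ler_piMr//.
  by rewrite -[leRHS]sqrtr1 ler_wsqrtr.
split.
  apply: le_trans qts _; rewrite ler_wpM2r ?(ltW ts0)// /L -addrA lerDl.
  by rewrite addr_ge0 ?mulr_ge0.
apply: le_trans (u_quantile_dist s0 t0) _; rewrite (gtr0_norm ts0).
apply: (@le_trans _ _ (2 * K * L1 * Num.sqrt (t - s) + 4 * K * Num.sqrt (t - s))).
  rewrite lerD2r -!mulrA ler_wpM2l// ler_wpM2l ?(ltW K0)//.
  by apply: le_trans qts _; rewrite ler_wpM2l ?(ltW L10).
by rewrite -mulrDl ler_wpM2r// /L -addrA lerDr ltW.
Qed.

End QuantileRegularity.

(** * The crossing probability *)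

Lemma max0_lip {R : realType} (a b : R) : `|Num.max a 0 - Num.max b 0| <= `|a - b|.
Proof.
case: (lerP a 0) => a0; case: (lerP b 0) => b0.
- by rewrite subrr normr0.
- by rewrite sub0r normrN gtr0_norm// ler0_norm; lra.
- by rewrite subr0 gtr0_norm// gtr0_norm; lra.
- by [].
Qed.

Section CrossingProbability.
Context {d : measure_display} {Omega : measurableType d} {R : realType}.
Variables (P : probability Omega R) (B W : R -> {RV P >-> R}).
Hypothesis W_bm : standard_brownian_motion W.
Hypothesis B0_W_indep : independent_of_process (B 0) W.
Hypothesis B_eq : forall (t : R) (w : Omega), 0 <= t -> B t w = B 0 w + W t w.
Variables (K M : R) (u : R -> R -> R) (q : R -> R).
Hypothesis K0 : 0 < K.
Hypothesis B_taylor : forall s, 0 <= s -> taylor2 K (Phi B s) (fun x => u x s).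
Hypothesis u_q : forall s, 0 <= s -> 0 <= u (q s) s <= M.

(** Both events [B s <= q s] and [B t <= q t] have probability [alpha], so this
    number determines their joint law, hence [rho]. *)
Definition crossing s t : R := pr P [set w | B s w <= q s /\ q t < B t w].

(** Given the increment [D] over [[s, t]], the crossing occurs when [B s] lies in
    [`]q t - D, q s]].  The probability of this interval is the positive part of a
    difference of values of the distribution function, which the expansion at
    [q s] compares with [U s * max D 0]. *)
Lemma crossing_estimate s t : 0 <= s -> s < t ->
  `|crossing s t - u (q s) s * (Num.sqrt (t - s) * Num.sqrt (2 / pi) / 2)| <=
  2 * K * (t - s) + 2 * K * (q t - q s) ^+ 2 + M * `|q t - q s|.
Proof.
move=> s0 st; have ts : 0 < t - s by rewrite subr_gt0.
have mD := increment_measurable W s t; have lD := increment_law W_bm s0 st.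
have [iD2 ED2] := normal_var_sqr ts mD lD.
have [iDp EDp] := normal_var_pos ts mD lD.
have ind := B_indep W_bm B0_W_indep B_eq s0 st.
have /andP[U0 UM] := u_q s0.
pose S : set (R * R) := [set z | z.2 <= q s /\ q t < z.2 + z.1].
have mS : measurable S.
  have mf1 : measurable_fun setT (fun z : R * R => z.2 + z.1) by apply: measurable_funD.
  have mf2 : measurable_fun setT (fun z : R * R => z.2) by exact: measurable_snd.
  have m1 := mf1 measurableT _ (measurable_itv `]q t, +oo[); rewrite setTI in m1.
  have m2 := mf2 measurableT _ (measurable_itv `]-oo, q s]); rewrite setTI in m2.
  have := measurableI _ _ m2 m1.
  congr measurable; apply/seteqP; split => z /=; rewrite !in_itv/= ?andbT.
    by case.
  by case.
have [mg E] := indep_Ex (RV_measurable (B s)) mD ind mS.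
pose G (y : R) := Num.max (Phi B s (q s) - Phi B s (q t - y)) 0.
have gE y : fine (P [set w' | S (y, B s w')]) = G y.
  rewrite /G /Phi -(pos_cdf_between P (RV_measurable (B s))) /pr; congr (fine (P _)).
  apply/seteqP; split => w; rewrite /S /= ltrBlDr.
    by move=> [-> ->].
  by move=> /andP[-> ->].
have mG : measurable_fun setT (fun w => G (W t w - W s w)).
  have mG : measurable_fun setT G.
    by have -> : G = (fun y => fine (P [set w' | S (y, B s w')]))
      by apply/funext => y; rewrite gE.
  exact: measurableT_comp mG mD.
have EG : crossing s t = Ex P (fun w => G (W t w - W s w)).
  have <- : (fun w => fine (P [set w' | S (W t w - W s w, B s w')])) = (fun w => G (W t w - W s w)).
    by apply/funext => w; rewrite gE.
  rewrite -E /crossing /pr; congr (fine (P _)); apply/seteqP.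
  by split => w; rewrite /S /= (B_increment B_eq w s0 st).
have iG : intg P (fun w => G (W t w - W s w)).
  apply: (@intg_bounded _ _ _ _ _ 1) => // w.
  rewrite -gE ger0_norm ?fine_ge0// pr_le1//.
  have := measurable_preimage (RV_measurable (B s)) (measurable_xsection (W t w - W s w) mS).
  by congr measurable; apply/seteqP; split => w' /=; rewrite /xsection /= inE.
pose delta := q t - q s.
have i1 := intgZ (u (q s) s) iDp.
have iDif := intgB iG i1.
have i2 := intgD (intgZ (2 * K) iD2) (intg_cst P (2 * K * delta ^+ 2 + M * `|delta|)).
have -> : crossing s t - u (q s) s * (Num.sqrt (t - s) * Num.sqrt (2 / pi) / 2) =
  Ex P (fun w => G (W t w - W s w) - u (q s) s * Num.max (W t w - W s w) 0).
  by rewrite (ExB iG i1) (ExZ _ iDp) EDp EG.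
apply: (@le_trans _ _ (Ex P (fun w => 2 * K * (W t w - W s w) ^+ 2 + (2 * K * delta ^+ 2 + M * `|delta|)))).
  apply: Ex_norm_le; [exact: intg_meas iDif|exact: i2|] => w.
  set D := W t w - W s w.
  have -> : u (q s) s * Num.max D 0 = Num.max (u (q s) s * D) 0.
    by rewrite maxr_pMr// mulr0.
  apply: le_trans (max0_lip _ _) _.
  have := B_taylor s0 (q s) (q t - D - q s); rewrite subrKC /=.
  move: (Phi B s _) (Phi B s _) => p1 p2.
  have := ler_norm (u (q s) s * delta); rewrite normrM (ger0_norm U0).
  have := ler_norm (- (u (q s) s * delta)); rewrite normrN normrM (ger0_norm U0).
  have : u (q s) s * `|delta| <= M * `|delta| by rewrite ler_wpM2r.
  have -> : q t - D - q s = delta - D by rewrite /delta; ring.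
  move: (u (q s) s) U0 UM `|delta| => U U0 UM dl h1 h2 h3.
  have : K * (delta - D) ^+ 2 <= 2 * K * D ^+ 2 + 2 * K * delta ^+ 2.
    have -> : 2 * K * D ^+ 2 + 2 * K * delta ^+ 2 = K * (2 * D ^+ 2 + 2 * delta ^+ 2) by ring.
    rewrite ler_pM2l//.
    by have := sqr_ge0 (delta + D); move: (delta) => e; lra.
  move=> h4; rewrite !ler_norml => /andP[h5 h6]; apply/andP; split; lra.
rewrite (ExD (intgZ (2 * K) iD2) (intg_cst P _)) (ExZ _ iD2) ED2 Ex_cst.
by rewrite addrA.
Qed.

End CrossingProbability.

(** * Influence of a past event on a later position *)

Lemma indep_sym {d d1 d2} {Omega : measurableType d} {R : realType}
  (P : probability Omega R) {T1 : measurableType d1} {T2 : measurableType d2}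
  (X : Omega -> T1) (Y : Omega -> T2) : indep P X Y -> indep P Y X.
Proof. by move=> XY A B mA mB; rewrite setIC XY// muleC. Qed.

Lemma pr_symdiff_le {d} {Omega : measurableType d} {R : realType}
  (P : probability Omega R) (A B C : set Omega) :
  measurable A -> measurable B -> measurable C -> A `\` B `<=` C -> B `\` A `<=` C ->
  `|pr P A - pr P B| <= pr P C.
Proof.
move=> mA mB mC AB BA; rewrite (pr_split P mA mB) (pr_split P mB mA) (setIC B A).
have h1 := pr_le P (measurableD mA mB) mC AB.
have h2 := pr_le P (measurableD mB mA) mC BA.
have h3 := pr_ge0 P (A `\` B); have h4 := pr_ge0 P (B `\` A).
rewrite opprD addrACA subrr add0r ler_norml; apply/andP.
move: (pr _ _) (pr _ _) (pr _ _) h1 h2 h3 h4 => x y z h1 h2 h3 h4; split; lra.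
Qed.

Section CovarianceDecay.
Context {d : measure_display} {Omega : measurableType d} {R : realType}.
Variables (P : probability Omega R) (B W : R -> {RV P >-> R}).
Hypothesis W_bm : standard_brownian_motion W.
Hypothesis B0_W_indep : independent_of_process (B 0) W.
Hypothesis B_eq : forall (t : R) (w : Omega), 0 <= t -> B t w = B 0 w + W t w.

Lemma measurable_increment_le s t y : measurable [set w | W t w - W s w <= y].
Proof. by apply: measurable_le_event; exact: increment_measurable. Qed.

(** The two events differ only if the increment over [[r, s]] is closer to [z1]
    than the increment over [[s, t]] is to [z2 - z1].  As the former is independent of the
    latter and has variance at least [eta], its density is at most
    [(sqrt eta)^-1], which bounds the probability of this window by its width. *)
Lemma increment_cdf_dist eta r s t z1 z2 : 0 < eta -> 0 <= r -> r + eta <= s -> s < t ->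
  `|pr P [set w | W t w - W r w <= z2] - pr P [set w | W s w - W r w <= z1]| <=
  2 * (Num.sqrt eta)^-1 * (Num.sqrt (t - s) + `|z2 - z1|).
Proof.
move=> eta0 r0 rs st; have rs' : r < s by apply: lt_le_trans rs; rewrite ltrDl.
have s0 : 0 <= s by rewrite (le_trans r0)// ltW.
have srP : 0 < s - r by rewrite subr_gt0.
have tsP : 0 < t - s by rewrite subr_gt0.
have mU := increment_measurable W r s; have lU := increment_law W_bm r0 rs'.
have mV := increment_measurable W s t; have lV := increment_law W_bm s0 st.
have ind := W_increments_indep W_bm r0 rs' st.
pose dl := z2 - z1.
pose S : set (R * R) := [set z | `|z.2 - z1| <= `|z.1 - dl| ].
have mS : measurable S.
  have mf1 : measurable_fun setT (fun z : R * R => `|z.1 - dl| - `|z.2 - z1|).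
    apply: measurable_funB; apply: measurableT_comp => //; apply: measurable_funB => //.
  have := mf1 measurableT _ (measurable_itv `[0, +oo[); rewrite setTI.
  by congr measurable; apply/seteqP; split => z /=; rewrite !in_itv/= ?andbT subr_ge0.
have [mg E] := indep_Ex mU mV ind mS.
have mSw : measurable [set w | S (W t w - W s w, W s w - W r w)].
  by have := measurable_preimage (measurable_fun_pair mV mU) mS.
have [iV _] := normal_var_abs tsP mV lV.
have i1 := intgD iV (intg_cst P `|dl|).
have k0 : 0 < 2 * (Num.sqrt eta)^-1 by rewrite mulr_gt0// invr_gt0 sqrtr_gt0.
apply: (@le_trans _ _ (pr P [set w | S (W t w - W s w, W s w - W r w)])).
  apply: pr_symdiff_le => //; try exact: measurable_increment_le.
    move=> w [/= h1 /negP]; rewrite -ltNge => h2; rewrite /S /=.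
    rewrite (gtr0_norm (_ : 0 < W s w - W r w - z1)) ?subr_gt0//.
    rewrite distrC; apply: le_trans (ler_norm _); rewrite /dl.
    by move: (W t w) (W s w) (W r w) h1 h2 => a b c h1 h2; lra.
  move=> w [/= h1 /negP]; rewrite -ltNge => h2; rewrite /S /=.
  rewrite (ler0_norm (_ : W s w - W r w - z1 <= 0)) ?subr_le0//.
  apply: le_trans (ler_norm _); rewrite /dl.
  by move: (W t w) (W s w) (W r w) h1 h2 => a b c h1 h2; lra.
rewrite {1}/pr E.
apply: (@le_trans _ _ (Ex P (fun w => 2 * (Num.sqrt eta)^-1 * (`|W t w - W s w| + `|dl|)))).
  apply: Ex_le.
  - apply: (@intg_bounded _ _ _ _ _ 1); first exact: measurableT_comp mg mV.
    move=> w; rewrite ger0_norm ?fine_ge0// pr_le1//.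
    have := measurable_preimage mU (measurable_xsection (W t w - W s w) mS).
    by congr measurable; apply/seteqP; split => w' /=; rewrite /xsection /= inE.
  - exact: intgZ.
  - move=> w; rewrite /S /=.
    have H := normal_var_ball_le srP lU z1 (normr_ge0 (W t w - W s w - dl)).
    rewrite /pr /= in H; apply: le_trans H _.
    rewrite mulrCA mulrA; apply: ler_pM; rewrite ?normr_ge0//.
    - apply: ler_wpM2l => //; rewrite lef_pV2 ?posrE ?sqrtr_gt0//.
      by apply: ler_wsqrtr; rewrite lerBrDr addrC.
    - exact: ler_normB.
rewrite (ExZ _ i1) (ExD iV (intg_cst P _)) Ex_cst ler_pM2l// lerD2r.
exact: normal_var_abs_le.
Qed.

(** Conditionally on the positions at [s1] and [t1], an event about a later
    position is an event about the increment since [t1], and [increment_cdf_dist]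
    applies uniformly.  The factor [pr P E] is what makes the bound useful for rare
    events [E]. *)
Lemma past_event_dist eta s1 t1 s2 t2 y1 y2 (E : set (R * R)) :
  0 < eta -> 0 <= s1 -> s1 < t1 -> t1 + eta <= s2 -> s2 < t2 -> measurable E ->
  `|pr P [set w | E (B s1 w, B t1 w) /\ B t2 w <= y2] -
    pr P [set w | E (B s1 w, B t1 w) /\ B s2 w <= y1]| <=
  2 * (Num.sqrt eta)^-1 * (Num.sqrt (t2 - s2) + `|y2 - y1|) *
  pr P [set w | E (B s1 w, B t1 w)].
Proof.
move=> eta0 s10 st1 ts st2 mE.
have t10 : 0 <= t1 by rewrite (le_trans s10)// ltW.
have ts1 : t1 < s2 by apply: lt_le_trans ts; rewrite ltrDl.
have tt2 : t1 < t2 by exact: lt_trans st2.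
have mX : measurable_fun setT (fun w => (B s1 w, B t1 w)).
  by apply: measurable_fun_pair; exact: RV_measurable.
have mEw : measurable [set w | E (B s1 w, B t1 w)].
  by have := measurable_preimage mX mE.
(* [g] is the conditional probability given the pair. *)
have key t y : t1 < t -> exists g : R * R -> R,
    [/\ intg P (fun w => g (B s1 w, B t1 w)),
       pr P [set w | E (B s1 w, B t1 w) /\ B t w <= y] = Ex P (fun w => g (B s1 w, B t1 w)) &
       forall x, g x = if x \in E then pr P [set w | W t w - W t1 w <= y - x.2] else 0].
  move=> t1t.
  have ind := indep_sym (B_pair_indep W_bm B0_W_indep B_eq s10 st1 t1t).
  have mY := increment_measurable W t1 t.
  pose S : set ((R * R) * R) := [set z | E z.1 /\ z.1.2 + z.2 <= y].
  have mS : measurable S.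
    have mf1 : measurable_fun setT (fun z : (R * R) * R => z.1.2 + z.2).
      apply: measurable_funD => //.
      exact: (measurableT_comp measurable_snd measurable_fst).
    have m1 := mf1 measurableT _ (measurable_itv `]-oo, y]); rewrite setTI in m1.
    have m2 := (@measurable_fst _ _ (R * R)%type R) measurableT _ mE; rewrite setTI in m2.
    have := measurableI _ _ m2 m1.
    by congr measurable; apply/seteqP; split => z /=; rewrite in_itv/=.
  have [mg Eg] := indep_Ex mY mX ind mS.
  pose g x := fine (P [set w' | S (x, W t w' - W t1 w')]).
  exists g; split.
  - apply: (@intg_bounded _ _ _ _ _ 1); first exact: measurableT_comp mg mX.
    move=> w; rewrite ger0_norm ?fine_ge0// pr_le1//.
    have := measurable_preimage mY (measurable_xsection (B s1 w, B t1 w) mS).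
    by congr measurable; apply/seteqP; split => w' /=; rewrite /xsection /= inE.
  - rewrite -[RHS]Eg /pr; congr (fine (P _)); apply/seteqP.
    by split => w; rewrite /S /= (B_increment B_eq w t10 t1t).
  - move=> x; rewrite /g /S /=; case: ifPn => xE.
      rewrite /pr; congr (fine (P _)); apply/seteqP; move: xE; rewrite inE => xE.
      by split => w /=; rewrite lerBrDl; [case|split].
    have -> : [set w' | E x /\ x.2 + (W t w' - W t1 w') <= y] = set0.
      by apply/seteqP; split => w //= -[h _]; move: xE; rewrite notin_setE.
    by rewrite measure0.
have [g2 [i2 E2 G2]] := key t2 y2 tt2.
have [g1 [i1 E1 G1]] := key s2 y1 ts1.
rewrite E2 E1 -(ExB i2 i1); set k := 2 * _ * _.
rewrite {1}/pr -(Ex_indic P mEw) -(ExZ k (intg_indic P mEw)).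
apply: Ex_norm_le; [exact: intg_meas (intgB i2 i1)|exact: intgZ (intg_indic P mEw)|].
move=> w; rewrite G2 G1 indicE.
have -> : (w \in [set w | E (B s1 w, B t1 w)]) = ((B s1 w, B t1 w) \in E).
  by apply/idP/idP; rewrite !inE.
case: ifPn => _; last by rewrite subrr normr0 mulr0.
rewrite mulr1 /=; apply: le_trans (increment_cdf_dist _ _ eta0 t10 ts st2) _.
by rewrite /k; have -> : y2 - B t1 w - (y1 - B t1 w) = y2 - y1 by ring.
Qed.

End CovarianceDecay.

(** * Asymptotics and decay of the covariance function *)

Lemma inv_dist {R : realType} (c x y : R) : 0 < c -> c <= x -> c <= y ->
  `|x^-1 - y^-1| <= c ^- 2 * `|x - y|.
Proof.
move=> c0 cx cy; have x0 : 0 < x by exact: lt_le_trans cx.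
have y0 : 0 < y by exact: lt_le_trans cy.
have -> : x^-1 - y^-1 = (x * y)^-1 * (y - x) by field; rewrite !gt_eqF.
rewrite normrM distrC ler_wpM2r// gtr0_norm ?invr_gt0 ?mulr_gt0//.
rewrite lef_pV2 ?posrE ?exprn_gt0 ?mulr_gt0// expr2.
by apply: ler_pM; rewrite ?(ltW c0).
Qed.

Lemma inv_bound {R : realType} (c x : R) : 0 < c -> c <= x -> 0 <= x^-1 <= c^-1.
Proof.
move=> c0 cx; have x0 : 0 < x by exact: lt_le_trans cx.
by rewrite invr_ge0 (ltW x0) lef_pV2 ?posrE.
Qed.

(** Here [x] and [y] stand for [U s] and [U t], [p] for the crossing probability,
    [v0] for [alpha - alpha ^+ 2] and [r] for [sqrt (t - s)].  Only the crossing
    term is of order [r], and replacing [y] by [x] in it costs [r ^+ 2]. *)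
Lemma variance_expansion {R : realType} (v0 p x y c L Cp k r : R) :
  0 <= v0 -> v0 <= 1 -> 0 < c -> c <= x -> c <= y -> 0 <= L -> 0 <= k -> 0 <= r ->
  `|y - x| <= L * r -> `|p - x * (r * k / 2)| <= Cp * r ^+ 2 ->
  `|v0 * (y^-1 - x^-1) ^+ 2 + 2 * x^-1 * y^-1 * p - x^-1 * (k * r)| <=
  ((c ^- 2 * L) ^+ 2 + 2 * c ^- 2 * Cp + k * (c ^- 2 * L)) * r ^+ 2.
Proof.
move=> v00 v01 c0 cx cy L0 k0 r0 xy pE.
have x0 : 0 < x by exact: lt_le_trans cx.
have y0 : 0 < y by exact: lt_le_trans cy.
have c20 : 0 < c ^- 2 by rewrite invr_gt0 exprn_gt0.
have ab : `|y^-1 - x^-1| <= c ^- 2 * L * r.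
  by apply: le_trans (inv_dist c0 cy cx) _; rewrite -mulrA ler_pM2l.
have -> : v0 * (y^-1 - x^-1) ^+ 2 + 2 * x^-1 * y^-1 * p - x^-1 * (k * r) =
  v0 * (y^-1 - x^-1) ^+ 2 + (2 * (x^-1 * y^-1)) * (p - x * (r * k / 2)) + (k * r) * (y^-1 - x^-1).
  by field; rewrite !gt_eqF.
have xy1 : x^-1 * y^-1 <= c ^- 2.
  rewrite -invfM lef_pV2 ?posrE ?exprn_gt0 ?mulr_gt0// expr2.
  by apply: ler_pM; rewrite ?(ltW c0).
have xy0 : 0 <= x^-1 * y^-1 by rewrite mulr_ge0 ?invr_ge0 ?ltW.
have -> : ((c ^- 2 * L) ^+ 2 + 2 * c ^- 2 * Cp + k * (c ^- 2 * L)) * r ^+ 2 =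
  (c ^- 2 * L * r) ^+ 2 + 2 * c ^- 2 * Cp * r ^+ 2 + k * (c ^- 2 * L) * r ^+ 2 by ring.
apply: le_trans (ler_normD _ _) _; apply: lerD.
  apply: le_trans (ler_normD _ _) _; apply: lerD.
    rewrite normrM (ger0_norm v00) normrX.
    apply: (@le_trans _ _ (1 * `|y^-1 - x^-1| ^+ 2)); first by rewrite ler_wpM2r.
    by rewrite mul1r ler_pXn2r ?nnegrE// !mulr_ge0// ltW.
  have xy20 : 0 <= 2 * (x^-1 * y^-1) by rewrite mulr_ge0.
  rewrite normrM (ger0_norm xy20).
  have -> : 2 * c ^- 2 * Cp * r ^+ 2 = (2 * c ^- 2) * (Cp * r ^+ 2) by ring.
  by apply: ler_pM => //; rewrite ler_pM2l.
rewrite normrM ger0_norm ?mulr_ge0//.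
have -> : k * (c ^- 2 * L) * r ^+ 2 = k * r * (c ^- 2 * L * r) by ring.
by apply: ler_wpM2l => //; rewrite mulr_ge0.
Qed.

(** Factor the difference of squares; [a] stands for [(U s)^-1]. *)
Lemma sqr_expansion {R : realType} (v a k r C c : R) : 0 <= C -> 0 < c -> 0 <= a -> a <= c^-1 ->
  0 <= k -> 0 <= r -> r <= 1 -> `|v - a * (k * r)| <= C * r ^+ 2 ->
  `|3 * v ^+ 2 - 3 * k ^+ 2 * a ^+ 2 * r ^+ 2| <= 3 * C * (C + 2 * c^-1 * k) * r ^+ 3.
Proof.
move=> C0 c0 a0 ac k0 r0 r1 H.
have -> : 3 * v ^+ 2 - 3 * k ^+ 2 * a ^+ 2 * r ^+ 2 =
  3 * (v - a * (k * r)) * ((v - a * (k * r)) + 2 * (a * (k * r))) by ring.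
rewrite !normrM (ger0_norm (ler0n _ 3)).
have -> : 3 * C * (C + 2 * c^-1 * k) * r ^+ 3 =
  3 * (C * r ^+ 2) * (C * r + 2 * (c^-1 * (k * r))) by ring.
have kr : 0 <= k * r by rewrite mulr_ge0.
apply: ler_pM => //; rewrite ?mulr_ge0// ?ler0n//.
  by rewrite ler_pM2l.
apply: le_trans (ler_normD _ _) _; apply: lerD.
  apply: le_trans H _; rewrite expr2 mulrA ler_piMr// mulr_ge0//.
rewrite ger0_norm ?mulr_ge0// ler_pM2l//.
by rewrite ler_wpM2r.
Qed.

(** Here [a0], [a1], [b0], [b1] are the values of [U^-1] at the times [s1], [t1],
    [s2], [t2].  The numbers [g1], [g2], [g3] are the probabilities of being below
    the quantile at [t2] (suffix [t]) or [s2] (suffix [s]) jointly with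
    [B s1 <= q s1] and with the two events by which [B t1 <= q t1] differs from it,
    which have probability [p].  The double difference is rearranged into products
    of a difference between [s1] and [t1], of order [r1], and one between [s2] and
    [t2], of order [r2]. *)
Lemma covariance_combination {R : realType} (a0 a1 b0 b1 al p c l m kk r1 r2 : R)
  (g1t g1s g2t g2s g3t g3s : R) :
  0 <= c -> 0 <= l -> 0 <= m -> 0 <= kk -> 0 <= r1 -> 0 <= r2 -> 0 < al -> al < 1 ->
  0 <= a1 -> a1 <= c -> 0 <= b1 -> b1 <= c ->
  `|a1 - a0| <= l * r1 -> `|b1 - b0| <= l * r2 -> 0 <= p -> p <= m * r1 ->
  0 <= g2s -> g2s <= p -> 0 <= g3s -> g3s <= p -> 0 <= g1s -> g1s <= al ->
  `|g2t - g2s| <= kk * r2 * p -> `|g3t - g3s| <= kk * r2 * p ->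
  `|g1t - g1s| <= kk * r2 * al ->
  `|a1 * b1 * (g1t + g2t - g3t - al ^+ 2) - a1 * b0 * (g1s + g2s - g3s - al ^+ 2) -
    (a0 * b1 * (g1t - al ^+ 2) - a0 * b0 * (g1s - al ^+ 2))| <=
  (2 * c * m + l) * (c * kk + l) * (r1 * r2).
Proof.
move=> c0 l0 m0 kk0 r10 r20 al0 al1 a10 a1c b10 b1c da db p0 pm.
move=> x1 x2 x3 x4 x5 x6 y1 y2 y3.
pose Js := a1 * (g2s - g3s) + (a1 - a0) * (g1s - al ^+ 2).
pose dJ := a1 * ((g2t - g2s) - (g3t - g3s)) + (a1 - a0) * (g1t - g1s).
have -> : a1 * b1 * (g1t + g2t - g3t - al ^+ 2) - a1 * b0 * (g1s + g2s - g3s - al ^+ 2) -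
    (a0 * b1 * (g1t - al ^+ 2) - a0 * b0 * (g1s - al ^+ 2)) = b1 * dJ + (b1 - b0) * Js.
  by rewrite /dJ /Js; ring.
pose Gam := 2 * c * p + l * r1.
have lr0 : 0 <= l * r1 by rewrite mulr_ge0.
have cp0 : 0 <= c * p by rewrite mulr_ge0.
have k0 : 0 <= kk * r2 by rewrite mulr_ge0.
have Gam0 : 0 <= Gam by rewrite /Gam addr_ge0// -mulrA mulr_ge0.
have sq : 0 <= al ^+ 2 <= 1.
  by rewrite sqr_ge0/= expr2 mulr_ile1// ltW.
case/andP: sq => sq0 sq1.
have JsG : `|Js| <= Gam.
  apply: le_trans (ler_normD _ _) _; apply: lerD; rewrite normrM.
    rewrite (ger0_norm a10); apply: (@le_trans _ _ (c * p)).
      by apply: ler_pM => //; rewrite ler_norml; apply/andP; split; lra.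
    by rewrite -mulrA ler_peMl// ler1n.
  apply: (@le_trans _ _ (l * r1 * 1)); last by rewrite mulr1.
  by apply: ler_pM => //; rewrite ler_norml; apply/andP; split; lra.
have dJG : `|dJ| <= kk * r2 * Gam.
  have -> : kk * r2 * Gam = c * (kk * r2 * p + kk * r2 * p) + l * r1 * (kk * r2).
    by rewrite /Gam; ring.
  apply: le_trans (ler_normD _ _) _; apply: lerD; rewrite normrM.
    rewrite (ger0_norm a10); apply: ler_pM => //.
    by apply: le_trans (ler_normB _ _) _; apply: lerD.
  apply: ler_pM => //; apply: le_trans y3 _.
  by rewrite ler_piMr// ltW.
have GamC : Gam <= (2 * c * m + l) * r1.
  have -> : (2 * c * m + l) * r1 = 2 * c * (m * r1) + l * r1 by ring.
  by rewrite /Gam lerD2r ler_wpM2l// mulr_ge0.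
apply: (@le_trans _ _ (c * (kk * r2 * Gam) + l * r2 * Gam)).
  apply: le_trans (ler_normD _ _) _; apply: lerD; rewrite normrM.
    by rewrite (ger0_norm b10); apply: ler_pM.
  exact: ler_pM.
have -> : c * (kk * r2 * Gam) + l * r2 * Gam = Gam * ((c * kk + l) * r2) by ring.
have -> : (2 * c * m + l) * (c * kk + l) * (r1 * r2) =
  (2 * c * m + l) * r1 * ((c * kk + l) * r2) by ring.
by apply: ler_wpM2r => //; rewrite mulr_ge0// addr_ge0// mulr_ge0.
Qed.

Section RhoEstimates.
Context {d : measure_display} {Omega : measurableType d} {R : realType}.
Variables (P : probability Omega R) (B W : R -> {RV P >-> R}).
Hypothesis W_bm : standard_brownian_motion W.
Hypothesis B0_W_indep : independent_of_process (B 0) W.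
Hypothesis B_eq : forall (t : R) (w : Omega), 0 <= t -> B t w = B 0 w + W t w.
Variables (alpha K M : R) (u : R -> R -> R) (q : R -> R).
Hypotheses (alpha0 : 0 < alpha) (alpha1 : alpha < 1).
Hypothesis K0 : 0 < K.
Hypothesis B_taylor : forall s, 0 <= s -> taylor2 K (Phi B s) (fun x => u x s).
Hypothesis B_quantile : forall s, 0 <= s -> Phi B s (q s) = alpha.
Local Notation U s := (u (q s) s).
Local Notation rho := (rho alpha B u q).
Hypothesis u_q : forall s, 0 <= s -> 0 <= U s <= M.
Variables (T c L delta : R).
Hypotheses (c0 : 0 < c) (L0 : 0 <= L) (delta1 : delta <= 1).
Hypothesis U_lower : forall s, 0 <= s -> s <= T -> c <= U s.
Hypothesis q_U_reg : forall s t, 0 <= s -> s < t -> t <= T -> t - s <= delta ->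
    `|q t - q s| <= L * (t - s) /\ `|U t - U s| <= L * Num.sqrt (t - s).
Local Notation k := (Num.sqrt (2 / pi) : R).
Let Cp := 2 * K + 2 * K * L ^+ 2 + M * L.

Let M0 : 0 <= M.
Proof. by have /andP[a b] := u_q (lexx 0); exact: le_trans b. Qed.

Let Cp0 : 0 <= Cp.
Proof. by rewrite /Cp !addr_ge0 ?mulr_ge0 ?sqr_ge0 ?(ltW K0). Qed.

Let mE t x : measurable [set w | B t w <= x].
Proof. by apply: measurable_le_event; exact: RV_measurable. Qed.

Lemma crossing_le_alpha s t : 0 <= s ->
  pr P [set w | B s w <= q s /\ B t w <= q t] = alpha - crossing B q s t.
Proof.
move=> s0; rewrite -(B_quantile s0) /Phi (pr_split P (mE s (q s)) (mE t (q t))).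
have -> : [set w | B s w <= q s] `\` [set w | B t w <= q t] = [set w | B s w <= q s /\ q t < B t w].
  apply/seteqP; split => w /=; first by case=> h1 /negP; rewrite -ltNge.
  by case=> h1 h2; split => //; apply/negP; rewrite -ltNge.
by rewrite /crossing addrK.
Qed.

Lemma rho_diag s : 0 <= s -> rho s s = (U s)^-1 * (U s)^-1 * (alpha - alpha ^+ 2).
Proof.
move=> s0; rewrite /Defs.rho -[fine _]/(pr P _) (crossing_le_alpha s s0) invfM mulrC.
have -> : crossing B q s s = 0; last by rewrite subr0.
rewrite /crossing; have -> : [set w | B s w <= q s /\ q s < B s w] = set0.
  by apply/seteqP; split => w //= -[h1 h2]; have := le_lt_trans h1 h2; rewrite ltxx.
by rewrite /pr measure0.
Qed.

Lemma rho_offdiag s t : 0 <= s ->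
  rho s t = (U s)^-1 * (U t)^-1 * (alpha - crossing B q s t - alpha ^+ 2).
Proof. by move=> s0; rewrite /Defs.rho -[fine _]/(pr P _) (crossing_le_alpha t s0) invfM mulrC. Qed.

Lemma rho_sym s t : rho s t = rho t s.
Proof.
rewrite /Defs.rho (mulrC (U s)); congr ((fine (P _) - _) / _).
by apply/seteqP; split => w /= [].
Qed.

Lemma rho_variance s t : 0 <= s -> 0 <= t ->
  rho t t - rho t s - (rho s t - rho s s) =
  (alpha - alpha ^+ 2) * ((U t)^-1 - (U s)^-1) ^+ 2 + 2 * (U s)^-1 * (U t)^-1 * crossing B q s t.
Proof.
by move=> s0 t0; rewrite (rho_sym t s) !rho_diag// rho_offdiag//; ring.
Qed.

Lemma crossing_bound s t : 0 <= s -> s < t -> t <= T -> t - s <= delta ->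
  `|crossing B q s t - U s * (Num.sqrt (t - s) * k / 2)| <= Cp * Num.sqrt (t - s) ^+ 2.
Proof.
move=> s0 st tT ts; have ts0 : 0 < t - s by rewrite subr_gt0.
have [qL _] := q_U_reg s0 st tT ts.
apply: le_trans (crossing_estimate W_bm B0_W_indep B_eq K0 B_taylor u_q s0 st) _.
rewrite sqr_sqrtr ?(ltW ts0)//.
have -> : Cp * (t - s) = 2 * K * (t - s) + 2 * K * L ^+ 2 * (t - s) + M * L * (t - s).
  by rewrite /Cp; ring.
have ts1 : t - s <= 1 by exact: le_trans delta1.
apply: lerD; first apply: lerD => //.
  have -> : 2 * K * L ^+ 2 * (t - s) = 2 * K * (L ^+ 2 * (t - s)) by ring.
  rewrite ler_pM2l ?mulr_gt0// -(real_normK (num_real (q t - q s))).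
  apply: (@le_trans _ _ ((L * (t - s)) ^+ 2)).
    by rewrite ler_pXn2r ?nnegrE// mulr_ge0// ltW.
  by rewrite exprMn ler_wpM2l ?sqr_ge0// expr2 ler_piMr// ltW.
by rewrite -mulrA ler_wpM2l.
Qed.

(** By [rho_variance] the variance of the increment is
    [k * sqrt (t - s) / U s] up to a multiple of [t - s], as [q] is Lipschitz and
    [U] is 1/2-Hoelder; it remains to square. *)
Lemma variance_asymptotics : exists2 C, 0 <= C & forall s t, 0 <= s -> s < t -> t <= T ->
  t - s <= delta -> `|3 * (rho t t - rho t s - (rho s t - rho s s)) ^+ 2
   - 3 * k ^+ 2 * (U s)^-1 ^+ 2 * (t - s)| <= C * (Num.sqrt (t - s) * (t - s)).
Proof.
have k0 : 0 <= k by rewrite sqrtr_ge0.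
have c20 : 0 <= c ^- 2 by rewrite invr_ge0 exprn_ge0// ltW.
pose C1 := (c ^- 2 * L) ^+ 2 + 2 * c ^- 2 * Cp + k * (c ^- 2 * L).
have C10 : 0 <= C1.
  apply: addr_ge0; last by rewrite mulr_ge0// mulr_ge0.
  by apply: addr_ge0; [exact: sqr_ge0|rewrite mulr_ge0// mulr_ge0].
exists (3 * C1 * (C1 + 2 * c^-1 * k)).
  apply: mulr_ge0; first by rewrite mulr_ge0.
  by rewrite addr_ge0// mulr_ge0// mulr_ge0// invr_ge0 ltW.
move=> s t s0 st tT ts; have ts0 : 0 < t - s by rewrite subr_gt0.
have t0 : 0 <= t by rewrite (le_trans s0)// ltW.
have sT : s <= T by rewrite (le_trans _ tT)// ltW.
have [_ UL] := q_U_reg s0 st tT ts.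
have cs := U_lower s0 sT; have ct := U_lower t0 tT.
have /andP[a0 ac] := inv_bound c0 cs.
have al0 : 0 <= alpha - alpha ^+ 2 by rewrite subr_ge0 expr2 ler_piMl// ltW.
have al1 : alpha - alpha ^+ 2 <= 1.
  by rewrite lerBlDr (le_trans (ltW alpha1))// lerDl sqr_ge0.
have r0 : 0 <= Num.sqrt (t - s) by rewrite sqrtr_ge0.
have r1 : Num.sqrt (t - s) <= 1.
  by rewrite -[leRHS]sqrtr1 ler_wsqrtr//; exact: le_trans delta1.
have := variance_expansion al0 al1 c0 cs ct L0 k0 r0 UL (crossing_bound s0 st tT ts).
rewrite -rho_variance// -/C1 => H.
have := sqr_expansion C10 c0 a0 ac k0 r0 r1 H.
by rewrite (exprS _ 2) (sqr_sqrtr (ltW ts0)).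
Qed.

Let joint (E : set (R * R)) s1 t1 t := pr P [set w | E (B s1 w, B t1 w) /\ B t w <= q t].

(** The event [B t1 <= q t1] is obtained from [B s1 <= q s1] by adding and removing
    an event of probability [crossing s1 t1], of order [sqrt (t1 - s1)].
    [past_event_dist] applied to these events gives the second factor
    [sqrt (t2 - s2)]. *)
Lemma covariance_decay_rho eta : 0 < eta -> exists2 C, 0 <= C & forall s1 t1 s2 t2,
  0 <= s1 -> s1 < t1 -> t1 + eta <= s2 -> s2 < t2 -> t2 <= T ->
  t1 - s1 <= delta -> t2 - s2 <= delta ->
  `|rho t1 t2 - rho t1 s2 - (rho s1 t2 - rho s1 s2)| <=
    C * (Num.sqrt (t1 - s1) * Num.sqrt (t2 - s2)).
Proof.
move=> eta0.
have k0 : 0 <= k by rewrite sqrtr_ge0.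
have c20 : 0 <= c ^- 2 by rewrite invr_ge0 exprn_ge0// ltW.
have cV0 : 0 <= c^-1 by rewrite invr_ge0 ltW.
have e0 : 0 <= 2 * (Num.sqrt eta)^-1 by rewrite mulr_ge0// invr_ge0 sqrtr_ge0.
pose C1 := 2 * c^-1 * (M * (k / 2) + Cp) + c ^- 2 * L.
pose C2 := c^-1 * (2 * (Num.sqrt eta)^-1 * (1 + L)) + c ^- 2 * L.
have C10 : 0 <= C1.
  apply: addr_ge0; last exact: mulr_ge0.
  apply: mulr_ge0; first exact: mulr_ge0.
  by apply: addr_ge0 => //; rewrite mulr_ge0// divr_ge0.
have C20 : 0 <= C2.
  apply: addr_ge0; last exact: mulr_ge0.
  by rewrite mulr_ge0// mulr_ge0// addr_ge0.
exists (C1 * C2); first exact: mulr_ge0.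
move=> s1 t1 s2 t2 s10 st1 t1s2 st2 t2T ts1 ts2.
have t1s2' : t1 < s2 by apply: lt_le_trans t1s2; rewrite ltrDl.
have t10 : 0 <= t1 by rewrite (le_trans s10)// ltW.
have s20 : 0 <= s2 by rewrite (le_trans t10)// ltW.
have t20 : 0 <= t2 by rewrite (le_trans s20)// ltW.
have s2T : s2 <= T by rewrite (le_trans _ t2T)// ltW.
have t1T : t1 <= T by rewrite (le_trans _ s2T)// ltW.
have s1T : s1 <= T by rewrite (le_trans _ t1T)// ltW.
have tsp1 : 0 < t1 - s1 by rewrite subr_gt0.
have tsp2 : 0 < t2 - s2 by rewrite subr_gt0.
set r1 := Num.sqrt (t1 - s1); set r2 := Num.sqrt (t2 - s2).
have r10 : 0 <= r1 by rewrite sqrtr_ge0.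
have r20 : 0 <= r2 by rewrite sqrtr_ge0.
have le1 x : 0 < x -> x <= delta -> Num.sqrt x <= 1 /\ x <= Num.sqrt x.
  move=> x0 xd; have x1 : Num.sqrt x <= 1.
    by rewrite -[leRHS]sqrtr1 ler_wsqrtr//; exact: le_trans delta1.
  by split => //; rewrite -{1}(sqr_sqrtr (ltW x0)) expr2 ler_piMr// sqrtr_ge0.
have [r11 tr1] := le1 _ tsp1 ts1; have [r21 tr2] := le1 _ tsp2 ts2.
have [qL1 UL1] := q_U_reg s10 st1 t1T ts1.
have [qL2 UL2] := q_U_reg s20 st2 t2T ts2.
have cs1 := U_lower s10 s1T; have ct1 := U_lower t10 t1T.
have cs2 := U_lower s20 s2T; have ct2 := U_lower t20 t2T.
pose E1 : set (R * R) := [set x | x.1 <= q s1].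
pose E2 : set (R * R) := [set x | x.2 <= q t1].
have mE1 : measurable E1.
  have := (@measurable_fst _ _ R R) measurableT _ (measurable_itv `]-oo, q s1]); rewrite setTI.
  by congr measurable; apply/seteqP; split => z /=; rewrite in_itv/=.
have mE2 : measurable E2.
  have := (@measurable_snd _ _ R R) measurableT _ (measurable_itv `]-oo, q t1]); rewrite setTI.
  by congr measurable; apply/seteqP; split => z /=; rewrite in_itv/=.
have mX : measurable_fun setT (fun w => (B s1 w, B t1 w)).
  by apply: measurable_fun_pair; exact: RV_measurable.
pose m (E : set (R * R)) := pr P [set w | E (B s1 w, B t1 w)].
pose G E t := joint E s1 t1 t.
have mEw E : measurable E -> measurable [set w | E (B s1 w, B t1 w)].
  by move=> mE'; have := measurable_preimage mX mE'.
have mGw E t : measurable E -> measurable [set w | E (B s1 w, B t1 w) /\ B t w <= q t].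
  by move=> mE'; have := measurableI _ _ (mEw _ mE') (mE t (q t)).
have mD12 := measurableD mE1 mE2; have mD21 := measurableD mE2 mE1.
have mI12 := measurableI _ _ mE1 mE2.
have m12 : m (E1 `\` E2) = crossing B q s1 t1.
  rewrite /m /crossing; congr (pr P _); apply/seteqP; split => w /=.
    by move=> [h1 /negP]; rewrite -ltNge.
  by move=> [h1 h2]; split => //; apply/negP; rewrite -ltNge.
have msplit E E' : measurable E -> measurable E' -> m E = m (E `&` E') + m (E `\` E').
  by move=> a b; rewrite /m (pr_split P (mEw _ a) (mEw _ b)).
have Gsplit E E' t : measurable E -> measurable E' -> G E t = G (E `&` E') t + G (E `\` E') t.
  move=> a b; rewrite /G /joint (pr_split P (mGw _ t a) (mEw _ b)); congr (pr P _ + pr P _).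
    by apply/seteqP; split => w /=; [case=> [[]]|case=> [[]]].
  by apply/seteqP; split => w /=; [case=> [[]]|case=> [[]]].
have m1 : m E1 = alpha by exact: B_quantile.
have m2 : m E2 = alpha by exact: B_quantile.
have m21 : m (E2 `\` E1) = crossing B q s1 t1.
  have := msplit _ _ mE1 mE2; have := msplit _ _ mE2 mE1.
  by rewrite m1 m2 m12 (setIC E2) => a b; apply: (@addrI _ (m (E1 `&` E2))); rewrite -a.
have Gm E t : measurable E -> 0 <= G E t <= m E.
  move=> a; rewrite pr_ge0/=; apply: pr_le; [exact: mGw|exact: mEw|].
  by move=> w /= [].
have Gdist E : measurable E -> `|G E t2 - G E s2| <= 2 * (Num.sqrt eta)^-1 * (1 + L) * r2 * m E.
  move=> mE'; have := past_event_dist W_bm B0_W_indep B_eq (q s2) (q t2) eta0 s10 st1 t1s2 st2 mE'.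
  move=> /le_trans; apply; rewrite ler_wpM2r ?pr_ge0// -[leRHS]mulrA ler_wpM2l//.
  rewrite mulrDl mul1r lerD2l; apply: le_trans qL2 _.
  by rewrite ler_wpM2l.
set p := crossing B q s1 t1 in m12 m21.
have p0 : 0 <= p by rewrite pr_ge0.
have rhoE s t (E : set (R * R)) : (forall w, E (B s1 w, B t1 w) <-> B s w <= q s) ->
    rho s t = (U s)^-1 * (U t)^-1 * (G E t - alpha ^+ 2).
  move=> HE; rewrite /Defs.rho -[fine _]/(pr P _) invfM mulrC; congr (_ * (pr P _ - _)).
  by apply/seteqP; split => w /= [h1 h2]; split => //; apply/HE.
have rE1 t : rho s1 t = (U s1)^-1 * (U t)^-1 * (G E1 t - alpha ^+ 2) by apply: rhoE.
have rE2 t : rho t1 t = (U t1)^-1 * (U t)^-1 * (G E2 t - alpha ^+ 2) by apply: rhoE.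
have GE2 t : G E2 t = G E1 t + G (E2 `\` E1) t - G (E1 `\` E2) t.
  by rewrite (Gsplit E2 E1 t mE2 mE1) (Gsplit E1 E2 t mE1 mE2) (setIC E2); ring.
have /andP[a10 a1c] := inv_bound c0 ct1.
have /andP[b10 b1c] := inv_bound c0 ct2.
have da : `|(U t1)^-1 - (U s1)^-1| <= c ^- 2 * L * r1.
  by apply: le_trans (inv_dist c0 ct1 cs1) _; rewrite -mulrA ler_wpM2l.
have db : `|(U t2)^-1 - (U s2)^-1| <= c ^- 2 * L * r2.
  by apply: le_trans (inv_dist c0 ct2 cs2) _; rewrite -mulrA ler_wpM2l.
have pb : p <= (M * (k / 2) + Cp) * r1.
  have := crossing_bound s10 st1 t1T ts1; rewrite -/p -/r1 ler_norml => /andP[_ h].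
  have /andP[U0 UM] := u_q s10.
  rewrite lerBlDr in h; apply: le_trans h _; rewrite addrC (mulrDl _ Cp); apply: lerD.
    rewrite -[leRHS]mulrA; apply: ler_pM => //.
      by rewrite divr_ge0// mulr_ge0.
    by rewrite -mulrA mulrC.
  by rewrite ler_wpM2l// expr2 ler_piMr.
set kap := 2 * (Num.sqrt eta)^-1 * (1 + L) * r2 in Gdist.
have kap0 : 0 <= kap by rewrite /kap mulr_ge0// mulr_ge0// addr_ge0.
rewrite !rE1 !rE2 !GE2.
have /andP[x1 x2] := Gm _ s2 mD21; rewrite m21 in x2.
have /andP[x3 x4] := Gm _ s2 mD12; rewrite m12 in x4.
have /andP[x5 x6] := Gm _ s2 mE1; rewrite m1 in x6.
have y1 := Gdist _ mD21; rewrite m21 in y1.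
have y2 := Gdist _ mD12; rewrite m12 in y2.
have y3 := Gdist _ mE1; rewrite m1 in y3.
set a1 := (U t1)^-1 in a10 a1c da *; set a0 := (U s1)^-1 in da *.
set b1 := (U t2)^-1 in b10 b1c db *; set b0 := (U s2)^-1 in db *.
move: (G E1 t2) (G E1 s2) (G (E2 `\` E1) t2) (G (E2 `\` E1) s2)
  (G (E1 `\` E2) t2) (G (E1 `\` E2) s2) x1 x2 x3 x4 x5 x6 y1 y2 y3
  => g1t g1s g2t g2s g3t g3s x1 x2 x3 x4 x5 x6 y1 y2 y3.
have l0 : 0 <= c ^- 2 * L by rewrite mulr_ge0.
have m0 : 0 <= M * (k / 2) + Cp by rewrite addr_ge0// mulr_ge0// divr_ge0.
have kk0 : 0 <= 2 * (Num.sqrt eta)^-1 * (1 + L) by rewrite mulr_ge0// addr_ge0.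
exact: (covariance_combination cV0 l0 m0 kk0 r10 r20 alpha0 alpha1 a10 a1c b10 b1c
  da db p0 pb x1 x2 x3 x4 x5 x6 y1 y2 y3).
Qed.

End RhoEstimates.

(** * Consequences of the assumption on the initial density *)

Lemma schwartz_bounded {R : realType} (f : R -> R) : schwartz f ->
  exists M, forall x, f x <= M.
Proof.
case=> _ /(_ 0%N 0%N)[M HM]; exists M => x.
have := HM _ (imageP _ (I : setT x)); rewrite expr0 /=; apply: le_trans.
by apply: le_trans (ler_norm _) _; rewrite ler_peMl// lerDl.
Qed.

Lemma schwartz_lipschitz {R : realType} (f : R -> R) : schwartz f ->
  exists2 K, 0 < K & forall x y, `|f x - f y| <= K * `|x - y|.
Proof.
case=> df /(_ 0%N 1%N)[M HM].
have dM x : `|derive1 f x| <= Num.max M 1.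
  have := HM _ (imageP _ (I : setT x)); rewrite expr0 /= le_max => h.
  by apply/orP; left; apply: le_trans h; rewrite ler_peMl// lerDl.
have df0 x : derivable f x 1 by exact: (df 0%N x).
exists (Num.max M 1); first by rewrite lt_max ltr01 orbT.
have lip x y : x <= y -> `|f y - f x| <= Num.max M 1 * `|y - x|.
  move=> xy; have [||c _ ->] := @MVT_segment _ f (derive1 f) x y xy.
  - by move=> z _; rewrite derive1E; apply/derivableP.
  - by apply: derivable_within_continuous => z _.
  by rewrite normrM ler_wpM2r.
move=> x y; have [/lip|/ltW/lip//] := leP x y.
by rewrite (distrC (f x)) (distrC x).
Qed.

(** * The limit as an integral *)

(** The integrand [h] is only known at nonnegative times, where it agrees with a
    function [g] that is continuous on the whole line. *)
Lemma integral_increment_bounds {R : realType} (g h : R -> R) (s t m m' : R) :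
  continuous g -> (forall r, 0 <= r -> h r = g r) -> 0 <= s -> s <= t ->
  (forall r, s <= r -> r <= t -> m <= g r <= m') ->
  m * (t - s) <= \int[lebesgue_measure]_(r in `[0, t]) h r
    - \int[lebesgue_measure]_(r in `[0, s]) h r <= m' * (t - s).
Proof.
move=> cg hg s0 st bnd.
have hgI x : \int[lebesgue_measure]_(r in `[0, x]) h r = \int[lebesgue_measure]_(r in `[0, x]) g r.
  by apply: eq_Rintegral => r; rewrite inE/= in_itv/= => /andP[r0 _]; rewrite hg.
have ig0 (k : R -> R) : continuous k ->
    lebesgue_measure.-integrable `[0, t]%classic (EFin \o k).
  move=> ck; apply: continuous_compact_integrable; first exact: segment_compact.
  exact: continuous_subspaceT.
have ig (k : R -> R) : continuous k ->
    lebesgue_measure.-integrable `]s, t]%classic (EFin \o k).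
  move=> ck; apply: integrableS (ig0 k ck) => // r /=.
  by rewrite !in_itv/= => /andP[sr ->]; rewrite andbT (le_trans s0)// ltW.
have mu : fine (lebesgue_measure (`]s, t]%classic : set R)) = t - s.
  rewrite lebesgue_measure_itv/= lte_fin; case: ltP => //= ts.
  by rewrite (le_anti (introT andP (conj st ts))) subrr.
have ic (c : R) : continuous (fun _ : R => c) by move=> x; exact: cvg_cst.
rewrite !hgI Rintegral_itvB ?bnd_simp//; last exact: ig0.
rewrite -mu -!Rintegral_cst//.
by apply/andP; split; apply: le_Rintegral; rewrite ?ig// => r /=; rewrite in_itv/= => /andP[/ltW sr rt]; have /andP[] := bnd r sr rt.
Qed.

Section Compensator.
Context {R : realType}.
Variables (U : R -> R) (T c L delta a : R).
Hypothesis U_continuous : continuous (fun s : R => U (Num.max s 0)).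
Hypothesis U_gt0 : forall s, 0 <= s -> 0 < U s.
Hypotheses (c0 : 0 < c) (L0 : 0 <= L) (a0 : 0 <= a).
Hypothesis U_lower : forall s, 0 <= s -> s <= T -> c <= U s.
Hypothesis U_holder : forall s t, 0 <= s -> s < t -> t <= T -> t - s <= delta ->
  `|U t - U s| <= L * Num.sqrt (t - s).
Local Notation A t := (a * \int[lebesgue_measure]_(s in `[0, t]) (`|U s| ^- 2)).
Let g (r : R) := (U (Num.max r 0))^-1 * (U (Num.max r 0))^-1.

Let g_continuous : continuous g.
Proof.
move=> x; have Ux : U (Num.max x 0) != 0 by rewrite gt_eqF ?U_gt0// le_max lexx orbT.
by apply: cvgM; apply: cvgV => //; exact: U_continuous.
Qed.

Let gE r : 0 <= r -> g r = (U r)^-1 ^+ 2.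
Proof. by move=> r0; rewrite /g max_l// expr2. Qed.

Let hE r : 0 <= r -> `|U r| ^- 2 = g r.
Proof. by move=> r0; rewrite gE// exprVn real_normK// num_real. Qed.

Lemma compensator_increment s t : 0 <= s -> s <= t -> t <= T ->
  0 <= A t - A s <= a * c^-1 ^+ 2 * (t - s).
Proof.
move=> s0 st tT.
have /andP[h1 h2] : 0 * (t - s) <= \int[lebesgue_measure]_(r in `[0, t]) `|U r| ^- 2
    - \int[lebesgue_measure]_(r in `[0, s]) `|U r| ^- 2 <= c^-1 ^+ 2 * (t - s).
  apply: (integral_increment_bounds g_continuous hE s0 st) => r sr rt.
  have r0 := le_trans s0 sr; rewrite gE// sqr_ge0/=.
  have /andP[i0 ic] := inv_bound c0 (U_lower r0 (le_trans rt tT)).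
  by rewrite ler_pXn2r ?nnegrE// (le_trans i0).
rewrite mul0r in h1; rewrite -mulrBr -mulrA; apply/andP; split; first exact: mulr_ge0.
exact: ler_wpM2l.
Qed.

(** [U ^ -2] is 1/2-Hoelder, as [U] is and stays above [c]; so it differs from its
    value at [s] by a multiple of [sqrt (t - s)] throughout [[s, t]]. *)
Lemma compensator_asymptotics s t : 0 <= s -> s < t -> t <= T -> t - s <= delta ->
  `|A t - A s - a * (U s)^-1 ^+ 2 * (t - s)| <=
    a * (2 * c^-1 * (c ^- 2 * L)) * (Num.sqrt (t - s) * (t - s)).
Proof.
move=> s0 st tT ts; have ts0 : 0 < t - s by rewrite subr_gt0.
set D := 2 * c^-1 * (c ^- 2 * L); set r0 := Num.sqrt (t - s).
have cV0 : 0 <= c^-1 by rewrite invr_ge0 ltW.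
have c20 : 0 <= c ^- 2 by rewrite invr_ge0 exprn_ge0// ltW.
have D0 : 0 <= D by rewrite /D mulr_ge0 ?mulr_ge0.
have near r : s <= r -> r <= t -> `|g r - (U s)^-1 ^+ 2| <= D * r0.
  move=> sr rt; have r00 := le_trans s0 sr; have rT := le_trans rt tT.
  have sT := le_trans sr rT.
  rewrite gE//; have cs := U_lower s0 sT; have cr := U_lower r00 rT.
  have /andP[i1 i2] := inv_bound c0 cs; have /andP[i3 i4] := inv_bound c0 cr.
  have Ud : `|U r - U s| <= L * r0.
    move: sr; rewrite le_eqVlt => /orP[/eqP <-|sr].
      by rewrite subrr normr0 mulr_ge0// sqrtr_ge0.
    apply: (@le_trans _ _ (L * Num.sqrt (r - s))).
      by apply: U_holder => //; apply: le_trans ts; rewrite lerD2r.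
    by rewrite ler_wpM2l// ler_wsqrtr// lerD2r.
  rewrite subr_sqr normrM mulrC.
  have -> : D * r0 = 2 * c^-1 * (c ^- 2 * (L * r0)) by rewrite /D; ring.
  apply: ler_pM => //.
    rewrite ger0_norm ?addr_ge0//.
    have -> : 2 * c^-1 = c^-1 + c^-1 by ring.
    exact: lerD.
  by apply: le_trans (inv_dist c0 cr cs) _; rewrite ler_wpM2l.
have /andP[h1 h2] : ((U s)^-1 ^+ 2 - D * r0) * (t - s) <=
    \int[lebesgue_measure]_(r in `[0, t]) `|U r| ^- 2
    - \int[lebesgue_measure]_(r in `[0, s]) `|U r| ^- 2
    <= ((U s)^-1 ^+ 2 + D * r0) * (t - s).
  apply: (integral_increment_bounds g_continuous hE s0 (ltW st)) => r sr rt.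
  by have := near r sr rt; rewrite ler_distl.
have -> : a * D * (r0 * (t - s)) = a * (D * r0 * (t - s)) by ring.
rewrite -mulrBr -mulrA -mulrBr normrM (ger0_norm a0) ler_wpM2l//.
move: h1 h2; move: (\int[_]_(_ in _) _) (\int[_]_(_ in _) _) => I1 I2.
rewrite mulrBl mulrDl => h1 h2; rewrite ler_distl; apply/andP; split => //.
Qed.

End Compensator.

(** * The quartic variation *)

(** The variance of an increment is about [k * sqrt (t - s) / U s] with
    [k = sqrt (2 / pi)], and the fourth moment is three times its square: this is
    where [6 / pi] comes from. *)
Lemma limit_variance_constant {R : realType} : 3 * Num.sqrt (2 / pi) ^+ 2 = 6 / pi :> R.
Proof.
have p0 : 0 <= 2 / pi :> R by rewrite divr_ge0// pi_ge0.
by rewrite (sqr_sqrtr p0) mulrA -natrM.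
Qed.

Lemma sqrt_small {R : realType} (C e : R) : 0 <= C -> 0 < e -> exists2 m, 0 < m &
  forall x, 0 < x -> x <= m -> C * (Num.sqrt x * x) <= e * x.
Proof.
move=> C0 e0; have [m m0 Hm] := small_mul C0 e0.
exists (m ^+ 2); first exact: exprn_gt0.
move=> x x0 xm; rewrite mulrA ler_pM2r//; apply: le_trans Hm; rewrite ler_wpM2l//.
by rewrite -(ger0_norm (ltW m0)) -sqrtr_sqr ler_wsqrtr.
Qed.

Unset Implicit Arguments.
Set Strict Implicit.
Set Printing Implicit Defensive.

Theorem theorem3p7 (R : realType) (alpha : R)
  (alpha_gt0 : 0 < alpha) (alpha_lt1 : alpha < 1)
  (d : measure_display) (Omega : measurableType d) (P : probability Omega R)
  (B W : R -> {RV P >-> R})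
  (W_bm : standard_brownian_motion W)
  (B0_W_indep : independent_of_process (B 0) W)
  (B_eq : forall (t : R) (w : Omega), 0 <= t -> B t w = B 0 w + W t w)
  (f : R -> R) (f_schwartz : schwartz f)
  (f_density : is_density P (B 0) f)
  (u : R -> R -> R)
  (u0 : forall x : R, u x 0 = f x)
  (u_density : forall t : R, 0 < t -> is_density P (B t) (fun x => u x t))
  (u_continuous : forall t : R, 0 < t -> continuous (fun x => u x t))
  (q : R -> R)
  (q0_quantile : is_unique_quantile alpha (density_law f) (q 0))
  (f_q0_gt0 : 0 < f (q 0))
  (q_quantile : forall t : R, 0 < t ->
     is_quantile alpha (distribution P (B t)) (q t))
  (d' : measure_display) (Omega' : measurableType d')
  (P' : probability Omega' R)
  (F : R -> {RV P' >-> R})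
  (F_continuous : continuous_process F)
  (F_gaussian : gaussian_process F)
  (F_centered : centered_process F)
  (F_covariance : has_covariance F (rho alpha B u q)) :
  forall T : R, 0 < T ->
  forall eps : R, 0 < eps ->
  exists delta : R, 0 < delta /\
  forall p : nat -> R, is_partition p -> (mesh p < delta%:E)%E ->
    (\int[P']_w
       ereal_sup
         [set ((`|quartic_variation F p t w
                  - 6 / pi * \int[lebesgue_measure]_(s in `[0%R, t])
                               (`|u (q s) s| ^- 2)|%R ^+ 2)%R)%:E
         | t in `[0%R, T]] < eps%:E)%E.
Proof.
move=> T T0 eps eps0.
have [K K0 f_lip] := schwartz_lipschitz f_schwartz.
have [M f_le] := schwartz_bounded f_schwartz.
have B_taylor s : 0 <= s -> taylor2 K (Phi B s) (fun x => u x s).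
  exact: (Phi_taylor W_bm B0_W_indep B_eq f_density K0 f_lip f_le u0 u_density u_continuous).
have B_time s t x : 0 <= s -> s < t -> `|Phi B t x - Phi B s x| <= K * (t - s).
  exact: (Phi_time W_bm B0_W_indep B_eq f_density K0 f_lip f_le u0 u_density u_continuous).
have half_line x : `]-oo, x]%classic = [set y : R | y <= x].
  by apply/seteqP; split => y; rewrite /= in_itv.
have B_quantile s : 0 <= s -> Phi B s (q s) = alpha.
  rewrite le_eqVlt => /orP[/eqP <-|s0].
    case: f_density => _ _ /(_ `]-oo, q 0]%classic (measurable_itv _)).
    by rewrite (proj1 q0_quantile) half_line /Phi /pr => ->.
  have := q_quantile s s0; rewrite /is_quantile half_line => qE.
  have {}qE : P [set w | B s w <= q s] = alpha%:E by exact: qE.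
  by rewrite /Phi /pr qE.
have U_gt0 s : 0 <= s -> 0 < u (q s) s.
  rewrite le_eqVlt => /orP[/eqP <-|s0]; first by rewrite u0.
  exact: (u_gt0 W_bm B0_W_indep B_eq f_density K0 f_lip f_le u_density u_continuous _ f_q0_gt0).
have U_le s : 0 <= s -> 0 <= u (q s) s <= M.
  move=> s0; rewrite ltW ?U_gt0//=.
  exact: (u_le W_bm B0_W_indep B_eq f_density K0 f_lip f_le u0 u_density u_continuous).
have U_cont : continuous (fun s : R => u (q (Num.max s 0)) (Num.max s 0)).
  exact: (u_quantile_continuous K0 B_taylor B_time (Phi_mono B) B_quantile U_gt0).
have [c [L [del [c0 L0 del0 del1 [U_lower q_U_reg]]]]] :=
  quantile_regularity K0 B_taylor B_time (Phi_mono B) B_quantile U_gt0 (ltW T0).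
have a0 : 0 <= 6 / pi :> R by rewrite divr_ge0// pi_ge0.
pose A t := 6 / pi * \int[lebesgue_measure]_(s in `[0%R, t]) (`|u (q s) s| ^- 2).
have A0 : A 0 = 0 by rewrite /A set_itv1 Rintegral_set1 mulr0.
have U_holder s t : 0 <= s -> s < t -> t <= T -> t - s <= del ->
    `|u (q t) t - u (q s) s| <= L * Num.sqrt (t - s).
  by move=> s0 st tT /(q_U_reg s t s0 st tT)[].
have A_incr s t : 0 <= s -> s <= t -> t <= T ->
    0 <= A t - A s <= 6 / pi * c^-1 ^+ 2 * (t - s).
  exact: (compensator_increment U_cont U_gt0 c0 a0 U_lower).
have LA0 : 0 <= 6 / pi * c^-1 ^+ 2 :> R by rewrite mulr_ge0// sqr_ge0.
have rhoE s1 t1 s2 t2 : 0 <= s1 -> 0 <= t1 -> 0 <= s2 -> 0 <= t2 ->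
    Ex P' (fun w => (F t1 w - F s1 w) * (F t2 w - F s2 w)) =
    rho alpha B u q t1 t2 - rho alpha B u q t1 s2 - (rho alpha B u q s1 t2 - rho alpha B u q s1 s2).
  exact: (Ex_increments F_gaussian F_centered F_covariance).
have variance_asymp e : 0 < e -> exists2 delta, 0 < delta &
    forall s t, 0 <= s -> s < t -> t <= T -> t - s <= delta ->
    `|3 * Ex P' (fun w => (F t w - F s w) ^+ 2) ^+ 2 - (A t - A s)| <= e * (t - s).
  move=> e0.
  have [C C0 HC] := variance_asymptotics W_bm B0_W_indep B_eq alpha_gt0 alpha_lt1 K0 B_taylor
    B_quantile U_le c0 L0 del1 U_lower q_U_reg.
  have D0 : 0 <= 6 / pi * (2 * c^-1 * (c ^- 2 * L)) :> R.
    by rewrite mulr_ge0// !mulr_ge0// invr_ge0 ?exprn_ge0// ltW.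
  have [m m0 Hm] := sqrt_small (addr_ge0 C0 D0) e0.
  exists (Num.min del m); first by rewrite lt_min del0.
  move=> s t s0 st tT; rewrite le_min => /andP[ts_del ts_m].
  have t0 : 0 <= t by rewrite (le_trans s0)// ltW.
  have ts0 : 0 < t - s by rewrite subr_gt0.
  have := HC s t s0 st tT ts_del; rewrite limit_variance_constant -rhoE//.
  under [in X in X -> _]eq_fun do rewrite -expr2.
  have := compensator_asymptotics U_cont U_gt0 c0 L0 a0 U_lower U_holder s0 st tT ts_del.
  move: (Hm _ ts0 ts_m); rewrite -/(A t) -/(A s) mulrDl distrC.
  move: (_ * (_ * _)) (_ * (_ * _)) (3 * _) (_ * _ * (t - s)) (A t - A s) => x1 x2 y1 y2 y3 h1 h2 h3.
  apply: le_trans h1; have -> : y1 - y3 = (y1 - y2) + (y2 - y3) by ring.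
  by apply: le_trans (ler_normD _ _) (lerD h3 h2).
have covariance_decay eta : 0 < eta -> exists L, exists delta,
    [/\ 0 <= L, 0 < delta & forall s1 t1 s2 t2, 0 <= s1 -> s1 < t1 -> t1 + eta <= s2 ->
    s2 < t2 -> t2 <= T -> t1 - s1 <= delta -> t2 - s2 <= delta ->
    Ex P' (fun w => (F t1 w - F s1 w) * (F t2 w - F s2 w)) ^+ 2
      <= L * ((t1 - s1) * (t2 - s2))].
  move=> eta0.
  have [C C0 HC] := covariance_decay_rho W_bm B0_W_indep B_eq alpha_gt0 alpha_lt1 K0 B_taylor
    B_quantile U_le c0 L0 del1 U_lower q_U_reg eta0.
  exists (C ^+ 2), del; split => //; first exact: sqr_ge0.
  move=> s1 t1 s2 t2 s10 st1 t1s2 st2 t2T ts1 ts2.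
  have t10 : 0 <= t1 by rewrite (le_trans s10)// ltW.
  have s20 : 0 <= s2 by apply: le_trans t1s2; rewrite addr_ge0// ltW.
  have t20 : 0 <= t2 by rewrite (le_trans s20)// ltW.
  have := HC s1 t1 s2 t2 s10 st1 t1s2 st2 t2T ts1 ts2; rewrite -rhoE// => h.
  rewrite -(real_normK (num_real (Ex _ _))).
  have <- : (C * (Num.sqrt (t1 - s1) * Num.sqrt (t2 - s2))) ^+ 2 =
      C ^+ 2 * ((t1 - s1) * (t2 - s2)).
    by rewrite !exprMn !sqr_sqrtr// subr_ge0 ltW.
  by rewrite ler_pXn2r ?nnegrE// !mulr_ge0// sqrtr_ge0.
have L2 := L2_convergence F_gaussian F_centered T0 LA0 A0 A_incr
  variance_asymp covariance_decay.
exact: (uniform_L2_convergence T0 LA0 A_incr L2 eps0).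
Qed.
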